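(* Let $s\ge2$ be an integer. The algebra $HS^\infty(s)$ is closed under the smooth functional calculus for self-adjoint elements: if $a\in HS^\infty(s)$ is self-adjoint and $g$ is smooth on an open neighborhood of the spectrum of $a$, then $g(a)\in HS^\infty(s)$.
   Context: $\mathbb{Z}_s$ is the compact ring of $s$-adic integers $x=\sum_{j\ge0}x_js^j$, $0\le x_j\le s-1$ (i.e. $\varprojlim\mathbb{Z}/s^n\mathbb{Z}$), and $\mathbb{Z}_s^\times=\{x\in\mathbb{Z}_s: x_0\ne0\}$ (a clopen subset; the elements of $s$-adic norm $1$). $H=\ell^2(\mathbb{Z})$ has canonical basis $\{E_l\}_{l\in\mathbb{Z}}$; $VE_l=E_{sl}$ and $M_fE_l=f(l)E_l$ for $f\in C(\mathbb{Z}_s)$. $HS(s)\subseteq B(H)$ is the C$^*$-algebra generated by $V$ and all $M_f$, $f\in C(\mathbb{Z}_s)$. Every nonzero $l\in\mathbb{Z}$ is written uniquely as $l=s^ml'$ with $m\ge0$, $s\nmid l'$. For $F\in C_0(\mathbb{Z}_{\ge0}\times\mathbb{Z}_s^\times)$ put $M_FE_{s^ml'}=F(m,l')E_{s^ml'}$, $M_FE_0=0$. RD (rapid decay) means decaying faster than any inverse polynomial in the indices. $I_s^\infty\subseteq HS(s)$ is the set of norm-convergent sums $a=\sum_{n\ge0}V^nM_{F_n}+\sum_{n<0}M_{F_n}(V^* )^{-n}$ with $F_n\in C_0(\mathbb{Z}_{\ge0}\times\mathbb{Z}_s^\times)$ and $\{\sup_x|F_n(m,x)|\}_{m,n}$ RD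 in $(m,n)$. For $\phi\in C^\infty(\mathbb{R}/\mathbb{Z})$ with Fourier coefficients $\phi_m$, $T(\phi)=\sum_{m\ge0}\phi_mV^m+\sum_{m<0}\phi_m(V^* )^{-m}$ (norm convergent). The smooth Hensel-Steinitz algebra is $HS^\infty(s)=\{T(\phi)+c:\phi\in C^\infty(\mathbb{R}/\mathbb{Z}),\,c\in I_s^\infty\}$. The spectrum is taken in $HS(s)$ (a subset of $\mathbb{R}$ for self-adjoint $a$), and $g(a)$ is the continuous functional calculus in $HS(s)$. *)

(* Defs.v *)
From HB Require Import structures.
From mathcomp Require Import all_boot all_order all_algebra.
From mathcomp Require Import all_classical all_reals all_analysis.
From mathcomp Require Import complex.
From mathcomp Require Import ring lra.

Set Implicit Arguments.
Unset Strict Implicit.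
Unset Printing Implicit Defensive.

Import Order.TTheory GRing.Theory Num.Theory.
Import numFieldNormedType.Exports.
Import ComplexField Normc.

Local Open Scope classical_set_scope.
Local Open Scope ring_scope.
Local Open Scope complex_scope.

Section SquareSummable.
Variable R : realType.
Implicit Types x y : int -> R[i]^o.

Definition sqsum x : \bar R :=
  (\esum_(k in [set: int]) ((normc (x k) ^+ 2)%:E))%E.

Definition square_summable : {pred int -> R[i]^o} := fun x => (sqsum x < +oo)%E.

Lemma sqsum_ge0 x : (0 <= sqsum x)%E.
Proof. by apply: esum_ge0 => k _; rewrite lee_fin sqr_ge0. Qed.

Lemma normc_ge0 (z : R[i]) : 0 <= normc z.
Proof. by case: z => a b; exact: sqrtr_ge0. Qed.

Lemma sqsum_fin x : x \in square_summable -> sqsum x \is a fin_num.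
Proof. by move=> xs; rewrite ge0_fin_numE// sqsum_ge0. Qed.

Lemma sqsum0 : sqsum 0 = 0%E.
Proof. by apply: esum1 => k _; rewrite normc0 expr0n. Qed.

Lemma le_esumZ (c : R) (f : int -> R) : 0 <= c -> (forall k, 0 <= f k) ->
  (\esum_(k in [set: int]) ((c * f k)%:E) <=
   c%:E * \esum_(k in [set: int]) ((f k)%:E))%E.
Proof.
move=> c0 f0; apply: ge_ereal_sup => _ [X XT <-].
rewrite (eq_fsbigr (fun k => c%:E * (f k)%:E)%E); last by [].
rewrite -ge0_mule_fsumr; last by move=> k; rewrite lee_fin.
apply: lee_wpmul2l; first by rewrite lee_fin.
by apply: esum_ge; exists X.
Qed.

Lemma sqsumZ (c : R[i]) x :
  (sqsum (c *: x)%R <= (normc c ^+ 2)%:E * sqsum x)%E.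
Proof.
have -> : sqsum (c *: x) =
    (\esum_(k in [set: int]) ((normc c ^+ 2 * normc (x k) ^+ 2)%:E))%E.
  by apply: eq_esum => k _; rewrite -exprMn -normcM.
by apply: le_esumZ => [|k]; rewrite sqr_ge0.
Qed.

Lemma sqsumD (c : R) x y : 0 < c ->
  (sqsum (x + y)%R <= (1 + c)%:E * sqsum x + (1 + c^-1)%:E * sqsum y)%E.
Proof.
move=> c0; have ci0 : 0 < c^-1 by rewrite invr_gt0.
apply: (@le_trans _ _ (\esum_(k in [set: int])
    (((1 + c) * normc (x k) ^+ 2)%:E + ((1 + c^-1) * normc (y k) ^+ 2)%:E))%E).
  apply: le_esum => k _; rewrite -EFinD lee_fin.
  set u := normc (x k); set v := normc (y k).
  have u0 : 0 <= u := normc_ge0 _.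
  have v0 : 0 <= v := normc_ge0 _.
  apply: (@le_trans _ _ ((u + v) ^+ 2)).
    by rewrite lerXn2r ?nnegrE ?normc_ge0 ?addr_ge0//; exact: le_normcD.
  rewrite -subr_ge0.
  have -> : (1 + c) * u ^+ 2 + (1 + c^-1) * v ^+ 2 - (u + v) ^+ 2 =
      (c * u - v) ^+ 2 * c^-1.
    by field; rewrite gt_eqF.
  by rewrite mulr_ge0// ?sqr_ge0// ltW.
rewrite esumD; [|by move=> k _; rewrite lee_fin mulr_ge0 ?sqr_ge0// addr_ge0// ltW..].
by apply: leeD; apply: le_esumZ => [|k]; rewrite ?sqr_ge0// addr_ge0// ltW.
Qed.
End SquareSummable.

Section EllTwo.
Variable R : realType.

Lemma square_summable_submod : submod_closed (@square_summable R).
Proof.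
split; first by rewrite unfold_in sqsum0 ltry.
move=> c x y xs ys; rewrite unfold_in.
apply: le_lt_trans (sqsumD (c *: x) y ltr01) _.
have cxs : c *: x \in @square_summable R.
  rewrite unfold_in; apply: le_lt_trans (sqsumZ c x) _.
  by rewrite lte_mul_pinfty ?lee_fin ?sqr_ge0.
by rewrite lte_add_pinfty// lte_mul_pinfty ?lee_fin ?sqr_ge0 ?addr_ge0 ?invr_ge0.
Qed.

HB.instance Definition _ :=
  GRing.isSubmodClosed.Build R[i] (int -> R[i]^o) (@square_summable R)
    square_summable_submod.

Record l2 := L2 {
  l2_val :> int -> R[i]^o;
  l2_valP : l2_val \in @square_summable R }.

HB.instance Definition _ := [isSub for l2_val].
HB.instance Definition _ := [Choice of l2 by <:].
HB.instance Definition _ := [SubChoice_isSubLmodule of l2 by <:].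

Definition l2norm (x : l2) : R := Num.sqrt (fine (sqsum x)).

Lemma l2norm_ge0 x : 0 <= l2norm x. Proof. exact: sqrtr_ge0. Qed.

Lemma sqsumE (x : l2) : sqsum x = ((l2norm x) ^+ 2)%:E.
Proof.
by rewrite sqr_sqrtr ?fine_ge0 ?sqsum_ge0// fineK// sqsum_fin// l2_valP.
Qed.

Lemma l2norm0_eq0 x : l2norm x = 0 -> x = 0.
Proof.
move=> x0; apply/val_inj/funext => k /=; apply: eq0_normc.
apply/eqP; rewrite -sqrf_eq0 eq_le sqr_ge0 andbT -lee_fin.
apply: (@le_trans _ _ (sqsum x)); last by rewrite sqsumE x0 expr0n.
apply: esum_ge; exists [set k]; first by split.
by rewrite fsbig_set1.
Qed.

Lemma l2norm0 : l2norm 0 = 0.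
Proof. by rewrite /l2norm sqsum0 sqrtr0. Qed.

Lemma l2normD x y : l2norm (x + y) <= l2norm x + l2norm y.
Proof.
have [/l2norm0_eq0 -> |x0] := eqVneq (l2norm x) 0.
  by rewrite !add0r lerDr l2norm_ge0.
have [/l2norm0_eq0 -> |y0] := eqVneq (l2norm y) 0.
  by rewrite !addr0 lerDl l2norm_ge0.
have {}x0 : 0 < l2norm x by rewrite lt_def x0 l2norm_ge0.
have {}y0 : 0 < l2norm y by rewrite lt_def y0 l2norm_ge0.
rewrite -(@ler_pXn2r _ 2) ?nnegrE ?addr_ge0 ?l2norm_ge0//.
have := @sqsumD R (l2norm y / l2norm x) x y (divr_gt0 y0 x0).
rewrite -[(l2_val x + l2_val y)%R]/(l2_val (x + y)) !sqsumE -!EFinM -EFinD lee_fin.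
move/le_trans; apply; rewrite le_eqVlt; apply/orP; left; apply/eqP.
by field; rewrite !gt_eqF.
Qed.

Lemma l2normZ_le (c : R[i]) x : l2norm (c *: x) <= normc c * l2norm x.
Proof.
rewrite -(@ler_pXn2r _ 2) ?nnegrE ?mulr_ge0 ?normc_ge0 ?l2norm_ge0//.
by have := sqsumZ c x; rewrite -[(c *: _)%R]/(l2_val (c *: x)) !sqsumE -EFinM lee_fin exprMn.
Qed.

Lemma l2normZ (c : R[i]) x : l2norm (c *: x) = normc c * l2norm x.
Proof.
have [->|c0] := eqVneq c 0; first by rewrite scale0r l2norm0 normc0 mul0r.
apply/eqP; rewrite eq_le l2normZ_le/=.
have nc0 : 0 < normc c.
  by rewrite lt_def normc_ge0 andbT; apply: contra c0 => /eqP/eq0_normc ->.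
rewrite -ler_pdivlMl// -normcV -{1}[x]scale1r -(mulVf c0) -scalerA.
exact: l2normZ_le.
Qed.

Let nrm (x : l2) : R[i] := (l2norm x)%:C.

Let nrmD x y : nrm (x + y) <= nrm x + nrm y.
Proof. by rewrite /nrm -rmorphD lecR l2normD. Qed.

Let nrmZ (c : R[i]) x : nrm (c *: x) = `|c| * nrm x.
Proof. by rewrite /nrm l2normZ rmorphM. Qed.

Let nrm_eq0 x : nrm x = 0 -> x = 0.
Proof. by move=> /complexI/l2norm0_eq0. Qed.

HB.instance Definition _ := Lmodule_isNormed.Build R[i] l2 nrmD nrmZ nrm_eq0.

End EllTwo.

Section BoundedOperators.
Variable R : realType.

Definition bounded_op : {pred l2 R -> l2 R} := fun A =>
  `[< linear A /\ exists M : R, forall x, l2norm (A x) <= M * l2norm x >].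

Lemma bounded_opP (A : l2 R -> l2 R) : reflect
  (linear A /\ exists2 M : R, 0 <= M & forall x, l2norm (A x) <= M * l2norm x)
  (A \in bounded_op).
Proof.
apply: (iffP (asboolP _)) => -[lA [M]]; last by move=> _ AM; split=> //; exists M.
move=> AM; split=> //; exists (Num.max M 0) => [|x]; first by rewrite le_max lexx orbT.
by apply: le_trans (AM x) _; rewrite ler_wpM2r ?l2norm_ge0// le_max lexx.
Qed.

Lemma bounded_op_submod : submod_closed bounded_op.
Proof.
split.
  apply/bounded_opP; split; first by move=> c x y; rewrite scaler0 addr0.
  by exists 0 => // x; rewrite l2norm0 mul0r.
move=> c A B /bounded_opP[lA [M M0 AM]] /bounded_opP[lB [N N0 BN]].
have E x : (c *: A + B) x = c *: A x + B x by [].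
apply/bounded_opP; split.
  move=> d x y; rewrite !E lA lB !scalerDr !scalerA [c * d]GRing.mulrC.
  by rewrite addrACA.
exists (normc c * M + N); first by rewrite addr_ge0 ?mulr_ge0 ?normc_ge0.
move=> x; rewrite E; apply: (le_trans (l2normD _ _)).
rewrite [leRHS]mulrDl.
apply: lerD; last exact: BN.
rewrite l2normZ.
rewrite -mulrA.
by apply: ler_wpM2l; [exact: normc_ge0|exact: AM].
Qed.

HB.instance Definition _ :=
  GRing.isSubmodClosed.Build R[i] (l2 R -> l2 R) bounded_op bounded_op_submod.

Record bop := Bop {
  bop_fun :> l2 R -> l2 R;
  bop_funP : bop_fun \in bounded_op }.

HB.instance Definition _ := [isSub for bop_fun].
HB.instance Definition _ := [Choice of bop by <:].
HB.instance Definition _ := [SubChoice_isSubLmodule of bop by <:].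

Lemma bop_linear (A : bop) : linear A.
Proof. by have /bounded_opP[] := bop_funP A. Qed.

Lemma id_bounded_op : id \in bounded_op.
Proof. by apply/bounded_opP; split=> //; exists 1 => // x; rewrite mul1r. Qed.

Lemma comp_bounded_op (A B : bop) : A \o B \in bounded_op.
Proof.
have /bounded_opP[lA [M M0 AM]] := bop_funP A.
have /bounded_opP[lB [N N0 BN]] := bop_funP B.
apply/bounded_opP; split; first by move=> c x y; rewrite /= lB lA.
exists (M * N); first by rewrite mulr_ge0.
by move=> x /=; apply: le_trans (AM _) _; rewrite -mulrA ler_wpM2l.
Qed.

Definition bop_one : bop := Bop id_bounded_op.
Definition bop_mul (A B : bop) : bop := Bop (comp_bounded_op A B).

Let mulA : associative bop_mul. Proof. by move=> A B C; exact/val_inj. Qed.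
Let mul1 : left_id bop_one bop_mul. Proof. by move=> A; exact/val_inj. Qed.
Let mulr1 : right_id bop_one bop_mul. Proof. by move=> A; exact/val_inj. Qed.
Let mulDl : left_distributive bop_mul +%R.
Proof. by move=> A B C; exact/val_inj. Qed.
Let mulDr : right_distributive bop_mul +%R.
Proof.
move=> A B C; apply/val_inj/funext => x /=.
by have := bop_linear A 1 (B x) (C x); rewrite !scale1r.
Qed.

HB.instance Definition _ :=
  GRing.Zmodule_isPzRing.Build bop mulA mul1 mulr1 mulDl mulDr.

Definition opnorm (A : bop) : R :=
  sup [set l2norm (A x) | x in [set x | l2norm x <= 1]].

Lemma bopZ (A : bop) c x : A (c *: x) = c *: A x.
Proof.
have A0 : A 0 = 0.
  by have := bop_linear A 1 0 0; rewrite scaler0 addr0 scale1r => /esym/eqP;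
     rewrite -subr_eq0 addrK => /eqP.
by have := bop_linear A c x 0; rewrite A0 !addr0.
Qed.

Lemma opnorm_has_sup (A : bop) :
  has_sup [set l2norm (A x) | x in [set x | l2norm x <= 1]].
Proof.
have /bounded_opP[lA [M M0 AM]] := bop_funP A; split.
  by exists (l2norm (A 0)), 0 => //=; rewrite l2norm0.
exists M => _ [x /= x1 <-]; apply: le_trans (AM x) _.
by rewrite -{2}[M]GRing.mulr1 ler_wpM2l.
Qed.

Lemma opnorm_ub (A : bop) x : l2norm (A x) <= opnorm A * l2norm x.
Proof.
have [/l2norm0_eq0 ->|x0] := eqVneq (l2norm x) 0.
  by rewrite -[X in A X](scale0r 0) bopZ scale0r !l2norm0 mulr0.
have {}x0 : 0 < l2norm x by rewrite lt_def x0 l2norm_ge0.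
have nx : normc ((l2norm x)^-1)%:C = (l2norm x)^-1.
  by rewrite /normc/= expr0n/= addr0 sqrtr_sqr ger0_norm// invr_ge0 ltW.
rewrite -ler_pdivrMr// mulrC -nx -l2normZ -bopZ.
apply: sup_upper_bound (opnorm_has_sup A) _ _.
by exists (((l2norm x)^-1)%:C *: x) => //=; rewrite l2normZ nx mulVf ?gt_eqF.
Qed.

Lemma opnorm_le (A : bop) M : (forall x, l2norm x <= 1 -> l2norm (A x) <= M) ->
  opnorm A <= M.
Proof.
move=> AM; apply: sup_le_ub; first by case: (opnorm_has_sup A).
by move=> _ [x /= x1 <-]; exact: AM.
Qed.

Lemma opnorm_ge0 A : 0 <= opnorm A.
Proof.
apply: le_trans (l2norm_ge0 (A 0)) _.
by apply: sup_upper_bound (opnorm_has_sup A) _ _; exists 0 => //=; rewrite l2norm0.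
Qed.

Let nrm (A : bop) : R[i] := (opnorm A)%:C.

Let nrmD A B : nrm (A + B) <= nrm A + nrm B.
Proof.
rewrite /nrm -rmorphD lecR; apply: opnorm_le => x x1.
rewrite -[(A + B) x]/(A x + B x); apply: (le_trans (l2normD _ _)).
by rewrite lerD//; apply: le_trans (opnorm_ub _ _) _;
   rewrite -[leRHS]GRing.mulr1 ler_wpM2l// opnorm_ge0.
Qed.

Lemma opnormZ_le (c : R[i]) A : opnorm (c *: A) <= normc c * opnorm A.
Proof.
apply: opnorm_le => x x1; rewrite -[(c *: A) x]/(c *: A x) l2normZ.
rewrite ler_wpM2l ?normc_ge0//; apply: le_trans (opnorm_ub _ _) _.
by rewrite -[leRHS]GRing.mulr1 ler_wpM2l// opnorm_ge0.
Qed.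

Let nrmZ (c : R[i]) A : nrm (c *: A) = `|c| * nrm A.
Proof.
rewrite -[`|c|]/((normc c)%:C) /nrm -rmorphM; congr (_%:C).
have [->|c0] := eqVneq c 0.
  rewrite scale0r normc0 mul0r; apply/eqP; rewrite eq_le opnorm_ge0 andbT.
  by apply: opnorm_le => x _; rewrite -[(0 : bop) x]/(0 : l2 R) l2norm0.
apply/eqP; rewrite eq_le opnormZ_le/=.
have nc0 : 0 < normc c.
  by rewrite lt_def normc_ge0 andbT; apply: contra c0 => /eqP/eq0_normc ->.
rewrite -ler_pdivlMl// -normcV -{1}[A]scale1r -(mulVf c0) -scalerA.
exact: opnormZ_le.
Qed.

Let nrm_eq0 A : nrm A = 0 -> A = 0.
Proof.
move=> /complexI A0; apply/val_inj/funext => x; apply: l2norm0_eq0.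
by apply/eqP; rewrite eq_le l2norm_ge0 andbT -(mul0r (l2norm x)) -A0 opnorm_ub.
Qed.

HB.instance Definition _ := Lmodule_isNormed.Build R[i] bop nrmD nrmZ nrm_eq0.

End BoundedOperators.

Section Basis.
Variable R : realType.

Lemma delta_square_summable (l : int) :
  (fun k => (k == l)%:R) \in @square_summable R.
Proof.
rewrite unfold_in /sqsum (esumID [set l]); last first.
  by move=> k _; rewrite lee_fin sqr_ge0.
rewrite !setTI esum_set1; last by rewrite lee_fin sqr_ge0.
rewrite esum1 ?adde0 ?ltry// => k /= kl.
have -> : (k == l) = false by apply/eqP.
by rewrite normc0 expr0n.
Qed.

Definition basis_vec (l : int) : l2 R := L2 (delta_square_summable l).

End Basis.

Section WeightedShift.
Variables (R : realType) (p : int -> int) (w : int -> R[i]) (B : R).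
Hypotheses (pinj : injective p) (wB : forall l, normc (w l) <= B).

Let q (k : int) : int := xget 0 [set l | p l = k].
Let qp l : q (p l) = l.
Proof. by apply: pinj; apply: (@xgetPex _ 0 [set m | p m = p l]); exists l. Qed.
Let f (x : l2 R) : int -> R[i]^o :=
  fun k => if p (q k) == k then w (q k) * x (q k) else 0.

Let B0 : 0 <= B. Proof. exact: le_trans (normc_ge0 _) (wB 0). Qed.

Let sqf x : (sqsum (f x) <= (B ^+ 2)%:E * sqsum x)%E.
Proof.
rewrite /sqsum (esumID (range p)); last by move=> k _; rewrite lee_fin sqr_ge0.
rewrite !setTI [X in (_ + X)%E]esum1 ?adde0; last first.
  move=> k /= kp; rewrite /f; case: eqP => [e|_]; last by rewrite normc0 expr0n.
  by case: kp; exists (q k).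
rewrite esum_image; last by move=> ? ? _ _; exact: pinj.
apply: le_trans (le_esumZ (sqr_ge0 _) (fun k => sqr_ge0 _)).
apply: le_esum => l _; rewrite lee_fin /f qp eqxx normcM exprMn.
by rewrite ler_wpM2r ?sqr_ge0// lerXn2r ?nnegrE ?normc_ge0.
Qed.

Let f2 x : f x \in @square_summable R.
Proof.
rewrite unfold_in; apply: le_lt_trans (sqf x) _.
by rewrite lte_mul_pinfty ?lee_fin ?sqr_ge0// -ge0_fin_numE ?sqsum_ge0// sqsum_fin// l2_valP.
Qed.

Let A (x : l2 R) : l2 R := L2 (f2 x).

Let Abd : A \in @bounded_op R.
Proof.
apply/bounded_opP; split.
  move=> c x y; apply/val_inj/funext => k.
  rewrite [RHS]/(c * f x k + f y k) [LHS]/(f (c *: x + y) k) /f.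
  case: eqP => _; last by rewrite mulr0; exact: (esym (addr0 (0 : R[i]))).
  rewrite -[(c *: x + y) _]/(c * x _ + y _).
  by rewrite mulrDr mulrCA.
exists B => // x; rewrite -(@ler_pXn2r _ 2) ?nnegrE ?mulr_ge0 ?l2norm_ge0//.
by rewrite -lee_fin -sqsumE exprMn EFinM -sqsumE; exact: sqf.
Qed.

Lemma weighted_shift_exists :
  exists A : bop R, forall l, A (basis_vec R l) = w l *: basis_vec R (p l).
Proof.
exists (Bop Abd) => l; apply/val_inj/funext => k.
have bE m n : basis_vec R m n = (n == m)%:R :> R[i]^o by [].
rewrite [RHS]/(w l * basis_vec R (p l) k) [LHS]/(f (basis_vec R l) k) /f !bE.
case: eqP => [e|ne].
  have -> : (k == p l) = (q k == l) by rewrite -{1}e (inj_eq pinj).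
  case: (eqVneq (q k) l) => [<-|_]; first by []. exact: (etrans (mulr0 _) (esym (mulr0 _))).
have [kp|] := eqVneq k (p l); last by move=> _; exact: (esym (mulr0 _)).
by case: ne; rewrite kp qp.
Qed.
End WeightedShift.

Section HenselSteinitz.
Variables (R : realType) (s : nat).

(* Bilateral sums, the terms of index k and -(k+1) being added together; all
   the sums below are absolutely convergent, so that this order is immaterial. *)
Definition bilateral_series (W : normedModType R[i]) (u : int -> W) : nat -> W :=
  series (fun k : nat => u (Posz k) + u (Negz k)).

Definition bilateral_sum (W : normedModType R[i]) (u : int -> W) : W :=
  limn (bilateral_series u).

Definition dotp (x y : l2 R) : R[i] :=
  bilateral_sum (fun k => (x k * conjc (y k) : R[i]^o)).

Definition adjoint (A B : bop R) : Prop :=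
  forall x y, dotp (A x) y = dotp x (B y).

(* The operator described by P. In all the uses below it exists (see
   weighted_shift_exists for operators given on the canonical basis) and is
   unique, so that the default value 0 plays no role. *)
Definition the_op (P : set (bop R)) : bop R := xget 0 P.

Definition adj (A : bop R) : bop R := the_op [set B | adjoint A B].

Definition shiftV : bop R :=
  the_op [set A | forall l, A (basis_vec R l) = basis_vec R (s%:Z * l)].

Lemma shiftVE (l : int) : (0 < s)%N ->
  shiftV (basis_vec R l) = basis_vec R (s%:Z * l).
Proof.
move=> s0.
have := @xgetPex _ (0 : bop R)
  [set A | forall l, A (basis_vec R l) = basis_vec R (s%:Z * l)].
move=> /(_ _)/(_ l); apply.
have [||A hA] := @weighted_shift_exists R (fun l => s%:Z * l) (fun=> 1) 1.
- by move=> x y /mulfI; apply; rewrite eqz_nat -lt0n.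
- by move=> _; rewrite normc1.
by exists A => m; rewrite hA scale1r.
Qed.

(* The s-adic integers as sequences of digits; 'Z_s is Z/sZ since s >= 2. *)
Definition Zs : Type := prod_topology (fun _ : nat => discrete_topology 'Z_s).

HB.instance Definition _ := Topological.on Zs.

Definition Zs_unit : set Zs := [set x | x 0%N != 0 :> 'Z_s].

(* Floor division makes this the s-adic expansion for negative l as well. *)
Definition Zs_of_int (l : int) : Zs :=
  fun j : nat => ((l %/ s%:Z ^+ j)%Z)%:~R : 'Z_s.

Definition mult (f : Zs -> R[i]) : bop R :=
  the_op [set A | forall l, A (basis_vec R l) = f (Zs_of_int l) *: basis_vec R l].

Record cstar_subalgebra (S : set (bop R)) : Prop := CstarSubalgebra {
  cstar_closed : closed S;
  cstar_linear : forall c A B, S A -> S B -> S (c *: A + B);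
  cstar_mul : forall A B, S A -> S B -> S (A * B);
  cstar_adjoint : forall A B, adjoint A B -> S A -> S B }.

Definition HS : set (bop R) :=
  smallest cstar_subalgebra
    ([set shiftV] `|` [set mult f | f in [set f : Zs -> R[i]^o | continuous f]]).

Definition C0_units (F : nat * Zs -> R[i]) : Prop :=
  let X := [set p : nat * Zs | Zs_unit p.2] in
  {within X, continuous (F : nat * Zs -> R[i]^o)} /\
  forall e : R, 0 < e -> exists K : set (nat * Zs),
    [/\ compact K, K `<=` X & forall p, X p -> ~ K p -> normc (F p) < e].

Definition mult_units (F : nat * Zs -> R[i]) : bop R :=
  the_op [set A | A (basis_vec R 0) = 0 /\
    forall (m : nat) (l : int), ~~ (s%:Z %| l)%Z ->
      A (basis_vec R (s%:Z ^+ m * l)) =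
        F (m, Zs_of_int l) *: basis_vec R (s%:Z ^+ m * l)].

Definition rapid_decay (u : nat -> int -> R) : Prop :=
  forall k : nat, exists C : R, forall (m : nat) (n : int),
    `|u m n| * (1 + m%:R + `|n|%N%:R) ^+ k <= C.

Definition Iinf_term (F : int -> nat * Zs -> R[i]) (n : int) : bop R :=
  match n with
  | Posz k => shiftV ^+ k * mult_units (F n)
  | Negz k => mult_units (F n) * adj shiftV ^+ k.+1
  end.

Definition Iinf : set (bop R) := [set a | exists F : int -> nat * Zs -> R[i],
  [/\ forall n, C0_units (F n),
      rapid_decay (fun m n => sup [set normc (F n (m, x)) | x in Zs_unit]) &
      bilateral_series (Iinf_term F) @ \oo --> a]].

Definition smooth_on (U : set R) (g : R -> R[i]) : Prop :=
  forall (n : nat) (t : R), U t ->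
    derivable (derive1n n (fun t => complex.Re (g t))) t 1 /\
    derivable (derive1n n (fun t => complex.Im (g t))) t 1.

Definition smooth_circle (phi : R -> R[i]) : Prop :=
  smooth_on setT phi /\ forall t, phi (t + 1) = phi t.

Definition integral01 (h : R -> R[i]) : R[i] :=
  (\int[lebesgue_measure]_(t in `[0, 1]) complex.Re (h t)) +i*
  (\int[lebesgue_measure]_(t in `[0, 1]) complex.Im (h t)).

Definition fourier_coef (phi : R -> R[i]) (m : int) : R[i] :=
  integral01 (fun t => let w := 2 * pi * m%:~R * t in
    phi t * (cos w -i* sin w)).

Definition toeplitz_term (phi : R -> R[i]) (m : int) : bop R :=
  match m with
  | Posz k => fourier_coef phi m *: shiftV ^+ k
  | Negz k => fourier_coef phi m *: adj shiftV ^+ k.+1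
  end.

Definition toeplitz (phi : R -> R[i]) : bop R := bilateral_sum (toeplitz_term phi).

Definition HSinf : set (bop R) :=
  [set a | exists phi c, [/\ smooth_circle phi, Iinf c & a = toeplitz phi + c]].

Definition self_adjoint (a : bop R) : Prop := adjoint a a.

Definition spectrum (a : bop R) : set R[i] := [set z | ~ exists b : bop R,
  [/\ HS b, (a - z *: (1 : bop R)) * b = 1 & b * (a - z *: (1 : bop R)) = 1]].

(* For a self-adjoint a this is the whole spectrum. *)
Definition real_spectrum (a : bop R) : set R := [set t | spectrum a t%:C].

(* Phi is the continuous functional calculus of the self-adjoint element a of
   HS(s), i.e. the unique unital *-homomorphism from C(spectrum a) to HS(s) that
   maps the identity function to a; an element of C(spectrum a) is represented
   by the functions on R that restrict to it. *)
Record continuous_calculus (a : bop R) (Phi : (R -> R[i]) -> bop R) : Prop :=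
  ContinuousCalculus {
  calculus_HS : forall f,
    {within real_spectrum a, continuous (f : R -> R[i]^o)} -> HS (Phi f);
  calculus_ext : forall f h,
    {within real_spectrum a, continuous (f : R -> R[i]^o)} ->
    (forall t, real_spectrum a t -> f t = h t) -> Phi f = Phi h;
  calculus_linear : forall (c : R[i]) f h,
    {within real_spectrum a, continuous (f : R -> R[i]^o)} ->
    {within real_spectrum a, continuous (h : R -> R[i]^o)} ->
    Phi (fun t => c * f t + h t) = c *: Phi f + Phi h;
  calculus_mul : forall f h,
    {within real_spectrum a, continuous (f : R -> R[i]^o)} ->
    {within real_spectrum a, continuous (h : R -> R[i]^o)} ->
    Phi (fun t => f t * h t) = Phi f * Phi h;
  calculus_adjoint : forall f,
    {within real_spectrum a, continuous (f : R -> R[i]^o)} ->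
    adjoint (Phi f) (Phi (fun t => conjc (f t)));
  calculus_one : Phi (fun=> 1) = 1;
  calculus_id : Phi (fun t => t%:C) = a }.

End HenselSteinitz.

(* Main.v *)
(* Let N E_l = nu(l) E_l, where nu is the s-adic valuation, truncated so as to be
   bounded; all estimates are uniform in the truncation. For a in HS^oo(s) the
   iterated commutators of N with a are bounded, and so are N^p [V, a] N^q and
   N^p [V^*, a] N^q for all p and q, because Toeplitz operators almost commute with
   V and the remaining part of a is rapidly decaying.

   These bounds pass to g(a). After extending g from the spectrum to a smooth
   function on the line and rescaling, g(a) is the limit of sums of c_k T_k(a), with
   T_k the Chebyshev polynomials and c_k rapidly decaying. As the norm of U_(k-1)(a)
   is at most k, the commutator bounds for T_k(a) grow polynomially in k.

   Conversely, an element G of HS(s) satisfying the bounds is in HS^oo(s). Along the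
   n-th diagonal, the entries of G at (s^i l, s^j l), i - j = n, converge rapidly to
   a limit phi_n as i grows, and phi_n does not depend on l. The phi_n are the
   Fourier coefficients of the Toeplitz part of G. The differences to the limit
   extend continuously from the integers l not divisible by s to Z_s^x, which gives the F_n. *)

Require Import Defs.
From HB Require Import structures.
From mathcomp Require Import all_boot all_order all_algebra.
From mathcomp Require Import all_classical all_reals all_analysis.
From mathcomp Require Import complex.
From mathcomp Require Import ring lra zify.

Set Implicit Arguments.
Unset Strict Implicit.
Unset Printing Implicit Defensive.

Import Order.TTheory GRing.Theory Num.Theory.
Import numFieldNormedType.Exports.

Local Open Scope classical_set_scope.
Local Open Scope ring_scope.

(** * Smooth functions on the line *)

Section SmoothGerms.
Variable R : realType.
Implicit Types (f g : R -> R) (x y : R) (n : nat).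

(** A product rule iterated along the Chebyshev recursion would give commutator bounds exponential
    in [k], which rapid decay does not absorb. But the recursion solves to a convolution: a
    commutator with [U_(k-1)(a)] is a sum of at most [k] products in which one commutator with [a]
    stands between two such polynomials, so every further commutator costs only a polynomial factor.
    The truncation makes all seminorms continuous, with a constant that depends on its level. Limits
    are therefore taken at a fixed level, and only bounds common to all levels are kept. The bounds
    govern the decay along the diagonals of [G]. That its entries vanish off the orbits of
    multiplication by [s], are uniformly continuous in [l] and have limits independent of [l] is
    drawn from membership in [HS s]: these properties hold for finite sums of words in the
    generators and pass to norm limits. The vector [E_0] is fixed by [V] and unseen by the other
    entries; its coefficient is recovered through almost invariant vectors on the orbit of [E_1]. *)

Fixpoint nsmooth n f x : Prop :=
  if n is n'.+1 then (\forall y \near x, derivable f y 1) /\ nsmooth n' (derive1 f) x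
  else True.

Lemma near_eq_derive1 f g x : (\forall y \near x, f y = g y) ->
  \forall y \near x, derive1 f y = derive1 g y.
Proof.
move=> fg; have := near_join fg; apply: filterS => y fgy.
by rewrite !derive1E; apply: near_eq_derive.
Qed.

(** Derivability is required near [x] at every order, not only at [x], so the predicate depends on
    the germ alone and local formulas for derivatives can be substituted freely. *)
Lemma nsmooth_near_eq n f g x : (\forall y \near x, f y = g y) -> nsmooth n f x -> nsmooth n g x.
Proof.
elim: n f g => [//|n IH] f g fg /= [df sf]; split.
  near=> y; apply: (@near_eq_derivable _ _ _ f); last by near: y.
  by near: y; exact: (near_join fg).
by apply: IH sf; exact: near_eq_derive1.
Unshelve. all: by end_near. Qed.

Lemma nsmoothW n f x : nsmooth n.+1 f x -> nsmooth n f x.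
Proof. by elim: n f => [//|n IH] f [df sf]; split=> //; exact: IH. Qed.

Lemma derive1_is_derive f x : derivable f x 1 -> is_derive x 1 f (derive1 f x).
Proof. by rewrite derive1E => /derivableP. Qed.

Lemma is_derive_derive1 f x d : is_derive x 1 f d -> derive1 f x = d.
Proof. by rewrite derive1E => -[_ ->]. Qed.

(** Lets each closure lemma supply an explicit formula for the derivative near [x] in place of
    [derive1]. *)
Lemma nsmooth_is_derive n f f' x : (\forall y \near x, is_derive (y : R) (1 : R) f (f' y)) ->
  nsmooth n f' x -> nsmooth n.+1 f x.
Proof.
move=> ff' sf'; split; first by apply: filterS ff' => y [].
by apply: nsmooth_near_eq sf'; apply: filterS ff' => y /is_derive_derive1.
Qed.

Lemma nsmooth_cst n c x : nsmooth n (fun=> c) x.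
Proof.
elim: n c => [//|n IH] c; apply: (@nsmooth_is_derive _ _ (fun=> 0)) => //.
by apply: filterE => y; exact: is_derive_cst.
Qed.

Lemma nsmooth_id n x : nsmooth n id x.
Proof.
case: n => [//|n]; apply: (@nsmooth_is_derive _ _ (fun=> 1)); last exact: nsmooth_cst.
by apply: filterE => y; exact: is_derive_id.
Qed.

Lemma nsmoothD n f g x : nsmooth n f x -> nsmooth n g x -> nsmooth n (fun y => f y + g y) x.
Proof.
elim: n f g => [//|n IH] f g [df sf] [dg sg].
apply: (@nsmooth_is_derive _ _ (fun y => derive1 f y + derive1 g y)); last exact: IH.
by apply: filterS2 df dg => y fy gy; apply: is_deriveD; exact: derive1_is_derive.
Qed.

Lemma nsmoothM n f g x : nsmooth n f x -> nsmooth n g x -> nsmooth n (fun y => f y * g y) x.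
Proof.
elim: n f g => [//|n IH] f g sf' sg'; have [df sf] := sf'; have [dg sg] := sg'.
apply: (@nsmooth_is_derive _ _ (fun y => f y * derive1 g y + g y * derive1 f y)).
  by apply: filterS2 df dg => y fy gy; apply: is_deriveM; exact: derive1_is_derive.
by apply: nsmoothD; apply: IH => //; exact: nsmoothW.
Qed.

Lemma nsmoothZ n c f x : nsmooth n f x -> nsmooth n (fun y => c * f y) x.
Proof. by apply: nsmoothM; exact: nsmooth_cst. Qed.

Lemma nsmoothN n f x : nsmooth n f x -> nsmooth n (fun y => - f y) x.
Proof.
move=> /(nsmoothZ (-1)); apply: nsmooth_near_eq; apply: filterE => y; exact: mulN1r.
Qed.

Lemma nsmoothB n f g x : nsmooth n f x -> nsmooth n g x -> nsmooth n (fun y => f y - g y) x.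
Proof. by move=> sf /nsmoothN; exact: nsmoothD. Qed.

Lemma nsmooth_sum (I : Type) (r : seq I) n (f : I -> R -> R) x :
  (forall i, nsmooth n (f i) x) -> nsmooth n (fun y => \sum_(i <- r) f i y) x.
Proof.
move=> sf; elim: r => [|i r IH].
  by apply: nsmooth_near_eq (@nsmooth_cst n 0 x); apply: filterE => y; rewrite big_nil.
by apply: nsmooth_near_eq (nsmoothD (sf i) IH); apply: filterE => y; rewrite big_cons.
Qed.

Lemma derivable_continuous f x : derivable f x 1 -> {for x, continuous f}.
Proof. by move=> /derivable1_diffP/differentiable_continuous. Qed.

Lemma nsmooth_continuous f x : nsmooth 1 f x -> {for x, continuous f}.
Proof. by move=> [/nbhs_singleton df _]; exact: derivable_continuous. Qed.

Lemma nsmooth_comp n f g x : nsmooth n g x -> nsmooth n f (g x) -> nsmooth n (f \o g) x.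
Proof.
elim: n f g => [//|n IH] f g sg' sf'; have [df sf] := sf'; have [dg sg] := sg'.
have cg : {for x, continuous g}.
  by apply: derivable_continuous; exact: nbhs_singleton dg.
apply: (@nsmooth_is_derive _ _ (fun y => (derive1 f \o g) y * derive1 g y)).
  have dfg : \forall y \near x, derivable f (g y) 1 by exact: (cg [set z : R | derivable f z (1 : R)] df).
  by apply: filterS2 dfg dg => y fy gy;
    apply: is_derive1_comp; exact: derive1_is_derive.
by apply: nsmoothM => //; apply: IH => //; exact: nsmoothW.
Qed.

(** The derivative of the inverse is again made of the inverse and of [derive1 f], at one order
    less, so the induction closes. *)
Lemma nsmoothV n f x : f x != 0 -> nsmooth n f x -> nsmooth n (fun y => (f y)^-1) x.
Proof.
move=> fx0; elim: n => [//|n IH] sf'; have [df sf] := sf'.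
have cf : {for x, continuous f}.
  by apply: derivable_continuous; exact: nbhs_singleton df.
apply: (@nsmooth_is_derive _ _ (fun y => - ((f y)^-1 * (f y)^-1 * derive1 f y))).
  apply: filterS2 (cvgr_neq0 _ cf fx0) df => y fy0 dfy.
  have -> : - ((f y)^-1 * (f y)^-1 * derive1 f y) = - (f y) ^- 2 *: derive1 f y.
    by rewrite /GRing.scale/= expr2 invfM mulNr.
  by apply: is_deriveV => //; exact: derive1_is_derive.
apply: nsmoothN; apply: nsmoothM => //.
by have := IH (nsmoothW sf') => s; exact: nsmoothM.
Qed.

Lemma nsmooth_cos_sin n x : nsmooth n (@cos R) x /\ nsmooth n (@sin R) x.
Proof.
elim: n => [//|n [IHc IHs]]; split.
  apply: (@nsmooth_is_derive _ _ (fun y => - sin y)); last exact: nsmoothN.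
  by apply: filterE => y; exact: is_derive_cos.
apply: (@nsmooth_is_derive _ _ (@cos R)); last exact: IHc.
by apply: filterE => y; exact: is_derive_sin.
Qed.

(** With [nsmooth_derivable], the passage between this inductive predicate and the iterated
    derivatives that define [smooth_on]. *)
Lemma nsmooth_pos n f x : (forall k, (k < n)%N ->
  \forall y \near x, derivable (derive1n k f) y 1) -> nsmooth n f x.
Proof.
have iterS k g : derive1n k (derive1 g) = derive1n k.+1 g.
  by rewrite /derive1n iterSr.
elim: n f => [//|n IH] f H; split; first exact: (H 0).
by apply: IH => k kn; rewrite iterS; exact: H.
Qed.

Lemma nsmooth_derivable n f x : nsmooth n.+1 f x -> derivable (derive1n n f) x 1.
Proof.
have iterS k g : derive1n k (derive1 g) = derive1n k.+1 g.
  by rewrite /derive1n iterSr.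
elim: n f => [|n IH] f [df sf]; first exact: nbhs_singleton df.
by rewrite -iterS; exact: IH.
Qed.

End SmoothGerms.

(** * A smooth step built from exp(-1/x) *)

Section Cutoff.
Variable R : realType.
Implicit Types (f g : R -> R) (x y : R) (n : nat).

(** A quadratic remainder is the form in which derivatives are obtained where the usual rules do not
    apply: at the flat point 0, and term by term in a trigonometric series. *)
Lemma is_derive_quadratic f x d C r : 0 < r ->
  (forall h, `|h| < r -> `|f (h + x) - f x - d * h| <= C * h ^+ 2) ->
  is_derive x (1 : R) f d.
Proof.
move=> r0 H.
have C0 : 0 <= C.
  have r2 : 0 < r / 2 by rewrite divr_gt0.
  have := H (r / 2); rewrite gtr0_norm// ltr_pdivrMr// ltr_pMr// ltr1n => /(_ isT).
  by move/(le_trans (normr_ge0 _)); rewrite pmulr_lge0// exprn_gt0.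
suff cv : (fun h => h^-1 *: (f (h *: (1 : R) + x) - f x)) @ 0^' --> d.
  by constructor; [apply/cvg_ex; exists d|exact: cvg_lim].
apply/cvgrPdist_le => e e0; near=> h.
have h0 : h != 0 by near: h; exact: nbhs_dnbhs_neq.
have hr : `|h| < r.
  near: h; apply: dnbhs0_lt => //.
have he : `|h| < e / (C + 1).
  by near: h; apply: dnbhs0_lt; rewrite divr_gt0// ltr_wpDl.
rewrite distrC /GRing.scale/= mulr1.
have -> : h^-1 * (f (h + x) - f x) - d = h^-1 * (f (h + x) - f x - d * h).
  by field.
rewrite normrM normfV ler_pdivrMl ?normr_gt0//.
apply: le_trans (H h hr) _.
rewrite -real_normK ?num_real// expr2 mulrA [leRHS]mulrC.
rewrite ler_wpM2r//.
apply: (@le_trans _ _ ((C + 1) * `|h|)); first by rewrite ler_wpM2r// lerDl.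
by rewrite -ler_pdivlMl ?ltr_wpDl// mulrC ltW.
Unshelve. all: by end_near. Qed.

Lemma horner_le_pow (p : {poly R}) : exists2 C, 0 <= C &
  forall y, 1 <= y -> `|p.[y]| <= C * y ^+ size p.
Proof.
exists (\sum_(i < size p) `|p`_i|) => [|y y1]; first exact: sumr_ge0.
rewrite horner_coef mulr_suml; apply: le_trans (ler_norm_sum _ _ _) _.
apply: ler_sum => i _; rewrite normrM ler_wpM2l// normrX ger0_norm; last lra.
by rewrite ler_weXn2l// ltnW.
Qed.

(* This class of functions is stable under differentiation, hence consists of
   smooth functions. *)
Definition flat (p : {poly R}) x : R := if 0 < x then p.[x^-1] * expR (- x^-1) else 0.

(** The exponential dominates each term of its Taylor series. *)
Lemma expR_pow_le n y : 0 <= y -> y ^+ n.+1 * expR (- y) <= n.+1`!%:R.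
Proof.
move=> y0; rewrite expRN ler_pdivrMr ?expR_gt0//.
rewrite -ler_pdivrMl ?ltr0n ?fact_gt0// mulrC.
by apply: le_trans (expR_ge1Dxn n y0); rewrite lerDr.
Qed.

(** Away from 0 this is the chain rule in the variable [x^-1]; at 0 the exponential beats the
    polynomial with two powers of [x] to spare, whence derivative 0. *)
Lemma flat_derive p x : is_derive x (1 : R) (flat p) (flat ('X^2 * (p - p^`())) x).
Proof.
have [x0|x0|->] := ltgtP x 0.
- have -> : flat ('X^2 * (p - p^`())) x = 0 by rewrite /flat ltNge ltW.
  apply: (@near_eq_is_derive _ _ _ (fun=> 0)).
  by near=> y; rewrite /flat ltNge ltW//; near: y; exact: lt_nbhsl.
- apply: (@near_eq_is_derive _ _ _ (fun y => p.[y^-1] * expR (- y^-1))).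
    near=> y; rewrite /flat ifT//; near: y; exact: lt_nbhsr.
  rewrite /flat x0 !hornerE /=.
  have dV : is_derive x (1 : R) (fun y : R => y^-1) (- x ^- 2).
    rewrite -[X in is_derive _ _ _ X]mulr1.
    by apply: (@is_deriveV _ id) => //; rewrite gt_eqF.
  have dNV : is_derive x (1 : R) (fun y : R => - y^-1) (x ^- 2).
    by rewrite -[X in is_derive _ _ _ X]opprK; exact: is_deriveN.
  have dE : is_derive x (1 : R) (expR \o (fun y : R => - y^-1)) (expR (- x^-1) * x ^- 2).
    exact: is_derive1_comp.
  have dP : is_derive x (1 : R) (horner p \o (fun y : R => y^-1)) (p^`().[x^-1] * - x ^- 2).
    exact: is_derive1_comp.
  apply: (is_derive_eq (is_deriveM dP dE)).
  by rewrite /GRing.scale/= exprVn; ring.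
- have [C C0 HC] := horner_le_pow p.
  have -> : flat ('X^2 * (p - p^`())) 0 = 0 by rewrite /flat ltxx.
  (* The factorial comes from [expR_pow_le] at exponent [size p + 2]: [size p] powers absorb the
     polynomial and two remain. *)
  apply: (@is_derive_quadratic _ _ _ (C * (size p).+2`!%:R) 1) => // h h1.
  rewrite addr0 mul0r subr0 {2}/flat ltxx subr0 /flat.
  case: ifPn => [h0|_]; last by rewrite normr0 mulr_ge0 ?sqr_ge0// mulr_ge0.
  have hV1 : 1 <= h^-1 by rewrite invf_ge1// ltW// (le_lt_trans (ler_norm _)).
  rewrite normrM (ger0_norm (expR_ge0 _)).
  apply: le_trans (ler_wpM2r (expR_ge0 _) (HC _ hV1)) _.
  rewrite -!mulrA ler_wpM2l//.
  have := @expR_pow_le (size p).+1 (h^-1); rewrite invr_ge0 (ltW h0) => /(_ isT).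
  rewrite -ler_pdivrMr ?exprn_gt0//; apply: le_trans.
  rewrite 2![in leRHS]exprSr; set u := _ ^+ size p; set e := expR _.
  by rewrite le_eqVlt; apply/orP; left; apply/eqP; field; rewrite gt_eqF.
Unshelve. all: by end_near. Qed.

Lemma nsmooth_flat n p x : nsmooth n (flat p) x.
Proof.
elim: n p => [//|n IH] p; apply: nsmooth_is_derive (IH _).
by apply: filterE => y; exact: flat_derive.
Qed.

Definition step x : R := flat 1 x / (flat 1 x + flat 1 (1 - x)).

Lemma flat1_ge0 x : 0 <= flat 1 x.
Proof. by rewrite /flat; case: ifP => // _; rewrite hornerE mul1r expR_ge0. Qed.

Lemma flat1_gt0 x : 0 < x -> 0 < flat 1 x.
Proof. by rewrite /flat => ->; rewrite hornerE mul1r expR_gt0. Qed.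

Lemma flat_le0 p x : x <= 0 -> flat p x = 0.
Proof. by rewrite /flat ltNge => ->. Qed.

Lemma step_le0 x : x <= 0 -> step x = 0.
Proof. by move=> x0; rewrite /step flat_le0// mul0r. Qed.

Lemma step_ge1 x : 1 <= x -> step x = 1.
Proof.
move=> x1; rewrite /step (@flat_le0 _ (1 - x)) ?subr_le0// addr0 divff// gt_eqF//.
by rewrite flat1_gt0// (lt_le_trans ltr01).
Qed.

Lemma nsmooth_step n x : nsmooth n step x.
Proof.
apply: nsmoothM; first exact: nsmooth_flat.
apply: nsmoothV.
  have [x0|x0] := ltP 0 x; first by rewrite gt_eqF// ltr_pwDl ?flat1_ge0 ?flat1_gt0.
  by rewrite gt_eqF// ltr_wpDl ?flat1_ge0// flat1_gt0// subr_gt0 (le_lt_trans x0).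
apply: nsmoothD; first exact: nsmooth_flat.
apply: (@nsmooth_comp _ _ (flat 1) (fun y => 1 - y)); last exact: nsmooth_flat.
by apply: nsmoothB; [exact: nsmooth_cst|exact: nsmooth_id].
Qed.

End Cutoff.

(** * Smooth extension from a compact subset of the line *)

Section Extension.
Variable R : realType.

Lemma lebesgue_number (K U : set R) : compact K -> open U -> K `<=` U ->
  exists2 r : R, 0 < r & forall x y, K x -> `|x - y| < r -> U y.
Proof.
move=> /compact_near_coveringP cK oU KU.
pose P (r x : R) := forall y, `|x - y| < r -> U y.
have H : forall x, K x -> \forall x' \near x & r \near (0 : R)^'+, P r x'.
  move=> x /KU Ux.
  have /nbhs_ballP[e /= e0 xeU] : nbhs x U by exact: open_nbhs_nbhs.
  exists (ball x (e / 2), [set r | 0 < r < e / 2]) => /=.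
    split; first by apply: nbhsx_ballx; rewrite divr_gt0.
    by near=> r; apply/andP; split; near: r; [exact: nbhs_right_gt|exact: nbhs_right_lt (divr_gt0 e0 _)].
  move=> [x' r] [/= xx' /andP[r0 re]] y xy.
  apply: xeU; rewrite -ball_normE/=.
  have -> : x - y = (x - x') + (x' - y) by rewrite addrA subrK.
  apply: le_lt_trans (ler_normD _ _) _.
  rewrite [e in _ < e]splitr; apply: ltrD; last exact: lt_trans re.
  by rewrite -ball_normE in xx'.
have := cK _ _ P _ H => HH.
have [r []] : exists r, (0 : R) < r /\ K `<=` P r.
  have : \forall r \near (0 : R)^'+, 0 < r /\ K `<=` P r.
    by near=> r; split; near: r; [exact: nbhs_right_gt|exact: HH].
  by move=> /filter_ex[r]; exists r.
by move=> r0 KP; exists r => // x y /KP; apply.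
Unshelve. all: by end_near. Qed.

(** Differences of translates of [step] on a grid of mesh [r] telescope to a partition of unity.
    Keeping only the bumps whose interval meets [K] leaves the sum equal to 1 on [K] and supports it
    within distance [2 * r] of [K]. *)
Lemma smooth_cutoff (K U : set R) : compact K -> open U -> K `<=` U ->
  exists chi : R -> R, [/\ forall n x, nsmooth n chi x, forall x, K x -> chi x = 1 &
    forall x, ~ U x -> \forall y \near x, chi y = 0].
Proof.
move=> cK oU KU.
have [r3 r30 Kr] := lebesgue_number cK oU KU.
(* A third: two points of one interval [|u j x| <= 1] are at most [2 * r] apart, and one more [r]
   leaves room for a neighbourhood of [x]. *)
pose r := r3 / 3; have r0 : 0 < r by rewrite divr_gt0.
have [M [_ KM]] := compact_bounded cK.
have {}KM x : K x -> `|x| <= M + 1 by apply: KM; rewrite ltrDl.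
(* Large enough for the [J.*2.+1] bumps to sum to 1 on all of [K]. *)
pose J := (Num.truncn ((M + 1) / r)).+1.
have KJ x : K x -> `|x / r| <= J%:R.
  move=> /KM xM; apply: ltW; apply: le_lt_trans (truncnS_gt _).
  by rewrite normrM normfV (gtr0_norm r0) ler_pM2r// invr_gt0.
pose u j x : R := x / r + J%:R - j%:R.
pose eta j x : R := step (u j x + 1) - step (u j x).
pose b j : R := if `[< exists2 k, K k & `|u j k| <= 1 >] then 1 else 0.
have eta0 j x : 1 < `|u j x| -> eta j x = 0.
  rewrite /eta lter_normr => /orP[u1|u1].
    by rewrite !step_ge1 ?subrr//; lra.
  by rewrite !step_le0 ?subrr//; lra.
have ux j x y : u j x - u j y = (x - y) / r by rewrite /u; ring.
exists (fun x => \sum_(0 <= j < J.*2.+1) b j * eta j x); split.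
- have su n j x : nsmooth n (u j) x.
    apply: nsmoothB; last exact: nsmooth_cst.
    apply: nsmoothD; last exact: nsmooth_cst.
    by apply: nsmoothM; [exact: nsmooth_id|exact: nsmooth_cst].
  move=> n x; apply: nsmooth_sum => j; apply: nsmoothZ; apply: nsmoothB.
    apply: (@nsmooth_comp _ _ (@step R) (fun y => u j y + 1)); last exact: nsmooth_step.
    by apply: nsmoothD => //; exact: nsmooth_cst.
  by apply: (@nsmooth_comp _ _ (@step R) (u j)); last exact: nsmooth_step.
- move=> x Kx.
  rewrite (eq_bigr (fun j => eta j x)); last first.
    move=> j _; rewrite /b; case: asboolP => [_|H]; first by rewrite mul1r.
    rewrite mul0r eta0// ltNge; apply/negP => uj; apply: H; by exists x.
  have -> : \sum_(0 <= j < J.*2.+1) eta j x =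
      step (x / r + J%:R + 1) - step (x / r + J%:R + 1 - J.*2.+1%:R).
    elim: (J.*2.+1) => [|n IH]; first by rewrite big_nil subr0 subrr.
    rewrite big_nat_recr//= IH /eta /u -[n.+1]addn1 natrD.
    have -> : x / r + J%:R - n%:R + 1 = x / r + J%:R + 1 - n%:R by ring.
    have -> : x / r + J%:R + 1 - (n%:R + 1) = x / r + J%:R - n%:R by ring.
    by ring.
  have := KJ x Kx; rewrite ler_norml => /andP[x1 x2].
  rewrite step_ge1; last lra.
  rewrite step_le0 ?subr0// -addn1 -muln2 natrD natrM; lra.
- move=> x Ux; near=> y; rewrite big1// => j _; rewrite /b.
  case: asboolP => [[k Kk uk]|]; last by rewrite mul0r.
  rewrite eta0 ?mulr0// ltNge; apply/negP => uy; apply: Ux; apply: (Kr k) => //.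
  have xy : `|y - x| < r.
    by rewrite distrC; near: y; exact: nbhsx_ballx.
  have ky : `|k - y| <= 2 * r.
    rewrite -ler_pdivrMr// -(gtr0_norm r0) -normfV -normrM -(ux j).
    by apply: le_trans (ler_normB _ _) _; lra.
  have -> : k - x = (k - y) + (y - x) by rewrite addrA subrK.
  apply: le_lt_trans (ler_normD _ _) _.
  have -> : r3 = 3 * r by rewrite /r; field.
  by lra.
Unshelve. all: by end_near. Qed.

(** Outside [U] the product with the cutoff is smooth whatever [g] does there, since the cutoff
    vanishes in a neighbourhood. *)
Lemma smooth_extension (K U : set R) (g : R -> R) : compact K -> open U -> K `<=` U ->
  (forall n x, U x -> nsmooth n g x) ->
  exists2 h : R -> R, (forall n x, nsmooth n h x) & forall x, K x -> h x = g x.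
Proof.
move=> cK oU KU sg; have [chi [schi chi1 chi0]] := smooth_cutoff cK oU KU.
exists (fun x => g x * chi x) => [n x|x Kx]; last by rewrite chi1// mulr1.
have [Ux|Ux] := pselect (U x); first by apply: nsmoothM => //; exact: sg.
apply: (@nsmooth_near_eq _ _ (fun=> 0)); last exact: nsmooth_cst.
by apply: filterS (chi0 x Ux) => y ->; rewrite mulr0.
Qed.

End Extension.

(** * Global smoothness, periodicity and second differences *)

Section Smooth.
Variable R : realType.
Implicit Types (f g F : R -> R) (t u x y : R) (n p : nat).

Definition smooth f := forall n x, nsmooth n f x.

Lemma smooth_derive1 f : smooth f -> smooth (derive1 f).
Proof. by move=> sf n x; have [] := sf n.+1 x. Qed.

Lemma smooth_is_derive f : smooth f -> forall x, is_derive x (1 : R) f (derive1 f x).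
Proof.
by move=> sf x; have [/nbhs_singleton df _] := sf 1 x; exact: derive1_is_derive.
Qed.

Lemma smooth_continuous f : smooth f -> continuous f.
Proof. by move=> sf x; apply: nsmooth_continuous; exact: sf. Qed.

Lemma smooth_derive1n f n : smooth f -> smooth (derive1n n f).
Proof.
by move=> sf; elim: n => [//|n IH]; rewrite derive1nS; exact: smooth_derive1.
Qed.

Lemma derive1_periodic f : smooth f -> (forall x, f (x + 1) = f x) ->
  forall x, derive1 f (x + 1) = derive1 f x.
Proof.
move=> sf pf x; apply/esym/is_derive_derive1.
rewrite -[X in is_derive _ _ X](_ : f \o (fun y => y + 1) = f); last exact/funext.
rewrite -[X in is_derive _ _ _ X]mulr1.
apply: is_derive1_comp; first exact: smooth_is_derive.
rewrite -[X in is_derive _ _ _ X]addr0; apply: is_deriveD.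
Qed.

Lemma derive1n_periodic f n : smooth f -> (forall x, f (x + 1) = f x) ->
  forall x, derive1n n f (x + 1) = derive1n n f x.
Proof.
move=> sf pf; elim: n => [//|n IH] x; rewrite derive1nS.
by apply: derive1_periodic => //; exact: smooth_derive1n.
Qed.

Lemma periodic_frac f : (forall x, f (x + 1) = f x) ->
  forall x, exists2 y, 0 <= y < 1 & exists z : int, x = y + z%:~R /\ f x = f y.
Proof.
move=> pf.
have pn n x : f (x + n%:R) = f x.
  by elim: n x => [|n IH] x; [rewrite addr0|rewrite -addn1 natrD addrA pf].
have pz (z : int) x : f (x + z%:~R) = f x.
  case: z => n; first exact: pn.
  by rewrite NegzE mulrNz -[in RHS](subrK (n.+1%:R) x) pn.
move=> x; exists (x - (Num.floor x)%:~R).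
  by have := floor_itv x; rewrite intrD; lra.
exists (Num.floor x); rewrite subrK; split => //.
by rewrite -[in LHS](subrK (Num.floor x)%:~R x) pz.
Qed.

Lemma smooth_bounded_segment f a b : smooth f -> a <= b ->
  exists2 C, 0 <= C & forall x, a <= x <= b -> `|f x| <= C.
Proof.
move=> sf ab.
have cf : {within `[a, b], continuous (fun x => `|f x|)}.
  apply: continuous_subspaceT => x; apply: continuous_comp; last exact: norm_continuous.
  exact: smooth_continuous.
have [c _ H] := EVT_max ab cf.
by exists `|f c| => // x xab; apply: H; rewrite in_itv.
Qed.

Lemma smooth_periodic_bounded f n : smooth f -> (forall x, f (x + 1) = f x) ->
  exists2 C, 0 <= C & forall x, `|derive1n n f x| <= C.
Proof.
move=> sf pf.
have [C C0 H] := smooth_bounded_segment (smooth_derive1n n sf) (@ler01 R).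
exists C => // x.
have [y /andP[y0 y1] [z [_ ->]]] := periodic_frac (derive1n_periodic n sf pf) x.
by apply: H; rewrite y0 ltW.
Qed.

Lemma lipschitz_derive f f' L : (forall x, is_derive x (1 : R) f (f' x)) ->
  forall x y, (forall z, Num.min x y <= z <= Num.max x y -> `|f' z| <= L) ->
  `|f x - f y| <= L * `|x - y|.
Proof.
move=> df; suff H x y : x <= y -> (forall z, x <= z <= y -> `|f' z| <= L) ->
    `|f x - f y| <= L * `|x - y|.
  move=> x y; have [xy|yx] := leP x y; first by move=> /H; exact.
  by move=> /H => /(_ (ltW yx)); rewrite distrC [`|y - x|]distrC.
move=> xy; have cf : {within `[x, y], continuous f}.
  apply: continuous_subspaceT => z; apply: derivable_continuous; by case: (df z).
move=> Lb; have [z] := MVT_segment xy (fun z _ => df z) cf.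
rewrite in_itv/= => zxy fxy; rewrite distrC fxy normrM [`|x - y|]distrC.
by rewrite ler_wpM2r// Lb.
Qed.

(** Second symmetric difference of step [u]. On the grid of step [1 / N] it is diagonalised by the
    discrete cosine transform and plays the part of integration by parts. *)
Definition sdiff u F t := F (t + u) - 2 * F t + F (t - u).

(** Two applications of the mean value inequality, to [F (t + v) + F (t - v)] as a function of [v]
    and then to [derive1 F]. *)
Lemma sdiff_le F B u t : smooth F -> (forall x, `|derive1n 2 F x| <= B) ->
  0 <= u -> `|sdiff u F t| <= 2 * u ^+ 2 * B.
Proof.
move=> sF FB u0.
pose G v := F (t + v) + F (t - v).
have dG v : is_derive v (1 : R) G (derive1 F (t + v) - derive1 F (t - v)).
  apply: is_deriveD.
    rewrite -[X in is_derive _ _ _ X]mulr1.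
    apply: (@is_derive1_comp _ F (fun v => t + v)); first exact: smooth_is_derive.
    by rewrite -[X in is_derive _ _ _ X]add0r; apply: is_deriveD.
  rewrite -[X in is_derive _ _ _ X]mulrN1.
  apply: (@is_derive1_comp _ F (fun v => t - v)); first exact: smooth_is_derive.
  by rewrite -[X in is_derive _ _ _ X]add0r; apply: is_deriveD.
have -> : sdiff u F t = G u - G 0 by rewrite /G /sdiff addr0 subr0; ring.
have -> : 2 * u ^+ 2 * B = 2 * u * B * `|u - 0| by rewrite subr0 ger0_norm//; ring.
apply: (lipschitz_derive dG) => z; rewrite min_r// max_l// => /andP[z0 zu].
have B0 : 0 <= B by exact: le_trans (FB 0).
apply: (@le_trans _ _ (B * `|(t + z) - (t - z)|)).
  apply: lipschitz_derive => [x|x _]; first exact: smooth_is_derive (smooth_derive1 sF) _.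
  exact: FB.
have -> : t + z - (t - z) = 2 * z by ring.
by rewrite ger0_norm ?mulr_ge0// mulrC ler_wpM2r// ler_wpM2l.
Qed.

Lemma smooth_comp_affine F a b : smooth F -> smooth (fun x => F (a * x + b)).
Proof.
move=> sF n x; apply: (@nsmooth_comp _ _ F (fun x => a * x + b)); last exact: sF.
by apply: nsmoothD; [apply: nsmoothZ; exact: nsmooth_id|exact: nsmooth_cst].
Qed.

Lemma smooth_shift F b : smooth F -> smooth (fun x => F (x + b)).
Proof.
by move=> /(smooth_comp_affine 1 b); under eq_fun do rewrite mul1r.
Qed.

Lemma smooth_sdiff u F : smooth F -> smooth (sdiff u F).
Proof.
move=> sF n x; apply: nsmoothD; last exact: (@smooth_shift _ (- u)).
by apply: nsmoothB; [exact: smooth_shift|exact: nsmoothZ].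
Qed.

Lemma derive1_sdiff u F : smooth F -> derive1 (sdiff u F) = sdiff u (derive1 F).
Proof.
move=> sF; apply/funext => x; apply: is_derive_derive1.
have dsh b : is_derive x (1 : R) (fun x => F (x + b)) (derive1 F (x + b)).
  rewrite -[X in is_derive _ _ _ X]mulr1.
  apply: (@is_derive1_comp _ F (fun v => v + b)); first exact: smooth_is_derive.
  by rewrite -[X in is_derive _ _ _ X]addr0; apply: is_deriveD.
apply: is_deriveD; apply: is_deriveB.
by apply: is_deriveZ; exact: smooth_is_derive.
Qed.

(** [sdiff u] commutes with differentiation, so each iteration trades two derivatives for a factor
    [2 * u ^+ 2]. *)
Lemma iter_sdiff_le p F B u : smooth F -> (forall x, `|derive1n p.*2 F x| <= B) ->
  0 <= u -> forall t, `|iter p (sdiff u) F t| <= (2 * u ^+ 2) ^+ p * B.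
Proof.
move=> sF + u0; elim: p F sF B => [|p IH] F sF B FB t; first by rewrite expr0 mul1r; exact: FB.
rewrite iterSr exprSr -mulrA; apply: IH; first exact: smooth_sdiff.
have E n G : smooth G -> derive1n n (sdiff u G) = sdiff u (derive1n n G).
  elim: n => [//|n IH] sG; rewrite !derive1nS IH//.
  by apply: derive1_sdiff; exact: smooth_derive1n.
move=> x; rewrite E//; apply: sdiff_le => //; first exact: smooth_derive1n.
Qed.

End Smooth.

(** * Chebyshev approximation *)

Section DiscreteCosine.
Variable R : realType.
Implicit Types (f F : R -> R) (t x y : R) (n p N k : nat).

(** On [[0, 2]] the half-angle formula reduces to [sin x >= cos 1 * x] on [[0, 1]], which gives
    [cos 1 ^+ 2]. On [[2, pi]] the cosine is nonpositive and [t < 4], which gives the crude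
    [1 / 16]. *)
Lemma one_sub_cos_ge : exists2 c : R, 0 < c &
  forall t, 0 <= t <= pi -> c * t ^+ 2 <= 2 - 2 * cos t.
Proof.
have k0 : 0 < cos 1 :> R := cos1_gt0 R.
have pi2 := pi_ge2 R.
have pi4 : (pi : R) < 4 by have := pihalf_lt2 R; lra.
have sinb x : 0 <= x <= 1 -> cos 1 * x <= sin x.
  move=> /andP[x0 x1].
  have cs : {within `[0, x], continuous (@sin R)}.
    by apply: continuous_subspaceT; exact: continuous_sin.
  have [z] := MVT_segment x0 (fun z _ => is_derive_sin z) cs.
  rewrite in_itv/= sin0 !subr0 => /andP[z0 zx] ->.
  rewrite ler_wpM2r// leNgt; apply/negP => zz.
  have : z <= 1 by lra.
  by rewrite leNgt -ltr_cos ?in_itv/= ?zz//; lra.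
exists (Num.min (cos 1 ^+ 2) (1 / 16)); first by rewrite lt_min exprn_gt0//; lra.
move=> t /andP[t0 tpi].
have [t2|t2] := leP t 2.
  have -> : 2 - 2 * cos t = (2 * sin (t / 2)) ^+ 2.
    set u := t / 2; have -> : t = u *+ 2 by rewrite mulr2n /u -splitr.
    rewrite cos_mulr2n exprMn sin2cos2.
    by ring.
  apply: (@le_trans _ _ (cos 1 ^+ 2 * t ^+ 2)).
    by rewrite ler_wpM2r ?sqr_ge0// ge_min lexx.
  rewrite -exprMn lerXn2r ?nnegrE ?mulr_ge0//; first exact: ltW.
    by apply: sin_ge0_pi; lra.
  have := sinb (t / 2); have -> : 0 <= t / 2 <= 1 by lra.
  by move=> /(_ isT); lra.
apply: (@le_trans _ _ (1 / 16 * t ^+ 2)).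
  by rewrite ler_wpM2r ?sqr_ge0// ge_min lexx orbT.
have : cos t <= 0.
  have : cos t <= cos (pi / 2) by rewrite leNgt ltr_cos ?in_itv/= -?leNgt; lra.
  by rewrite cos_pihalf.
by nra.
Qed.

(** Discrete cosine coefficients at [N] equispaced nodes. Unlike integral coefficients they
    reproduce [F] exactly at the nodes, which reduces convergence to a Lipschitz estimate between
    nodes. *)
Definition fhat F N k : R :=
  N%:R^-1 * \sum_(j < N) F (j%:R / N%:R) * cos (2 * pi * k%:R * (j%:R / N%:R)).

Lemma sum_shift (G : nat -> R) N : G N = G 0 ->
  \sum_(j < N) G j.+1 = \sum_(j < N) G j.
Proof.
case: N => [|N] G0; first by rewrite !big_ord0.
rewrite big_ord_recr/= G0 [RHS]big_ord_recl/= addrC; congr (_ + _).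
Qed.

Lemma cos_2piM_addz x k : cos (x + 2 * pi * k%:R) = cos x :> R.
Proof.
have -> : x + 2 * pi * k%:R = x + pi *+ 2 *+ k.
  by rewrite -[in RHS]mulr_natr -[pi *+ 2]mulr_natl.
by rewrite (periodicn (@cosD2pi R)).
Qed.

(** Summation by parts over one period: shifts of the nodes are moved onto the cosine, which is an
    eigenvector of the second difference. *)
Lemma fhat_sdiff F N k : (0 < N)%N -> (forall x, F (x + 1) = F x) ->
  fhat (sdiff N%:R^-1 F) N k = - (2 - 2 * cos (2 * pi * (k%:R / N%:R))) * fhat F N k.
Proof.
move=> N0 pF; rewrite /fhat [RHS]mulrCA; congr (_ * _).
have NN : N%:R != 0 :> R by rewrite pnatr_eq0 -lt0n.
set th := 2 * pi * (k%:R / N%:R).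
have thE j : 2 * pi * k%:R * (j%:R / N%:R) = th * j%:R by rewrite /th; field.
pose G j : R := F (j%:R / N%:R).
have GS j : F (j%:R / N%:R + N%:R^-1) = G j.+1.
  by rewrite /G; congr F; rewrite -natr1; field.
have pG j : G (j + N)%N = G j by rewrite /G natrD mulrDl divff// pF.
pose H j : R := F (j%:R / N%:R - N%:R^-1).
have HS j : H j.+1 = G j by rewrite /G /H; congr F; rewrite -natr1; field.
have pH j : H (j + N)%N = H j.
  by rewrite /H natrD mulrDl divff// addrAC pF.
pose c x : R := cos (th * x).
have pc x : c (x + N%:R) = c x.
  rewrite /c mulrDr (_ : th * N%:R = 2 * pi * k%:R) ?cos_2piM_addz//.
  by rewrite /th; field.
have ccc x : c (x + 1) + c (x - 1) = 2 * cos th * c x.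
  by rewrite /c mulrDr mulrBr mulr1 cosD cosB; ring.
transitivity (\sum_(j < N) (G j.+1 * c j%:R - 2 * G j * c j%:R + H j * c j%:R)).
  by apply: eq_bigr => j _; rewrite /sdiff GS thE /c /G /H; ring.
rewrite !big_split/= sumrN.
have -> : \sum_(j < N) G j.+1 * c j%:R = \sum_(j < N) G j * c (j%:R - 1).
  rewrite -(@sum_shift (fun j => G j * c (j%:R - 1))).
    by apply: eq_bigr => j _; rewrite -[j.+1%:R]natr1 addrK.
  by rewrite (pG 0) -(pc (0 - 1)) addrAC add0r.
have -> : \sum_(j < N) H j * c j%:R = \sum_(j < N) G j * c (j%:R + 1).
  rewrite -(@sum_shift (fun j => H j * c j%:R)).
    by apply: eq_bigr => j _; rewrite HS -natr1.
  by rewrite (pH 0) -(pc 0) add0r.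
rewrite mulr_sumr -sumrN -!big_split/=; apply: eq_bigr => j _.
rewrite thE -/(c j%:R) -/(G j).
have := ccc j%:R => E.
have -> : c (j%:R + 1) = 2 * cos th * c j%:R - c (j%:R - 1) by rewrite -E addrK.
by ring.
Qed.

Lemma fhat_le F N k B : (0 < N)%N -> (forall x, `|F x| <= B) -> `|fhat F N k| <= B.
Proof.
move=> N0 FB; have NN : 0 < N%:R :> R by rewrite ltr0n.
rewrite /fhat normrM normfV (gtr0_norm NN) ler_pdivrMl//.
apply: le_trans (ler_norm_sum _ _ _) _.
have -> : N%:R * B = \sum_(j < N) B by rewrite sumr_const card_ord mulr_natl.
apply: ler_sum => j _; rewrite normrM -[leRHS]mulr1.
by apply: ler_pM => //; exact: cos_max.
Qed.

(** [p] summations by parts. Up to constants, the differences contribute [N] to the power [-2p] and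
    the eigenvalue at least [k / N] to the power [2p], so the powers of [N] cancel; [k.*2 <= N]
    keeps the angle in [[0, pi]]. *)
Lemma fhat_decay F p : smooth F -> (forall x, F (x + 1) = F x) ->
  exists2 C, 0 <= C & forall N k, (0 < N)%N -> (k.*2 <= N)%N ->
    k%:R ^+ p.*2 * `|fhat F N k| <= C.
Proof.
move=> sF pF; have [c c0 Hc] := one_sub_cos_ge.
have [B B0 HB] := smooth_periodic_bounded p.*2 sF pF.
exists ((2 / (c * 4 * pi ^+ 2)) ^+ p * B) => [|N k N0 kN].
  by rewrite mulr_ge0// exprn_ge0// divr_ge0// mulr_ge0 ?sqr_ge0// mulr_ge0// ltW.
have NN : 0 < N%:R :> R by rewrite ltr0n.
pose th : R := 2 * pi * (k%:R / N%:R).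
have pi0 := pi_gt0 R.
have iterp q : (forall x, iter q (sdiff N%:R^-1) F (x + 1) = iter q (sdiff N%:R^-1) F x) /\
    fhat (iter q (sdiff N%:R^-1) F) N k = (- (2 - 2 * cos th)) ^+ q * fhat F N k.
  elim: q => [|q [IH1 IH2]]; first by rewrite expr0 mul1r.
  split; last by rewrite iterS fhat_sdiff// IH2 exprS mulrA.
  by move=> x; rewrite iterS /sdiff (addrAC x 1 N%:R^-1) (addrAC x 1 (- N%:R^-1)) !IH1.
have := fhat_le k N0 (iter_sdiff_le sF HB (_ : 0 <= N%:R^-1)).
rewrite invr_ge0 ler0n => /(_ isT); rewrite (iterp p).2 normrM normrX normrN.
have thpi : 0 <= th <= pi.
  rewrite /th mulr_ge0 ?mulr_ge0 ?divr_ge0 ?(ltW pi0)//=.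
  have : k%:R / N%:R <= 1 / 2 :> R.
    rewrite ler_pdivrMr// mulrC mulrA ler_pdivlMr// mulr1 -natrM ler_nat.
    by rewrite muln2.
  set u := k%:R / _ => u2.
  have -> : 2 * pi * u = pi * (2 * u) by ring.
  by rewrite ler_piMr ?(ltW pi0)//; lra.
have cth := Hc _ thpi.
have s0 : 0 <= 2 - 2 * cos th by apply: le_trans cth; rewrite mulr_ge0 ?sqr_ge0 ?(ltW c0).
rewrite (ger0_norm s0) => H.
have {}H : (c * th ^+ 2) ^+ p * `|fhat F N k| <= (2 * N%:R^-1 ^+ 2) ^+ p * B.
  apply: le_trans H; rewrite ler_wpM2r// lerXn2r// nnegrE.
  by rewrite mulr_ge0 ?sqr_ge0 ?(ltW c0).
set e := 2 / (c * 4 * pi ^+ 2); pose d : R := c * 4 * pi ^+ 2 / N%:R ^+ 2.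
have E1 : c * th ^+ 2 = k%:R ^+ 2 * d.
  by rewrite /th /d; field; rewrite (gt_eqF NN).
have E2 : 2 * N%:R^-1 ^+ 2 = e * d.
  rewrite /e /d; move: (pi : R) (gt_eqF pi0) => q q0.
  by field; rewrite (gt_eqF NN) q0 (gt_eqF c0).
have d0 : 0 < d ^+ p.
  by rewrite exprn_gt0// /d divr_gt0 ?exprn_gt0// !mulr_gt0// exprn_gt0.
move: H; rewrite E1 E2 !(exprMn _ _ d) -exprM mul2n => H.
by rewrite -(ler_pM2r d0) mulrAC; apply: le_trans H _; rewrite mulrAC.
Qed.

End DiscreteCosine.

(** * Interpolation at equispaced nodes and Chebyshev sums *)

Section Interpolation.
Variable R : realType.
Implicit Types (f F : R -> R) (t x y : R) (n p N k : nat).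

(** Two surplus powers in a decay estimate make a series summable with total at most 2; this is how
    the rapidly decaying families below are summed. *)
Lemma sum_inv_sq n : \sum_(k < n) (1 + k%:R) ^- 2 <= 2 :> R.
Proof.
(* The induction needs the sharper telescoping bound. *)
suff H m : \sum_(k < m.+1) (1 + k%:R) ^- 2 <= 2 - m.+1%:R^-1 :> R.
  case: n => [|n]; first by rewrite big_ord0.
  by apply: le_trans (H n) _; rewrite gerBl invr_ge0.
elim: m => [|m IH].
  by rewrite big_ord_recr big_ord0/= add0r addr0 expr1n invr1; lra.
rewrite big_ord_recr/=; apply: le_trans (lerD IH (lexx _)) _.
have m0 : 0 < m.+1%:R :> R by rewrite ltr0n.
rewrite -[m.+2%:R]natr1 [1 + _]addrC; set u := m.+1%:R in m0 *.
rewrite -subr_ge0.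
have -> : 2 - (u + 1)^-1 - (2 - u^-1 + (u + 1) ^- 2) = (u * (u + 1) ^+ 2)^-1.
  field; apply/andP; split; lra.
by rewrite invr_ge0 mulr_ge0 ?sqr_ge0// ltW.
Qed.

(** Shifting the index by one in either direction leaves the sum over a full period unchanged, while
    the two shifts together multiply each term by twice [cos th]; hence [cos th - 1] annihilates the
    sum. *)
Lemma cos_sum_eq0 N (x : R) : (0 < N)%N -> cos (2 * pi * x / N%:R) != 1 ->
  (exists m : nat, x = m%:R) ->
  \sum_(k < N) cos (2 * pi * x / N%:R * k%:R) = 0.
Proof.
move=> N0 + [m xm]; have NN : N%:R != 0 :> R by rewrite pnatr_eq0 -lt0n.
set th := 2 * pi * x / N%:R => th1.
pose c (y : R) : R := cos (th * y).
have pc y : c (y + N%:R) = c y.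
  rewrite /c mulrDr (_ : th * N%:R = 2 * pi * m%:R) ?cos_2piM_addz//.
  by rewrite /th xm; move: (pi : R) => q; field.
have ccc y : c (y + 1) + c (y - 1) = 2 * cos th * c y.
  by rewrite /c mulrDr mulrBr mulr1 cosD cosB; ring.
have s1 : \sum_(k < N) c (k%:R + 1) = \sum_(k < N) c k%:R.
  rewrite -(@sum_shift R (fun j => c j%:R)).
    by apply: eq_bigr => j _; rewrite -natr1.
  by rewrite -(pc 0) add0r.
have s2 : \sum_(k < N) c (k%:R - 1) = \sum_(k < N) c k%:R.
  rewrite -(@sum_shift R (fun j => c (j%:R - 1))).
    by apply: eq_bigr => j _; rewrite -natr1 addrK.
  by rewrite -(pc (0 - 1)) addrAC add0r.
have : 2 * (cos th - 1) * \sum_(k < N) c k%:R = 0.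
  have : \sum_(k < N) (c (k%:R + 1) + c (k%:R - 1)) = 2 * cos th * \sum_(k < N) c k%:R.
    by rewrite mulr_sumr; apply: eq_bigr => k _; exact: ccc.
  by rewrite big_split/= s1 s2; lra.
move=> /eqP; rewrite !mulf_eq0 pnatr_eq0/= subr_eq0 (negbTE th1)/= => /eqP.
exact.
Qed.

Lemma cos_lt1 x : 0 < x < 2 * pi -> cos x < 1 :> R.
Proof.
move=> x0; have -> : x = (x / 2) *+ 2 by rewrite mulr2n -splitr.
rewrite cos_mulr2n cos2sin2.
have : 0 < sin (x / 2) by apply: sin_gt0_pi; lra.
move=> /(exprn_gt0 2); set u := sin _ ^+ 2; rewrite mulr2n; lra.
Qed.

Lemma cos_sum_nat N m : (0 < N)%N ->
  \sum_(k < N) cos (2 * pi * m%:R / N%:R * k%:R) = if (N %| m)%N then N%:R else 0 :> R.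
Proof.
move=> N0; have NN : N%:R != 0 :> R by rewrite pnatr_eq0 -lt0n.
have NN0 : 0 < N%:R :> R by rewrite ltr0n.
case: ifPn => [/dvdnP[q ->]|Nm].
  under eq_bigr => k _.
    have -> : 2 * pi * (q * N)%:R / N%:R * k%:R = 0 + 2 * pi * (q * k)%:R :> R.
      by rewrite !natrM; move: (pi : R) => r; field.
    rewrite cos_2piM_addz cos0; over.
  by rewrite sumr_const card_ord.
apply: cos_sum_eq0 => //; last by exists m.
rewrite lt_eqF// {1}(divn_eq m N) natrD natrM.
have -> : 2 * pi * ((m %/ N)%:R * N%:R + (m %% N)%:R) / N%:R =
    2 * pi * ((m %% N)%:R / N%:R) + 2 * pi * (m %/ N)%:R :> R.
  by move: (pi : R) => r; field.
rewrite cos_2piM_addz; apply: cos_lt1.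
have pi0 : 0 < 2 * pi :> R by rewrite mulr_gt0// pi_gt0.
rewrite mulr_gt0//=; last by rewrite divr_gt0// ltr0n lt0n; move: Nm; rewrite /dvdn.
by rewrite gtr_pMr// ltr_pdivrMr// mul1r ltr_nat ltn_mod.
Qed.

(** By orthogonality only the nodes [j = i] and [j = N - i] survive, each with weight one half, and
    evenness with periodicity gives [F] the same value at both. *)
Lemma fhat_interpolation F N i : (0 < N)%N -> (i < N)%N ->
  (forall x, F (x + 1) = F x) -> (forall x, F (- x) = F x) ->
  \sum_(k < N) fhat F N k * cos (2 * pi * k%:R * (i%:R / N%:R)) = F (i%:R / N%:R).
Proof.
move=> N0 iN pF eF; have NN : N%:R != 0 :> R by rewrite pnatr_eq0 -lt0n.
pose S m : R := \sum_(k < N) cos (2 * pi * m%:R / N%:R * k%:R).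
transitivity (N%:R^-1 * \sum_(j < N) F (j%:R / N%:R) *
    ((S (i + j)%N + S (i + (N - j))%N) / 2)).
  rewrite /fhat; under eq_bigr do rewrite -(mulrA N%:R^-1) mulr_suml.
  rewrite -mulr_sumr exchange_big/=; congr (_ * _); apply: eq_bigr => j _.
  under eq_bigr do rewrite -(mulrA (F _)).
  rewrite -mulr_sumr; congr (_ * _); rewrite /S -big_split/= mulr_suml.
  apply: eq_bigr => k _; rewrite !natrD natrB ?(ltnW (ltn_ord j))//.
  have -> : 2 * pi * (i%:R + (N%:R - j%:R)) / N%:R * k%:R =
      (2 * pi * k%:R * (i%:R / N%:R) - 2 * pi * k%:R * (j%:R / N%:R)) + 2 * pi * k%:R :> R.
    by move: (pi : R) => r; field.
  have -> : 2 * pi * (i%:R + j%:R) / N%:R * k%:R =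
      2 * pi * k%:R * (i%:R / N%:R) + 2 * pi * k%:R * (j%:R / N%:R) :> R.
    by move: (pi : R) => r; field.
  by rewrite cos_2piM_addz cosD cosB; set a := cos _; set b := sin _; field.
rewrite /S; under eq_bigr do rewrite !cos_sum_nat//.
(* Reduced modulo [N] because the mirror image of node 0 is node 0 itself. *)
pose i' := ((N - i) %% N)%N.
have i'N : (i' < N)%N by rewrite ltn_mod.
transitivity (N%:R^-1 * \sum_(j < N)
   ((if j == Ordinal i'N then F (j%:R / N%:R) * (N%:R / 2) else 0) +
    (if j == Ordinal iN then F (j%:R / N%:R) * (N%:R / 2) else 0))).
  congr (_ * _); apply: eq_bigr => j _; have jN := ltn_ord j.
  have -> : (N %| i + j)%N = (j == Ordinal i'N).
    rewrite -val_eqE/= /i'; apply/idP/eqP => [/dvdnP[q e]|->].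
      case: q e => [|[|q]] e; last by nia.
        have [-> ->] : i = 0%N /\ nat_of_ord j = 0%N by lia.
        by rewrite subn0 modnn.
      have -> : (N - i = j)%N by lia.
      by rewrite modn_small.
    by rewrite /dvdn modnDmr subnKC ?modnn// ltnW.
  have -> : (N %| i + (N - j))%N = (j == Ordinal iN).
    rewrite -val_eqE/=; apply/idP/eqP => [/dvdnP[q e]|->].
      by case: q e => [|[|q]] e; [lia|lia|nia].
    by rewrite subnKC// ltnW.
  by do 2 case: ifP => _; rewrite ?(addr0, add0r, mul0r, mulr0, mulrDl, mulrDr).
rewrite big_split/= -!big_mkcond/= !big_pred1_eq/=.
have -> : F (i'%:R / N%:R) = F (i%:R / N%:R).
  rewrite /i'; case: (posnP i) => [->|i0]; first by rewrite subn0 modnn.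
  rewrite modn_small ?ltn_subrL ?N0 ?i0// natrB ?(ltnW iN)// mulrBl divff//.
  by rewrite addrC pF eF.
by field.
Qed.

Fixpoint chebT k x : R :=
  match k with
  | 0%N => 1
  | 1%N => x
  | (k'.+1 as k1).+1 => 2 * x * chebT k1 x - chebT k' x
  end.

Lemma chebT_cos k x : chebT k (cos x) = cos (k%:R * x).
Proof.
suff: chebT k (cos x) = cos (k%:R * x) /\ chebT k.+1 (cos x) = cos (k.+1%:R * x).
  by case.
elim: k => [|k [IH1 IH2]]; first by rewrite mul0r cos0 mul1r.
split=> //; rewrite [LHS]/= -/(chebT k.+1 _) IH1 IH2.
have -> : k%:R * x = k.+1%:R * x - x by rewrite -natr1; ring.
have -> : k.+2%:R * x = k.+1%:R * x + x by rewrite -[k.+2%:R]natr1; ring.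
by rewrite cosB cosD; ring.
Qed.

(** Frequencies [k] and [N - k] give the same cosine at the nodes, hence the factor 2; as
    [N = K.*2.+1] is odd, they pair up and only [k = 0] stays alone. The value 0 beyond [K] lets the
    decay bound hold for all [k]. *)
Definition ccoef F K k : R :=
  if (k <= K)%N then (if k == 0%N then 1 else 2) * fhat F K.*2.+1 k else 0.

Lemma ccoef_decay F p : smooth F -> (forall x, F (x + 1) = F x) ->
  exists2 C, 0 <= C & forall K k, `|ccoef F K k| * (1 + k%:R) ^+ p <= C.
Proof.
move=> sF pF; have [C C0 HC] := fhat_decay p sF pF.
have [B B0 HB] := fhat_decay 0 sF pF.
exists (2 * (2 ^+ p * (B + C))) => [|K k].
  by rewrite !mulr_ge0 ?exprn_ge0 ?addr_ge0.
rewrite /ccoef; case: ifPn => [kK|_]; last first.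
  by rewrite normr0 mul0r !mulr_ge0 ?exprn_ge0 ?addr_ge0.
have kN : (k.*2 <= K.*2.+1)%N by lia.
have := HC K.*2.+1 k isT kN; have := HB K.*2.+1 k isT kN.
rewrite expr0 mul1r; set u := fhat _ _ _ => uB uC.
have c2 : `|(if k == 0%N then 1 else 2) * u| <= 2 * `|u|.
  by case: eqP => _; rewrite normrM ?normr1 ?normr_nat//; have := normr_ge0 u; lra.
apply: le_trans (ler_wpM2r _ c2) _; first by rewrite exprn_ge0// addr_ge0.
rewrite -mulrA ler_wpM2l//.
have [->|k0] := posnP k.
  rewrite addr0 expr1n mulr1; apply: le_trans uB _.
  apply: (@le_trans _ _ (B + C)); first by rewrite lerDl.
  by rewrite ler_peMl ?addr_ge0// exprn_ege1// ler1n.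
have k1 : 1 <= k%:R :> R by rewrite ler1n.
apply: (@le_trans _ _ (`|u| * (2 ^+ p * k%:R ^+ p.*2))).
  rewrite ler_wpM2l// -addnn exprD -exprMn; apply: (@le_trans _ _ ((2 * k%:R) ^+ p)).
    by rewrite lerXn2r ?nnegrE ?addr_ge0 ?mulr_ge0//; lra.
  by rewrite !exprMn ler_pM2l ?exprn_gt0// ler_peMr ?exprn_ge0// exprn_ege1.
rewrite mulrCA ler_wpM2l ?exprn_ge0// mulrC; apply: le_trans uC _.
by rewrite lerDr.
Qed.

Lemma ccoef_interpolation F K i : (i < K.*2.+1)%N ->
  (forall x, F (x + 1) = F x) -> (forall x, F (- x) = F x) ->
  \sum_(k < K.+1) ccoef F K k * cos (2 * pi * k%:R * (i%:R / K.*2.+1%:R)) =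
  F (i%:R / K.*2.+1%:R).
Proof.
move=> iN pF eF; rewrite -fhat_interpolation//; set N := K.*2.+1 in iN *.
have NN : N%:R != 0 :> R by rewrite pnatr_eq0.
pose A k := fhat F N k * cos (2 * pi * k%:R * (i%:R / N%:R)).
have AN k : (k <= N)%N -> A (N - k)%N = A k.
  move=> kN; have E j : cos (2 * pi * (N - k)%:R * (j%:R / N%:R)) =
      cos (2 * pi * k%:R * (j%:R / N%:R)) :> R.
    rewrite natrB// -[RHS]cosN -[RHS](cos_2piM_addz _ j); congr cos.
    by move: (pi : R) => r; field.
  rewrite /A E; congr (_ * _); rewrite /fhat; congr (_ * _).
  by apply: eq_bigr => j _; rewrite E.
rewrite -[RHS]/(\sum_(k < N) A k) -(big_mkord xpredT A).
rewrite -(big_mkord xpredT (fun k => ccoef F K k * cos (2 * pi * k%:R * (i%:R / N%:R)))).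
rewrite big_nat_recl// [RHS](@big_cat_nat _ _ _ K.+1)/=; [|by []|by rewrite /N; lia].
rewrite big_nat_recl// -addrA; congr (_ + _).
  by rewrite /ccoef/= mul1r.
have -> : \sum_(K.+1 <= k < N) A k = \sum_(0 <= k < K) A k.+1.
  rewrite big_nat_rev/= -{1}(add0n K.+1) big_addn.
  have -> : (N - K.+1 = K)%N by rewrite /N; lia.
  apply: eq_big_nat => k /andP[_ kK]; rewrite -(AN k.+1) ?/N; last by lia.
  by congr A; lia.
rewrite -big_split/=; apply: eq_big_nat => k /andP[_ kK].
by rewrite /ccoef kK/= -/N /A; ring.
Qed.

Lemma cos_lipschitz x y : `|cos x - cos y| <= `|x - y| :> R.
Proof.
rewrite -[leRHS]mul1r; apply: (lipschitz_derive (@is_derive_cos R)) => z _.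
by rewrite normrN sin_max.
Qed.

(** Under [x = cos (2 * pi * t)] the polynomial [chebT k] becomes a cosine and [h] an even periodic
    smooth function. Interpolant and function agree at the nodes and are Lipschitz uniformly in [K],
    so they differ by [O(1 / K)]. The coefficients depend on [K], but their decay bounds do not. *)
Lemma chebyshev_approximation (h : R -> R) : smooth h ->
  exists c : nat -> nat -> R,
    (forall p, exists C, forall K k, `|c K k| * (1 + k%:R) ^+ p <= C) /\
    (forall e, 0 < e -> exists K, forall x, -1 <= x <= 1 ->
      `|h x - \sum_(k < K.+1) c K k * chebT k x| <= e).
Proof.
move=> sh; pose F t := h (cos (2 * pi * t)).
have sF : smooth F.
  move=> n x; apply: (@nsmooth_comp _ _ h (fun t => cos (2 * pi * t))); last exact: sh.
  apply: (@nsmooth_comp _ _ cos (fun t => 2 * pi * t)); last by have [] := nsmooth_cos_sin n (2 * pi * x).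
  by apply: nsmoothZ; exact: nsmooth_id.
have pF x : F (x + 1) = F x by rewrite /F mulrDr (cos_2piM_addz _ 1).
have eF x : F (- x) = F x by rewrite /F mulrN cosN.
exists (ccoef F); split.
  by move=> p; have [C _ HC] := ccoef_decay p sF pF; exists C.
(* One power pays for the Lipschitz constant of the cosine, two more sum the series. *)
have [C C0 HC] := ccoef_decay 3 sF pF.
have [B B0 HB] := smooth_periodic_bounded 1 sF pF.
have pi0 : 0 < pi :> R := pi_gt0 R.
pose L : R := 2 * pi * C * 2.
move=> e e0; pose K := Num.truncn ((B + L) / e).
exists K => x x1; pose N := K.*2.+1.
have NN : 0 < N%:R :> R by rewrite ltr0n.
pose t := acos x / (2 * pi).
have xE : x = cos (2 * pi * t).
  rewrite /t mulrC divfK; last by rewrite gt_eqF// mulr_gt0.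
  by rewrite acosK.
have t0 : 0 <= t by rewrite divr_ge0 ?acos_ge0// mulr_ge0// ltW.
have t1 : t < 1.
  by rewrite ltr_pdivrMr ?mulr_gt0// mul1r; have := acos_lepi x1; lra.
pose i := Num.truncn (t * N%:R).
have /andP[i1 i2] : i%:R <= t * N%:R < i.+1%:R by apply: truncn_itv; rewrite mulr_ge0// ltW.
have iN : (i < N)%N.
  by rewrite -(ltr_nat R); apply: le_lt_trans i1 _; rewrite gtr_pMl.
have ti : `|t - i%:R / N%:R| <= N%:R^-1.
  rewrite -[leLHS](@mulfK _ N%:R) ?gt_eqF//.
  rewrite ler_piMl ?invr_ge0 ?(ltW NN)// -{2}(gtr0_norm NN) -normrM mulrBl divfK ?gt_eqF//.
  by move: i2; rewrite -natr1 ler_norml; lra.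
pose P u := \sum_(k < K.+1) ccoef F K k * cos (2 * pi * k%:R * u).
have PL u v : `|P u - P v| <= L * `|u - v|.
  rewrite /P -sumrB; apply: le_trans (ler_norm_sum _ _ _) _.
  apply: (@le_trans _ _ (\sum_(k < K.+1) 2 * pi * C * `|u - v| * (1 + k%:R) ^- 2)).
    apply: ler_sum => k _; rewrite -mulrBr normrM.
    apply: (@le_trans _ _ (`|ccoef F K k| * (2 * pi * (1 + k%:R) * `|u - v|))).
      rewrite ler_wpM2l//; apply: le_trans (cos_lipschitz _ _) _.
      rewrite -mulrBr normrM ler_wpM2r// ger0_norm ?mulr_ge0 ?(ltW pi0)//.
      by rewrite ler_wpM2l ?mulr_ge0 ?(ltW pi0)// lerDr.
    have k0 : 0 < 1 + k%:R :> R by rewrite ltr_pwDl.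
    have := HC K k; set w := 1 + k%:R in k0 *; set c := `|ccoef _ _ _| => cw.
    rewrite ler_pdivlMr ?exprn_gt0//.
    have -> : c * (2 * pi * w * `|u - v|) * w ^+ 2 = 2 * pi * (c * w ^+ 3) * `|u - v|.
      by move: (pi : R) => q; ring.
    by rewrite ler_wpM2r// ler_wpM2l// mulr_ge0// ltW.
  rewrite -mulr_sumr /L [leRHS]mulrAC ler_wpM2l ?sum_inv_sq//.
  by rewrite !mulr_ge0// ltW.
have -> : \sum_(k < K.+1) ccoef F K k * chebT k x = P t.
  rewrite /P; apply: eq_bigr => k _; congr (_ * _).
  by rewrite xE chebT_cos; congr cos; move: (pi : R) => q; ring.
have -> : h x = F t by rewrite xE.
have Pi : P (i%:R / N%:R) = F (i%:R / N%:R) by exact: ccoef_interpolation.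
have -> : F t - P t = (F t - F (i%:R / N%:R)) + (P (i%:R / N%:R) - P t).
  by rewrite Pi addrA subrK.
apply: le_trans (ler_normD _ _) _.
have FL : `|F t - F (i%:R / N%:R)| <= B * `|t - i%:R / N%:R|.
  by apply: (lipschitz_derive (smooth_is_derive sF)) => z _; exact: HB.
have BL0 : 0 <= B + L by rewrite addr_ge0// /L !mulr_ge0// ltW.
apply: (@le_trans _ _ ((B + L) * N%:R^-1)).
  apply: (@le_trans _ _ ((B + L) * `|t - i%:R / N%:R|)); last by rewrite ler_wpM2l.
  by rewrite mulrDl lerD// (le_trans (PL _ _))// distrC.
rewrite ler_pdivrMr// mulrC -ler_pdivrMr//.
apply: ltW; apply: lt_le_trans (truncnS_gt _) _.
by rewrite ler_nat ltnS -addnn leq_addr.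
Qed.

End Interpolation.

(** * Fourier series with rapidly decaying coefficients *)

Section UnitIntegral.
Variable R : realType.
Implicit Types (f g F : R -> R) (t x y : R) (n p k : nat) (m : int).

Definition I01 f : R := \int[lebesgue_measure]_(t in `[0, 1]) f t.

Lemma smooth_within f (A : set R) : smooth f -> {within A, continuous f}.
Proof. by move=> sf; apply: continuous_subspaceT; exact: smooth_continuous. Qed.

Lemma smooth_integrable f : smooth f ->
  (@lebesgue_measure R).-integrable `[0, 1] (EFin \o f).
Proof.
move=> sf; apply: continuous_compact_integrable; first exact: segment_compact.
exact: smooth_within.
Qed.

Lemma smoothD f g : smooth f -> smooth g -> smooth (fun x => f x + g x).
Proof. by move=> sf sg n x; exact: nsmoothD. Qed.

Lemma smoothM f g : smooth f -> smooth g -> smooth (fun x => f x * g x).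
Proof. by move=> sf sg n x; exact: nsmoothM. Qed.

Lemma smoothZ c f : smooth f -> smooth (fun x => c * f x).
Proof. by move=> sf n x; exact: nsmoothZ. Qed.

Lemma smoothN f : smooth f -> smooth (fun x => - f x).
Proof. by move=> sf n x; exact: nsmoothN. Qed.

Lemma smooth_cst c : smooth (fun=> c : R).
Proof. by move=> n x; exact: nsmooth_cst. Qed.

Lemma smooth_cosM c : smooth (fun t => cos (c * t)).
Proof.
move=> n x; apply: (@nsmooth_comp _ _ cos (fun t => c * t)).
  by apply: nsmoothZ; exact: nsmooth_id.
by have [] := nsmooth_cos_sin n (c * x).
Qed.

Lemma smooth_sinM c : smooth (fun t => sin (c * t)).
Proof.
move=> n x; apply: (@nsmooth_comp _ _ sin (fun t => c * t)).
  by apply: nsmoothZ; exact: nsmooth_id.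
by have [] := nsmooth_cos_sin n (c * x).
Qed.

Lemma is_derive_cosM c x : is_derive x (1 : R) (fun t => cos (c * t)) (- c * sin (c * x)).
Proof.
rewrite mulNr -mulrN mulrC; apply: (@is_derive1_comp _ cos (fun t => c * t)).
by rewrite -[X in is_derive _ _ _ X]mulr1; apply: is_deriveZ.
Qed.

Lemma is_derive_sinM c x : is_derive x (1 : R) (fun t => sin (c * t)) (c * cos (c * x)).
Proof.
rewrite mulrC; apply: (@is_derive1_comp _ sin (fun t => c * t)).
by rewrite -[X in is_derive _ _ _ X]mulr1; apply: is_deriveZ.
Qed.

Lemma I01D f g : smooth f -> smooth g -> I01 (fun x => f x + g x) = I01 f + I01 g.
Proof. by move=> sf sg; apply: RintegralD => //; exact: smooth_integrable. Qed.

Lemma I01Z c f : smooth f -> I01 (fun x => c * f x) = c * I01 f.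
Proof. by move=> sf; apply: RintegralZl => //; exact: smooth_integrable. Qed.

Lemma I01_FTC F f : smooth F -> smooth f ->
  (forall x, derive1 F x = f x) -> I01 f = F 1 - F 0.
Proof.
move=> sF sf dF; rewrite /I01 /Rintegral (@continuous_FTC2 _ f F)//.
- exact: smooth_within.
- split=> [x _||]; first by case: (smooth_is_derive sF x).
  + exact/cvg_at_right_filter/smooth_continuous.
  + exact/cvg_at_left_filter/smooth_continuous.
Qed.

Lemma I01_cst c : I01 (fun=> c) = c.
Proof.
rewrite (@I01_FTC (fun x => c * x)) ?mulr0 ?mulr1 ?subr0//.
- by apply: smoothZ => n x; exact: nsmooth_id.
- exact: smooth_cst.
- by move=> x; apply: is_derive_derive1; rewrite -[X in is_derive _ _ _ X]mulr1; apply: is_deriveZ.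
Qed.

Lemma I01_le f g : smooth f -> smooth g -> (forall x, f x <= g x) -> I01 f <= I01 g.
Proof.
by move=> sf sg fg; apply: le_Rintegral => //; exact: smooth_integrable.
Qed.

Lemma I01_norm_le f B : smooth f -> (forall x, `|f x| <= B) -> `|I01 f| <= B.
Proof.
move=> sf fB; rewrite ler_norml -{1}[- B]I01_cst -[X in _ && (_ <= X)](I01_cst B).
by apply/andP; split; apply: I01_le => //; try exact: smooth_cst;
  move=> x; have := fB x; rewrite ler_norml => /andP[].
Qed.

Lemma I01_cos m : I01 (fun t => cos (2 * pi * m%:~R * t)) = (m == 0)%:R.
Proof.
have pi0 : 2 * pi != 0 :> R by rewrite gt_eqF// mulr_gt0// pi_gt0.
have [->|m0] := eqVneq m 0.
  rewrite -[RHS](I01_cst 1); congr I01.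
  by apply/funext => t; rewrite mulr0 mul0r cos0.
have c0 : 2 * pi * m%:~R != 0 :> R by rewrite mulf_neq0// intr_eq0.
rewrite (@I01_FTC (fun t => (2 * pi * m%:~R)^-1 * sin (2 * pi * m%:~R * t))).
- rewrite mulr0 sin0 mulr0 subr0 mulr1.
  have sn k : sin (2 * pi * k%:R) = 0 :> R.
    rewrite -[2 * pi * _]add0r (_ : 2 * pi * k%:R = pi *+ 2 *+ k); last first.
      by rewrite -[in RHS]mulr_natr -[pi *+ 2]mulr_natl.
    by rewrite (periodicn (@sinD2pi R)) sin0.
  case: m {m0 c0} => k; first by rewrite sn mulr0.
  by rewrite NegzE mulrNz mulrN sinN sn oppr0 mulr0.
- by apply: smoothZ; exact: smooth_sinM.
- exact: smooth_cosM.
- move=> x; apply: is_derive_derive1; rewrite -[X in is_derive _ _ _ X](mulKf c0).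
  by apply: is_deriveZ; exact: is_derive_sinM.
Qed.

Lemma cos_2piMz m : cos (2 * pi * m%:~R) = 1 :> R.
Proof.
case: m => k; first by rewrite -[2 * pi * _]add0r cos_2piM_addz cos0.
by rewrite NegzE mulrNz mulrN cosN -[2 * pi * _]add0r cos_2piM_addz cos0.
Qed.

Lemma sin_2piMz m : sin (2 * pi * m%:~R) = 0 :> R.
Proof.
apply/eqP; rewrite -sqrf_eq0 sin2cos2 cos_2piMz expr1n subrr eqxx//.
Qed.

Lemma I01_sin m : I01 (fun t => sin (2 * pi * m%:~R * t)) = 0.
Proof.
have pi0 : 2 * pi != 0 :> R by rewrite gt_eqF// mulr_gt0// pi_gt0.
have [->|m0] := eqVneq m 0.
  rewrite -[RHS](I01_cst 0); congr I01.
  by apply/funext => t; rewrite mulr0 mul0r sin0.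
have c0 : - (2 * pi * m%:~R) != 0 :> R by rewrite oppr_eq0 mulf_neq0// intr_eq0.
rewrite (@I01_FTC (fun t => (- (2 * pi * m%:~R))^-1 * cos (2 * pi * m%:~R * t))).
- by rewrite mulr0 cos0 !mulr1 cos_2piMz mulr1 subrr.
- by apply: smoothZ; exact: smooth_cosM.
- exact: smooth_sinM.
- move=> x; apply: is_derive_derive1; rewrite -[X in is_derive _ _ _ X](mulKf c0).
  by apply: is_deriveZ; exact: is_derive_cosM.
Qed.

Definition fcos f m := I01 (fun t => f t * cos (2 * pi * m%:~R * t)).
Definition fsin f m := I01 (fun t => f t * sin (2 * pi * m%:~R * t)).

(** Integration by parts; the boundary terms cancel by periodicity. *)
Lemma fcos_derive1 f m : smooth f -> (forall x, f (x + 1) = f x) ->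
  fsin (derive1 f) m + 2 * pi * m%:~R * fcos f m = 0 /\
  fcos (derive1 f) m - 2 * pi * m%:~R * fsin f m = 0.
Proof.
move=> sf pf; set c := 2 * pi * m%:~R.
have f10 : f 1 = f 0 by rewrite -(pf 0) add0r.
have sc : smooth (fun t => cos (c * t)) by exact: smooth_cosM.
have ss : smooth (fun t => sin (c * t)) by exact: smooth_sinM.
have sf' := smooth_derive1 sf.
split.
  rewrite /fsin /fcos -I01Z; last exact: smoothM.
  rewrite -I01D; [|exact: smoothM|by apply: smoothZ; exact: smoothM].
  rewrite (@I01_FTC (fun t => f t * sin (c * t))).
  - by rewrite mulr1 mulr0 sin0 sin_2piMz !mulr0 subrr.
  - exact: smoothM.
  - by apply: smoothD; [exact: smoothM|apply: smoothZ; exact: smoothM].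
  - move=> x; apply: is_derive_derive1.
    apply: (is_derive_eq (is_deriveM (smooth_is_derive sf x) (is_derive_sinM c x))).
    by rewrite /GRing.scale/=; ring.
rewrite /fsin /fcos -mulNr -I01Z; last exact: smoothM.
rewrite -I01D; [|exact: smoothM|by apply: smoothZ; exact: smoothM].
rewrite (@I01_FTC (fun t => f t * cos (c * t))).
- by rewrite mulr1 mulr0 cos0 cos_2piMz !mulr1 f10 subrr.
- exact: smoothM.
- by apply: smoothD; [exact: smoothM|apply: smoothZ; exact: smoothM].
- move=> x; apply: is_derive_derive1.
  apply: (is_derive_eq (is_deriveM (smooth_is_derive sf x) (is_derive_cosM c x))).
  by rewrite /GRing.scale/=; ring.
Qed.

Lemma fcos_norm_le f m B : smooth f -> (forall x, `|f x| <= B) ->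
  `|fcos f m| <= B /\ `|fsin f m| <= B.
Proof.
move=> sf fB; split; apply: I01_norm_le.
- by apply: smoothM => //; exact: smooth_cosM.
- move=> x; rewrite normrM -[leRHS]mulr1; apply: ler_pM => //; exact: cos_max.
- by apply: smoothM => //; exact: smooth_sinM.
- move=> x; rewrite normrM -[leRHS]mulr1; apply: ler_pM => //; exact: sin_max.
Qed.

(** [p] integrations by parts, where the factors [2 * pi] are bounded below by 1. *)
Lemma fcos_decay_pow f p B m : smooth f -> (forall x, f (x + 1) = f x) ->
  (forall x, `|derive1n p f x| <= B) ->
  `|m|%:R ^+ p * `|fcos f m| <= B /\ `|m|%:R ^+ p * `|fsin f m| <= B.
Proof.
have am : `|m|%:R = `|m%:~R| :> R by rewrite natr_absz -intr_norm.
elim: p f => [|p IH] f sf pf fB.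
  by rewrite expr0 !mul1r; exact: fcos_norm_le.
have [e1 e2] := fcos_derive1 m sf pf.
have fB' x : `|derive1n p (derive1 f) x| <= B by rewrite /derive1n -iterSr; exact: fB.
have [h1 h2] := IH _ (smooth_derive1 sf) (derive1_periodic sf pf) fB'.
suff H u v : 2 * pi * m%:~R * u = v -> `|m|%:R ^+ p * `|v| <= B ->
    `|m|%:R ^+ p.+1 * `|u| <= B.
  split.
    by apply: (H _ (- fsin (derive1 f) m)); [lra|rewrite normrN].
  by apply: (H _ (fcos (derive1 f) m)); [lra|].
move=> <-; apply: le_trans.
rewrite exprSr -mulrA ler_wpM2l ?exprn_ge0// am -normrM -(mulrA (2 * pi)) (normrM (2 * pi)).
rewrite ler_peMl// ger0_norm ?mulr_ge0 ?pi_ge0//.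
by have := pi_ge2 R; lra.
Qed.

Lemma fcos_decay f p : smooth f -> (forall x, f (x + 1) = f x) ->
  exists2 C, 0 <= C & forall m, `|fcos f m| * (1 + `|m|%:R) ^+ p <= C /\
    `|fsin f m| * (1 + `|m|%:R) ^+ p <= C.
Proof.
move=> sf pf; have [B B0 HB] := smooth_periodic_bounded 0 sf pf.
have [C C0 HC] := smooth_periodic_bounded p sf pf.
exists (2 ^+ p * (B + C)) => [|m]; first by rewrite mulr_ge0 ?addr_ge0 ?exprn_ge0.
have [b1 b2] := fcos_decay_pow m sf pf HB.
have [c1 c2] := fcos_decay_pow m sf pf HC.
suff H (a u : R) : 0 <= u -> `|m|%:R ^+ 0 * u <= B -> `|m|%:R ^+ p * u <= C ->
    u * (1 + `|m|%:R) ^+ p <= 2 ^+ p * (B + C) by split; exact: H.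
move=> u0 uB uC; rewrite expr0 mul1r in uB.
have [->|m0] := posnP `|m|%N.
  rewrite addr0 expr1n mulr1; apply: le_trans uB _.
  apply: (@le_trans _ _ (B + C)); first by rewrite lerDl.
  by rewrite ler_peMl ?addr_ge0// exprn_ege1// ler1n.
have m1 : 1 <= `|m|%:R :> R by rewrite ler1n.
apply: (@le_trans _ _ (u * (2 * `|m|%:R) ^+ p)).
  by rewrite ler_wpM2l// lerXn2r ?nnegrE ?addr_ge0 ?mulr_ge0//; lra.
rewrite exprMn mulrCA ler_wpM2l ?exprn_ge0// mulrC; apply: le_trans uC _.
by rewrite lerDr.
Qed.

End UnitIntegral.

Import ComplexField Normc.

(** * Trigonometric series with rapidly decaying coefficients *)

Section TrigSeries.
Variable R : realType.
Implicit Types (a b : nat -> R) (f g F : R -> R) (t x y : R) (n p k : nat) (m : int).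

Definition rapid_nat a := forall p, exists2 C, 0 <= C & forall k, `|a k| * (1 + k%:R) ^+ p <= C.

Lemma rapid_natMk a c : rapid_nat a -> rapid_nat (fun k => c * k%:R * a k).
Proof.
move=> ra p; have [C C0 HC] := ra p.+1.
exists (`|c| * C) => [|k]; first by rewrite mulr_ge0.
rewrite normrM normrM -!mulrA ler_wpM2l// normr_nat; apply: le_trans (HC k).
rewrite exprS mulrCA ler_wpM2l// ler_wpM2r ?exprn_ge0 ?addr_ge0//.
by rewrite lerDr.
Qed.

Lemma rapid_natN a : rapid_nat a -> rapid_nat (fun k => - a k).
Proof. by move=> ra p; have [C C0 HC] := ra p; exists C => // k; rewrite normrN. Qed.

Lemma rapid_natD a b : rapid_nat a -> rapid_nat b -> rapid_nat (fun k => a k + b k).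
Proof.
move=> ra rb p; have [C C0 HC] := ra p; have [D D0 HD] := rb p.
exists (C + D) => [|k]; first exact: addr_ge0.
apply: le_trans (lerD (HC k) (HD k)).
by rewrite -mulrDl ler_wpM2r ?ler_normD// exprn_ge0// addr_ge0.
Qed.

Definition tterm a b k t : R := a k * cos (2 * pi * k%:R * t) + b k * sin (2 * pi * k%:R * t).

Definition trig a b t : R := limn (series (fun k => tterm a b k t)).

Lemma tterm_le a b k t : `|tterm a b k t| <= `|a k| + `|b k|.
Proof.
apply: le_trans (ler_normD _ _) _; rewrite !normrM.
by apply: lerD; rewrite -[leRHS]mulr1 ler_wpM2l// (cos_max, sin_max).
Qed.

Lemma rapid_nat_sum a : rapid_nat a -> exists2 C, 0 <= C & forall n, \sum_(k < n) `|a k| <= C.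
Proof.
move=> ra; have [C C0 HC] := ra 2; exists (C * 2) => [|n]; first by rewrite mulr_ge0.
apply: le_trans (ler_wpM2l C0 (sum_inv_sq R n)); rewrite mulr_sumr.
by apply: ler_sum => k _; rewrite ler_pdivlMr// exprn_gt0// ltr_pwDl.
Qed.

Lemma abs_cvg (u : nat -> R) B : (forall n, \sum_(k < n) `|u k| <= B) ->
  cvgn (series u).
Proof.
move=> uB; apply: normed_cvg; apply: nondecreasing_is_cvgn.
  by apply: nondecreasing_series => n _ _; exact: normr_ge0.
by exists B => _ [n _ <-]; rewrite /normed_series_of/= /series/= big_mkord.
Qed.

Lemma trig_cvg a b t : rapid_nat a -> rapid_nat b -> series (fun k => tterm a b k t) @ \oo --> trig a b t.
Proof.
move=> ra rb; have [C C0 HC] := rapid_nat_sum ra; have [D D0 HD] := rapid_nat_sum rb.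
apply: (@abs_cvg _ (C + D)) => n.
apply: le_trans (lerD (HC n) (HD n)); rewrite -big_split/=.
by apply: ler_sum => k _; exact: tterm_le.
Qed.

Lemma lim_norm_le (u : nat -> R) l B : u @ \oo --> l -> (\forall n \near \oo, `|u n| <= B) ->
  `|l| <= B.
Proof.
move=> ul uB; have nl : (fun n => `|u n|) @ \oo --> `|l| by exact: cvg_norm.
rewrite -(cvg_lim _ nl)//; apply: limr_le => //; first by apply/cvg_ex; exists `|l|.
Qed.

(** The second-order remainders of the terms are summable against [h ^+ 2], since the coefficients
    multiplied by the square of the frequency still decay rapidly; the quadratic remainder of the
    sum identifies its derivative. *)
Lemma trig_derive a b t : rapid_nat a -> rapid_nat b ->
  is_derive t (1 : R) (trig a b)
    (trig (fun k => 2 * pi * k%:R * b k) (fun k => - (2 * pi * k%:R * a k)) t).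
Proof.
move=> ra rb.
have ra1 := rapid_natMk (2 * pi) ra; have rb1 := rapid_natMk (2 * pi) rb.
have ra2 := rapid_natMk (2 * pi) ra1; have rb2 := rapid_natMk (2 * pi) rb1.
have [C C0 HC] := rapid_nat_sum ra2; have [D D0 HD] := rapid_nat_sum rb2.
apply: (@is_derive_quadratic _ _ _ _ (C + D) 1) => // h _.
set a' := fun k => _; set b' := fun k => - _.
have cv : (fun n => series (fun k => tterm a b k (h + t)) n - series (fun k => tterm a b k t) n -
    series (fun k => tterm a' b' k t) n * h) @ \oo -->
    trig a b (h + t) - trig a b t - trig a' b' t * h.
  apply: cvgB; first by apply: cvgB; exact: trig_cvg.
  by apply: cvgMl; apply: trig_cvg => //; exact: rapid_natN.
apply: (lim_norm_le cv); near=> n.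
rewrite /series/= !big_mkord mulr_suml -!sumrB.
apply: le_trans (ler_norm_sum _ _ _) _.
apply: le_trans (ler_wpM2r (sqr_ge0 h) (lerD (HC n) (HD n))).
rewrite -big_split/= mulr_suml; apply: ler_sum => k _.
rewrite /tterm /a' /b'; set c := 2 * pi * k%:R.
have cosq y u : `|cos (y + u) - cos y + u * sin y| <= u ^+ 2.
  pose G v : R := cos (y + v) + v * sin y.
  have -> : cos (y + u) - cos y + u * sin y = G u - G 0 by rewrite /G addr0; ring.
  have dG v : is_derive v (1 : R) G (- sin (y + v) + sin y).
    apply: is_deriveD.
      rewrite -[X in is_derive _ _ _ X]mulr1.
      apply: (@is_derive1_comp _ cos (fun v => y + v)); first exact: is_derive_cos.
      by rewrite -[X in is_derive _ _ _ X]add0r; apply: is_deriveD.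
    apply: (is_derive_eq (is_deriveM (is_derive_id _ _) (is_derive_cst (sin y) v 1))).
    by rewrite /GRing.scale/=; ring.
  have -> : u ^+ 2 = `|u| * `|u - 0| by rewrite subr0 -expr2 real_normK// num_real.
  apply: (lipschitz_derive dG) => z zu; rewrite addrC distrC.
  apply: (@le_trans _ _ (1 * `|(y + z) - y|)).
    by apply: (lipschitz_derive (@is_derive_sin R)) => w _; exact: cos_max.
  rewrite mul1r addrC addKr; move: zu; rewrite ler_norml.
  by case: (leP u 0) => u0; [rewrite ler0_norm|rewrite gtr0_norm]; lra.
(* The sine is the cosine a quarter period earlier. *)
have sinq y u : `|sin (y + u) - sin y - u * cos y| <= u ^+ 2.
  have := cosq (y - pi / 2) u.
  by rewrite (addrAC y) !cosBpihalf sinBpihalf mulrN.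
rewrite [c * (h + t)]mulrDr [c * h + _]addrC.
have -> : a k * cos (c * t + c * h) + b k * sin (c * t + c * h) -
     (a k * cos (c * t) + b k * sin (c * t)) -
     (c * b k * cos (c * t) + - (c * a k) * sin (c * t)) * h =
   a k * (cos (c * t + c * h) - cos (c * t) + c * h * sin (c * t)) +
   b k * (sin (c * t + c * h) - sin (c * t) - c * h * cos (c * t)) by ring.
apply: le_trans (ler_normD _ _) _; rewrite !normrM mulrDl.
have -> u : `|2| * `|pi| * `|k%:R| * (`|2| * `|pi| * `|k%:R| * u) * h ^+ 2 = u * (c * h) ^+ 2.
  by rewrite normr_nat ger0_norm ?pi_ge0// normr_nat /c; move: (pi : R) => q; ring.
have -> u : `|2| * `|pi| * `|k%:R| * (`|2| * `|pi| * `|k%:R| * u) * h ^+ 2 = u * (c * h) ^+ 2.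
  by rewrite normr_nat ger0_norm ?pi_ge0// normr_nat /c; move: (pi : R) => q; ring.
by apply: lerD; rewrite ler_wpM2l.
Unshelve. all: by end_near. Qed.

Lemma smooth_trig a b : rapid_nat a -> rapid_nat b -> smooth (trig a b).
Proof.
move=> + + n; elim: n a b => [//|n IH] a b ra rb x.
apply: nsmooth_is_derive; first by apply: filterE => y; exact: trig_derive.
by apply: IH; [exact: rapid_natMk|apply: rapid_natN; exact: rapid_natMk].
Qed.

Lemma trig_periodic a b t : trig a b (t + 1) = trig a b t.
Proof.
rewrite /trig; congr (limn _); apply/funext => n; rewrite /series/=.
apply: eq_bigr => k _; rewrite /tterm mulrDr mulr1 cos_2piM_addz.
by rewrite sinD (cos_2piMz R k) (sin_2piMz R k) mulr1 mulr0 addr0.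
Qed.

Lemma cvg_I01 (u : nat -> R -> R) f g : (forall n, smooth (u n)) -> smooth f -> smooth g ->
  (forall x, `|g x| <= 1) ->
  (forall e, 0 < e -> exists N, forall n x, (N <= n)%N -> `|f x - u n x| <= e) ->
  (fun n => I01 (fun x => u n x * g x)) @ \oo --> I01 (fun x => f x * g x).
Proof.
move=> su sf sg g1 H; apply/cvgrPdist_le => e e0; have [N HN] := H e e0.
near=> n.
have -> : I01 (fun x => f x * g x) - I01 (fun x => u n x * g x) =
    I01 (fun x => (f x - u n x) * g x).
  rewrite -mulN1r -I01Z; last exact: smoothM.
  rewrite -I01D; [|exact: smoothM|by apply: smoothZ; exact: smoothM].
  by congr I01; apply/funext => x; ring.
apply: I01_norm_le.
  by apply: smoothM => //; apply: smoothD => //; exact: smoothN.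
move=> x; rewrite normrM -[leRHS]mulr1; apply: ler_pM => //.
by apply: HN; near: n; exact: nbhs_infty_ge.
Unshelve. all: by end_near. Qed.

Lemma trig_unif a b : rapid_nat a -> rapid_nat b -> forall e : R, 0 < e -> exists N, forall n t, (N <= n)%N ->
  `|trig a b t - \sum_(k < n) tterm a b k t| <= e.
Proof.
move=> ra rb.
have H c : rapid_nat c -> forall e : R, 0 < e ->
    exists N, forall n n', (N <= n)%N -> (n <= n')%N -> \sum_(n <= k < n') `|c k| <= e.
  move=> /rapid_nat_sum[C C0 HC] e e0.
  have : cvgn (series (fun k => `|c k|)).
    by apply: (@abs_cvg _ C) => n; under eq_bigr do rewrite normr_id.
  move=> /cauchy_cvgP/cauchy_seriesP/(_ e e0)[[A B] /= [[N1 _ HA] [N2 _ HB]] HAB].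
  exists (maxn N1 N2) => n n' Nn nn'.
  have /= := HAB (n, n'); rewrite ger0_norm ?sumr_ge0// => HH; apply/ltW/HH; split.
    by apply: HA; exact: leq_trans (leq_maxl _ _) Nn.
  by apply: HB; apply: leq_trans nn'; exact: leq_trans (leq_maxr _ _) Nn.
move=> e e0; have e20 : 0 < e / 2 by rewrite divr_gt0.
have [N1 H1] := H a ra _ e20; have [N2 H2] := H b rb _ e20.
exists (maxn N1 N2) => n t; rewrite geq_max => /andP[n1 n2].
have cv : (fun n' => series (fun k => tterm a b k t) n' - \sum_(k < n) tterm a b k t) @ \oo -->
    trig a b t - \sum_(k < n) tterm a b k t.
  by apply: cvgB; [exact: trig_cvg|exact: cvg_cst].
apply: (lim_norm_le cv); near=> n'.
have nn' : (n <= n')%N by near: n'; exact: nbhs_infty_ge.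
rewrite /series/= -(big_mkord xpredT (fun k => tterm a b k t)).
rewrite (@big_cat_nat _ _ _ n)//= [X in X - _]addrC addrK.
apply: le_trans (ler_norm_sum _ _ _) _.
apply: (@le_trans _ _ (\sum_(n <= k < n') (`|a k| + `|b k|))).
  by apply: ler_sum => k _; exact: tterm_le.
by rewrite big_split/= [e]splitr lerD ?H1 ?H2.
Unshelve. all: by end_near. Qed.

End TrigSeries.

Local Open Scope complex_scope.

(** * A smooth function with prescribed Fourier coefficients *)

Section FourierSynthesis.
Variable R : realType.
Implicit Types (a b : nat -> R) (f g F : R -> R) (t x y : R) (n p k : nat) (m : int).

Lemma I01_cos_cos k m : I01 (fun t : R => cos (2 * pi * k%:R * t) * cos (2 * pi * m%:~R * t)) =
  ((k%:Z == m)%:R + (k%:Z == - m)%:R) / 2.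
Proof.
rewrite -subr_eq0 -[(k%:Z == - m)]subr_eq0 opprK -!I01_cos -I01D; [|exact: smooth_cosM..].
rewrite [RHS]mulrC -I01Z; last by apply: smoothD; exact: smooth_cosM.
congr I01; apply/funext => t.
by move: (2 * pi : R) => q; rewrite !intrD mulrNz !mulrDr !mulrDl !mulrN !mulNr cosB cosD; field.
Qed.

Lemma I01_sin_cos k m : I01 (fun t : R => sin (2 * pi * k%:R * t) * cos (2 * pi * m%:~R * t)) = 0.
Proof.
transitivity (2^-1 * (I01 (fun t : R => sin (2 * pi * (k%:Z - m)%:~R * t)) +
  I01 (fun t : R => sin (2 * pi * (k%:Z + m)%:~R * t)))).
  rewrite -I01D; [|exact: smooth_sinM..].
  rewrite -I01Z; last by apply: smoothD; exact: smooth_sinM.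
  congr I01; apply/funext => t.
  by move: (2 * pi : R) => q; rewrite !intrD mulrNz !mulrDr !mulrDl !mulrN !mulNr sinB sinD; field.
by rewrite !I01_sin addr0 mulr0.
Qed.

Lemma I01_cos_sin k m : I01 (fun t : R => cos (2 * pi * k%:R * t) * sin (2 * pi * m%:~R * t)) = 0.
Proof.
transitivity (2^-1 * (I01 (fun t : R => sin (2 * pi * (m - k%:Z)%:~R * t)) +
  I01 (fun t : R => sin (2 * pi * (m + k%:Z)%:~R * t)))).
  rewrite -I01D; [|exact: smooth_sinM..].
  rewrite -I01Z; last by apply: smoothD; exact: smooth_sinM.
  congr I01; apply/funext => t.
  by move: (2 * pi : R) => q; rewrite !intrD mulrNz !mulrDr !mulrDl !mulrN !mulNr sinB sinD; field.
by rewrite !I01_sin addr0 mulr0.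
Qed.

Lemma I01_sin_sin k m : I01 (fun t : R => sin (2 * pi * k%:R * t) * sin (2 * pi * m%:~R * t)) =
  ((k%:Z == m)%:R - (k%:Z == - m)%:R) / 2.
Proof.
rewrite -subr_eq0 -[(k%:Z == - m)]subr_eq0 opprK -!I01_cos.
rewrite -mulN1r -I01Z -?I01D; try by [exact: smooth_cosM|apply: smoothZ; exact: smooth_cosM].
rewrite [RHS]mulrC -I01Z; last by apply: smoothD; [|apply: smoothZ]; exact: smooth_cosM.
congr I01; apply/funext => t.
by move: (2 * pi : R) => q; rewrite !intrD mulrNz !mulrDr !mulrDl !mulrN !mulNr cosB cosD; field.
Qed.

(** The coefficients of the partial sums are stationary once the number of terms exceeds [|m|], and
    uniform convergence passes them to the limit. The frequencies [m] and [- m] coincide only for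
    [m = 0], whence the two cases of the factor. *)
Lemma fcos_trig a b m : rapid_nat a -> rapid_nat b ->
  fcos (trig a b) m = a `|m|%N * (if m == 0 then 1 else 2^-1) /\
  fsin (trig a b) m = b `|m|%N * (Num.sg m)%:~R / 2.
Proof.
move=> ra rb; pose S n t := \sum_(k < n) tterm a b k t.
have sterm k : smooth (tterm a b k).
  by apply: smoothD; apply: smoothZ; solve [exact: smooth_cosM|exact: smooth_sinM].
have sS n : smooth (S n) by move=> q x; apply: nsmooth_sum => k; exact: sterm.
have sI g n : smooth g -> I01 (fun x => S n x * g x) =
    \sum_(k < n) (a k * I01 (fun x => cos (2 * pi * k%:R * x) * g x) +
                  b k * I01 (fun x => sin (2 * pi * k%:R * x) * g x)).
  move=> sg; elim: n => [|n IH].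
    rewrite big_ord0 -[RHS](I01_cst 0); congr I01.
    by apply/funext => t; rewrite /S big_ord0 mul0r.
  have s1 : smooth (fun x => cos (2 * pi * n%:R * x) * g x).
    by apply: smoothM => //; exact: smooth_cosM.
  have s2 : smooth (fun x => sin (2 * pi * n%:R * x) * g x).
    by apply: smoothM => //; exact: smooth_sinM.
  rewrite big_ord_recr/= -IH -(I01Z (a n) s1) -(I01Z (b n) s2) -I01D; [|exact: smoothZ..].
  rewrite -I01D; [|exact: smoothM|by apply: smoothD; exact: smoothZ].
  congr I01; apply/funext => t; rewrite /S big_ord_recr/= mulrDl /tterm; congr (_ + _).
  by ring.
have st : smooth (trig a b) by exact: smooth_trig.
have ev (G : nat -> R) (P : nat -> R) (z : R) : P @ \oo --> z ->
    (forall n, P n = \sum_(k < n) G k) -> (forall k, k != `|m|%N -> G k = 0) -> z = G `|m|%N.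
  move=> Pz PG G0; rewrite -(cvg_lim _ Pz)//; apply: cvg_lim => //.
  apply: cvg_near_cst; near=> n.
  have mn : (`|m| < n)%N by near: n; exact: nbhs_infty_gt.
  rewrite PG (bigD1 (Ordinal mn))//= big1 ?addr0// => k kn; apply: G0.
  by apply: contra kn => /eqP km; apply/eqP/val_inj.
split.
  have cv := @cvg_I01 R S (trig a b) (fun x => cos (2 * pi * m%:~R * x)) sS st
     (@smooth_cosM R _) (fun x => cos_max _) (trig_unif ra rb).
  rewrite /fcos; rewrite (ev (fun k => a k * (((k%:Z == m)%:R + (k%:Z == - m)%:R) / 2)) _ _ cv).
  - congr (_ * _); case: m {ev cv} => k /=.
      rewrite eqxx; have -> : (Posz k == - Posz k) = (k == 0%N) by lia.
      by rewrite eqz_nat; case: eqP => _ /=; field.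
    have -> : (Posz k.+1 == - Negz k) by lia.
    by rewrite /=; field.
  - move=> n; rewrite sI; last exact: smooth_cosM.
    by apply: eq_bigr => k _; rewrite I01_cos_cos I01_sin_cos mulr0 addr0.
  - move=> k km; have -> : (k%:Z == m) = false by lia.
    have -> : (k%:Z == - m) = false by lia.
    by rewrite addr0 mul0r mulr0.
have cv := @cvg_I01 R S (trig a b) (fun x => sin (2 * pi * m%:~R * x)) sS st
   (@smooth_sinM R _) (fun x => sin_max _) (trig_unif ra rb).
rewrite /fsin; rewrite (ev (fun k => b k * (((k%:Z == m)%:R - (k%:Z == - m)%:R) / 2)) _ _ cv).
- rewrite -mulrA; congr (_ * (_ / _)); case: m {ev cv} => k /=.
    rewrite eqxx; have -> : (Posz k == - Posz k) = (k == 0%N) by lia.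
    by case: k => [|k]; rewrite ?sgr0 ?subrr ?subr0.
  have -> : (Posz k.+1 == - Negz k) by lia.
  by rewrite sub0r.
- move=> n; rewrite sI; last exact: smooth_sinM.
  by apply: eq_bigr => k _; rewrite I01_cos_sin I01_sin_sin mulr0 add0r.
- move=> k km; have -> : (k%:Z == m) = false by lia.
  have -> : (k%:Z == - m) = false by lia.
  by rewrite subr0 mul0r mulr0.
Unshelve. all: by end_near. Qed.

Lemma smooth_on_setT f : (forall n t, derivable (derive1n n f) t 1) <-> smooth f.
Proof.
split=> [H n x|sf n t]; last by apply: nsmooth_derivable; exact: sf.
by apply: nsmooth_pos => k _; apply: filterE => y; exact: H.
Qed.

Lemma smooth_circleP (phi : R -> R[i]) : smooth_circle phi <->
  [/\ smooth (fun t => complex.Re (phi t)), smooth (fun t => complex.Im (phi t)) &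
      forall t, phi (t + 1) = phi t].
Proof.
split=> [[sp pp]|[s1 s2 pp]].
  by split=> //; apply/smooth_on_setT => n t; have [] := sp n t I.
by split=> // n t _; split; [exact: (smooth_on_setT _).2 s1 n t|exact: (smooth_on_setT _).2 s2 n t].
Qed.

Lemma fourier_coefE (phi : R -> R[i]) m : smooth_circle phi ->
  fourier_coef phi m =
    (fcos (fun t => complex.Re (phi t)) m + fsin (fun t => complex.Im (phi t)) m) +i*
    (fcos (fun t => complex.Im (phi t)) m - fsin (fun t => complex.Re (phi t)) m).
Proof.
move=> /smooth_circleP[sR sI _]; rewrite /fourier_coef /integral01 /fcos /fsin.
rewrite -mulN1r -I01Z -?I01D; try by
  [apply: smoothM => //; solve [exact: smooth_cosM|exact: smooth_sinM]|
   apply: smoothZ; apply: smoothM => //; exact: smooth_sinM|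
   apply: smoothM => //; exact: smooth_cosM|apply: smoothM => //; exact: smooth_sinM].
by congr (_ +i* _); apply: eq_Rintegral => t _; case: (phi t) => u v /=; ring.
Qed.

Definition rapid_int (u : int -> R[i]) := forall p, exists2 C, 0 <= C &
  forall m, normc (u m) * (1 + `|m|%:R) ^+ p <= C.

Lemma normc_leD (x y : R) : normc (x +i* y) <= `|x| + `|y|.
Proof.
rewrite /normc -[leRHS]ger0_norm ?addr_ge0// -sqrtr_sqr ler_wsqrtr//.
rewrite sqrrD !real_normK ?num_real// addrAC lerDl mulrn_wge0// mulr_ge0//.
Qed.

Lemma Re_le_normc (z : R[i]) : `|complex.Re z| <= normc z.
Proof.
by case: z => x y /=; rewrite -[leLHS]sqrtr_sqr ler_wsqrtr// lerDl sqr_ge0.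
Qed.

Lemma Im_le_normc (z : R[i]) : `|complex.Im z| <= normc z.
Proof.
by case: z => x y /=; rewrite -[leLHS]sqrtr_sqr ler_wsqrtr// lerDr sqr_ge0.
Qed.

Lemma fourier_coef_decay (phi : R -> R[i]) : smooth_circle phi -> rapid_int (fourier_coef phi).
Proof.
move=> sp p; have /smooth_circleP[sR sI pp] := sp.
have [C C0 HC] := fcos_decay p sR (fun t => congr1 _ (pp t)).
have [D D0 HD] := fcos_decay p sI (fun t => congr1 _ (pp t)).
exists (C + D + (D + C)) => [|m]; first by rewrite !addr_ge0.
have w0 : 0 <= (1 + `|m|%:R) ^+ p :> R by rewrite exprn_ge0// addr_ge0.
rewrite fourier_coefE//; apply: le_trans (ler_wpM2r w0 (normc_leD _ _)) _.
have [c1 c2] := HC m; have [d1 d2] := HD m.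
rewrite mulrDl; apply: lerD.
  by apply: le_trans (ler_wpM2r w0 (ler_normD _ _)) _; rewrite mulrDl lerD.
by apply: le_trans (ler_wpM2r w0 (ler_normB _ _)) _; rewrite mulrDl lerD.
Qed.

(** The exponential series is split into real and imaginary parts and [m] is paired with [- m]: even
    combinations go to the cosines, odd ones to the sines. *)
Lemma fourier_synthesis (u : int -> R[i]) : rapid_int u ->
  exists2 phi, smooth_circle phi & forall m, fourier_coef phi m = u m.
Proof.
move=> ru.
have rn (w : nat -> int) (P : R[i] -> R) : (forall k, `|w k|%N = k) ->
    (forall z, `|P z| <= normc z) -> rapid_nat (fun k => P (u (w k))).
  move=> wk Pz p; have [C C0 HC] := ru p; exists C => // k.
  apply: le_trans (HC (w k)); rewrite wk; apply: ler_wpM2r; last exact: Pz.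
  by rewrite exprn_ge0// addr_ge0.
have rR := rn Posz _ (fun=> erefl) Re_le_normc.
have rI := rn Posz _ (fun=> erefl) Im_le_normc.
have rR' := rn (fun k => - k%:Z) _ (fun k => abszN k%:Z) Re_le_normc.
have rI' := rn (fun k => - k%:Z) _ (fun k => abszN k%:Z) Im_le_normc.
(* At [k = 0] the two members of the pair are the same coefficient, to be counted once. *)
pose h k : R := if k == 0%N then 2^-1 else 1.
have rh a : rapid_nat a -> rapid_nat (fun k => h k * a k).
  move=> ra p; have [C C0 HC] := ra p; exists C => // k; apply: le_trans (HC k).
  rewrite ler_wpM2r ?exprn_ge0 ?addr_ge0// /h normrM.
  by case: eqP => _; rewrite ?normr1 ?mul1r// ger0_norm ?invr_ge0// ler_piMl//; lra.
pose a k := h k * (complex.Re (u k) + complex.Re (u (- k%:Z))).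
pose b k := - complex.Im (u k) + complex.Im (u (- k%:Z)).
pose c k := h k * (complex.Im (u k) + complex.Im (u (- k%:Z))).
pose d k := complex.Re (u k) + - complex.Re (u (- k%:Z)).
have ra : rapid_nat a by apply: rh; exact: rapid_natD.
have rb : rapid_nat b by apply: rapid_natD => //; exact: rapid_natN.
have rc : rapid_nat c by apply: rh; exact: rapid_natD.
have rd : rapid_nat d by apply: rapid_natD => //; exact: rapid_natN.
pose phi t := trig a b t +i* trig c d t.
have sp : smooth_circle phi.
  apply/smooth_circleP; split; [exact: smooth_trig..|].
  by move=> t; rewrite /phi !trig_periodic.
exists phi => // m; rewrite fourier_coefE//.
have [-> ->] := fcos_trig m ra rb; have [-> ->] := fcos_trig m rc rd.
rewrite /a /b /c /d /h; case: m => k /=.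
  case: k => [|k]/=.
    by rewrite sgr0 oppr0 !mulr0 !mul0r addr0 subr0; case: (u 0) => x y /=; congr (_ +i* _); field.
  rewrite sgrz/= !mulr1 !mul1r; case: (u _) => x y; case: (u _) => x' y' /=.
  by congr (_ +i* _); field.
rewrite NegzE/= !mul1r mulrN1z.
by case: (u k.+1%:Z) => x y; case: (u _) => x' y' /=; congr (_ +i* _); field.
Qed.

End FourierSynthesis.

(** * Operators on l2 *)

Section ComplexLimits.
Variable R : realType.
Implicit Types (u v : nat -> R[i]) (l z : R[i]).

(** Stated with the real-valued [normc], because the norm of [R[i]^o] takes its values in [R[i]];
    [ccvg_lim] links it to [limn]. *)
Definition ccvg u l := forall e : R, 0 < e ->
  exists N, forall n, (N <= n)%N -> normc (u n - l) <= e.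

Lemma normcN z : normc (- z) = normc z.
Proof. by case: z => x y /=; rewrite !sqrrN. Qed.

Lemma normc_distC z l : normc (z - l) = normc (l - z).
Proof. by rewrite -normcN opprB. Qed.

Lemma normc_triangle z l (w : R[i]) : normc (z - w) <= normc (z - l) + normc (l - w).
Proof. by rewrite -[X in normc X](subrKA l) le_normcD. Qed.

Lemma ccvg_unique u l l' : ccvg u l -> ccvg u l' -> l = l'.
Proof.
move=> ul ul'; apply/eqP; rewrite -subr_eq0; apply/eqP/eq0_normc/eqP.
rewrite eq_le normc_ge0 andbT; apply/ler_addgt0Pl => e e0; rewrite addr0.
have e2 : 0 < e / 2 by rewrite divr_gt0.
have [N HN] := ul _ e2; have [N' HN'] := ul' _ e2.
apply: le_trans (normc_triangle _ (u (maxn N N')) _) _.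
rewrite [e]splitr lerD// ?(normc_distC l) ?HN ?HN'// ?leq_maxl ?leq_maxr//.
Qed.

Lemma normc_Re_Im z : normc z <= `|complex.Re z| + `|complex.Im z|.
Proof.
case: z => x y; rewrite /normc -[leRHS]ger0_norm ?addr_ge0// -sqrtr_sqr ler_wsqrtr//.
by rewrite sqrrD !real_normK ?num_real// addrAC lerDl mulrn_wge0// mulr_ge0.
Qed.

Lemma ccvg_complete u :
  (forall e : R, 0 < e -> exists N, forall m n, (N <= m)%N -> (N <= n)%N ->
     normc (u m - u n) <= e) -> exists l, ccvg u l.
Proof.
move=> cu.
have H (P : R[i] -> R) : (forall z w, P (z - w) = P z - P w) ->
    (forall z, `|P z| <= normc z) ->
    exists l : R, forall e : R, 0 < e -> exists N, forall n, (N <= n)%N -> `|P (u n) - l| <= e.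
  move=> PB Pz; have : cvgn (fun n => P (u n)).
    apply/cauchy_cvgP/cauchy_ballP => e e0; have e2 : 0 < e / 2 by rewrite divr_gt0.
    have [N HN] := cu _ e2.
    exists ([set P (u n) | n in [set n | (N <= n)%N]], [set P (u n) | n in [set n | (N <= n)%N]]) => /=.
      by split; exists N => // n Nn; exists n.
    move=> [_ _] [/= [m Nm <-] [n Nn <-]]; rewrite -ball_normE/= -PB.
    apply: le_lt_trans (Pz _) _; apply: le_lt_trans (HN _ _ Nm Nn) _.
    by rewrite ltr_pdivrMr// ltr_pMr// ltr1n.
  move=> /cvg_ex[l /cvgrPdist_le Pl]; exists l => e e0.
  by have [N _ HN] := Pl e e0; exists N => n Nn; rewrite distrC; apply: HN.
have [|z|x Hx] := H (@complex.Re R); first by case=> ? ? [].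
  by case: z => x y /=; rewrite -[leLHS]sqrtr_sqr ler_wsqrtr// lerDl sqr_ge0.
have [|z|y Hy] := H (@complex.Im R); first by case=> ? ? [].
  by case: z => x' y /=; rewrite -[leLHS]sqrtr_sqr ler_wsqrtr// lerDr sqr_ge0.
exists (x +i* y) => e e0; have e2 : 0 < e / 2 by rewrite divr_gt0.
have [N HN] := Hx _ e2; have [N' HN'] := Hy _ e2.
exists (maxn N N') => n; rewrite geq_max => /andP[n1 n2].
apply: le_trans (normc_Re_Im _) _; rewrite [e]splitr.
apply: lerD.
  by apply: le_trans (HN n n1); case: (u n).
by apply: le_trans (HN' n n2); case: (u n).
Qed.

Lemma ccvgD u v l l' : ccvg u l -> ccvg v l' -> ccvg (fun n => u n + v n) (l + l').
Proof.
move=> ul vl e e0; have e2 : 0 < e / 2 by rewrite divr_gt0.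
have [N HN] := ul _ e2; have [N' HN'] := vl _ e2.
exists (maxn N N') => n; rewrite geq_max => /andP[n1 n2].
rewrite opprD addrACA; apply: le_trans (le_normcD _ _) _.
by rewrite [e]splitr lerD ?HN ?HN'.
Qed.

Lemma ccvgZ c u l : ccvg u l -> ccvg (fun n => c * u n) (c * l).
Proof.
move=> ul e e0; have c1 : 0 < normc c + 1 by rewrite ltr_wpDl ?normc_ge0.
have [|N HN] := ul (e / (normc c + 1)); first by rewrite divr_gt0.
exists N => n /HN un; rewrite -mulrBr normcM.
apply: (@le_trans _ _ ((normc c + 1) * normc (u n - l))).
  by rewrite ler_wpM2r ?normc_ge0// lerDl.
by rewrite -ler_pdivlMl// mulrC.
Qed.

Lemma ccvg_eq u v l : (exists N, forall n, (N <= n)%N -> u n = v n) -> ccvg u l -> ccvg v l.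
Proof.
move=> [N uv] ul e e0; have [N' HN'] := ul _ e0.
exists (maxn N N') => n; rewrite geq_max => /andP[n1 n2].
by rewrite -uv// HN'.
Qed.

Lemma ccvg_cst l : ccvg (fun=> l) l.
Proof. by move=> e e0; exists 0%N => n _; rewrite subrr normc0 ltW. Qed.

Lemma ccvg_normc_le u l B : ccvg u l -> (exists N, forall n, (N <= n)%N -> normc (u n) <= B) ->
  normc l <= B.
Proof.
move=> ul [N uB]; apply/ler_addgt0Pr => e e0.
have [N' HN'] := ul _ e0.
rewrite -[l](subrK (u (maxn N N'))); apply: le_trans (le_normcD _ _) _.
by rewrite addrC lerD ?uB ?leq_maxl// normc_distC HN'// leq_maxr.
Qed.

Lemma ccvgB u v l l' : ccvg u l -> ccvg v l' -> ccvg (fun n => u n - v n) (l - l').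
Proof.
move=> ul vl; apply: ccvgD => //; have := ccvgZ (-1) vl; rewrite mulN1r.
by apply: ccvg_eq; exists 0%N => n _; rewrite mulN1r.
Qed.

Lemma ccvg_lim (u : nat -> R[i]^o) l : ccvg u l -> limn u = l.
Proof.
move=> ul; apply: cvg_lim => //; apply/cvgrPdist_le => -[e e'] /=.
rewrite ltcE/= => /andP[/eqP -> e0].
have [N HN] := ul _ e0; exists N => // n /= Nn.
rewrite -[X in X <= _]/((normc (l - u n))%:C) -[X in _ <= X]/(e%:C) lecR.
by rewrite normc_distC HN.
Qed.

End ComplexLimits.

(** * Partial sums and finitely supported vectors *)

Section EllTwoFacts.
Variable R : realType.
Implicit Types (x y : l2 R) (f : int -> R[i]^o) (n : nat).

(** Same enumeration of the integers as in [bilateral_series], so that [dotp] and the norm are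
    limits along the same partial sums. *)
Definition ssum f n : R := \sum_(k < n) (normc (f (Posz k)) ^+ 2 + normc (f (Negz k)) ^+ 2).

Lemma sqsum_series f : sqsum f =
  (\sum_(k <oo) (normc (f (Posz k)) ^+ 2 + normc (f (Negz k)) ^+ 2)%:E)%E.
Proof.
have n0 (g : nat -> int) k : (0 <= (normc (f (g k)) ^+ 2)%:E)%E by rewrite lee_fin sqr_ge0.
rewrite /sqsum (esumID (range Posz)); last by move=> k _; rewrite lee_fin sqr_ge0.
rewrite !setTI (_ : ~` range Posz = range Negz); last first.
  apply/seteqP; split=> [[k|k]|_ [k _ <-] []//] /=; last by exists k.
  by case; exists k.
rewrite !esum_image; [|by move=> ? ? _ _ []..].
rewrite -!nneseries_esumT; [|exact: n0..].
by rewrite -nneseriesD; [|by move=> k _ _; exact: n0..].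
Qed.

Lemma ssum_le f n : ((ssum f n)%:E <= sqsum f)%E.
Proof.
rewrite sqsum_series /ssum -sumEFin.
apply: le_trans (nneseries_lim_ge n _) => [|k _ _]; first by rewrite big_mkord.
by rewrite lee_fin addr_ge0 ?sqr_ge0.
Qed.

Lemma sqsum_le f B : (forall n, ssum f n <= B) -> (sqsum f <= B%:E)%E.
Proof.
move=> fB; rewrite sqsum_series; apply: lime_le.
  by apply: is_cvg_nneseries => k _ _; rewrite lee_fin addr_ge0 ?sqr_ge0.
by apply: nearW => n; rewrite big_mkord sumEFin lee_fin; exact: fB.
Qed.

Lemma ssum_l2norm x n : ssum x n <= l2norm x ^+ 2.
Proof. by rewrite -lee_fin -sqsumE; exact: ssum_le. Qed.

Lemma l2norm_le x B : 0 <= B -> (forall n, ssum x n <= B ^+ 2) -> l2norm x <= B.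
Proof.
move=> B0 H; rewrite -(@ler_pXn2r _ 2) ?nnegrE ?l2norm_ge0//.
by rewrite -lee_fin -sqsumE; exact: sqsum_le.
Qed.

Lemma ssum_mem f B : (forall n, ssum f n <= B) -> f \in @square_summable R.
Proof. by move=> fB; rewrite unfold_in; apply: le_lt_trans (sqsum_le fB) (ltry _). Qed.

Lemma ssum_ge_coord f (k : int) : exists N, forall n, (N <= n)%N -> normc (f k) ^+ 2 <= ssum f n.
Proof.
case: k => i; exists i.+1 => n kn; rewrite /ssum (bigD1 (Ordinal kn))//=.
  rewrite -addrA lerDl addr_ge0 ?sqr_ge0//.
  by apply: sumr_ge0 => j _; rewrite addr_ge0 ?sqr_ge0.
rewrite addrAC lerDr addr_ge0 ?sqr_ge0//.
by apply: sumr_ge0 => j _; rewrite addr_ge0 ?sqr_ge0.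
Qed.

Lemma coord_le x (k : int) : normc (x k) <= l2norm x.
Proof.
rewrite -(@ler_pXn2r _ 2) ?nnegrE ?normc_ge0 ?l2norm_ge0//.
have [N HN] := ssum_ge_coord x k.
exact: le_trans (HN N (leqnn _)) (ssum_l2norm _ _).
Qed.

End EllTwoFacts.

Section Density.
Variable R : realType.
Implicit Types (x y : l2 R) (f : int -> R[i]^o) (n : nat) (k l : int).

Notation E := (basis_vec R).

Lemma basis_vecE l k : E l k = (k == l)%:R :> R[i].
Proof. by []. Qed.

Lemma l2D x y k : (x + y) k = x k + y k :> R[i]. Proof. by []. Qed.
Lemma l2Z (c : R[i]) x k : (c *: x) k = c * x k :> R[i]. Proof. by []. Qed.
Lemma l2B x y k : (x - y) k = x k - y k :> R[i]. Proof. by []. Qed.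
Lemma l2_0 k : (0 : l2 R) k = 0 :> R[i]. Proof. by []. Qed.

Lemma l2_ext x y : (forall k, x k = y k :> R[i]) -> x = y.
Proof. by move=> xy; apply/val_inj/funext. Qed.

Lemma l2_sum (I : Type) (r : seq I) (F : I -> l2 R) k :
  (\sum_(i <- r) F i) k = \sum_(i <- r) F i k :> R[i].
Proof.
by elim: r => [|i r IH]; rewrite ?big_nil ?l2_0// !big_cons l2D IH.
Qed.

Lemma l2normN x : l2norm (- x) = l2norm x.
Proof. by rewrite -scaleN1r l2normZ normcN normc1 mul1r. Qed.

Lemma l2norm_basis l : l2norm (E l) = 1.
Proof.
apply/eqP; rewrite eq_le; apply/andP; split; last first.
  by have := coord_le (E l) l; rewrite basis_vecE eqxx normc1.
apply: l2norm_le => // n; rewrite expr1n /ssum.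
case: l => l.
  rewrite (eq_bigr (fun k : 'I_n => (if (k : nat) == l then 1 else 0))); last first.
    move=> k _; rewrite !basis_vecE eqz_nat normc0 expr0n addr0.
    by case: eqP; rewrite ?normc1 ?normc0 ?expr1n ?expr0n.
  rewrite -big_mkcond/=; have [ln|nl] := ltnP l n; last first.
    rewrite big_pred0 // => k; apply/negbTE; apply: contraL nl => /eqP <-.
    by rewrite -ltnNge.
  by rewrite (big_pred1 (Ordinal ln)).
rewrite (eq_bigr (fun k : 'I_n => (if (k : nat) == l then 1 else 0))); last first.
  move=> k _; rewrite !basis_vecE normc0 expr0n add0r.
  have -> : (Negz k == Negz l) = (k == l :> nat) by apply/eqP/eqP => [[]|->].
  by case: eqP; rewrite ?normc1 ?normc0 ?expr1n ?expr0n.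
rewrite -big_mkcond/=; have [ln|nl] := ltnP l n; last first.
  rewrite big_pred0 // => k; apply/negbTE; apply: contraL nl => /eqP <-.
  by rewrite -ltnNge.
by rewrite (big_pred1 (Ordinal ln)).
Qed.

Definition truncl2 x n : l2 R :=
  \sum_(k < n) (x (Posz k) *: E (Posz k) + x (Negz k) *: E (Negz k)).

Lemma truncl2E x n k :
  truncl2 x n k = (if (match k with Posz i => i | Negz i => i end < n)%N then x k else 0) :> R[i].
Proof.
rewrite /truncl2 l2_sum.
have H i : (x (Posz i) *: E (Posz i) + x (Negz i) *: E (Negz i)) k =
    (if k == Posz i then x k else 0) + (if k == Negz i then x k else 0) :> R[i].
  rewrite l2D !l2Z !basis_vecE.
  by congr (_ + _); case: eqP => [->|]; rewrite ?mulr1 ?mulr0.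
under eq_bigr do rewrite H.
case: k {H} => k.
  under eq_bigr => i _ do rewrite eqz_nat eq_sym addr0.
  rewrite -big_mkcond/=; case: ltnP => [ln|nl]; last first.
    rewrite big_pred0 // => i; apply/negbTE; apply: contraL nl => /eqP <-.
    by rewrite -ltnNge.
  by rewrite (big_pred1 (Ordinal ln)).
under eq_bigr => i _.
  have -> : (Negz k == Negz i) = ((i : nat) == k) by apply/eqP/eqP => [[]|->].
  rewrite add0r; over.
rewrite -big_mkcond/=; case: ltnP => [ln|nl]; last first.
  rewrite big_pred0 // => i; apply/negbTE; apply: contraL nl => /eqP <-.
  by rewrite -ltnNge.
by rewrite (big_pred1 (Ordinal ln)).
Qed.

Lemma ssum_cvg x (e : R) : 0 < e -> exists N, forall n, (N <= n)%N ->
  l2norm x ^+ 2 - e <= ssum x n.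
Proof.
move=> e0; apply: contrapT => /forallNP H.
have HH n : ssum x n <= l2norm x ^+ 2 - e.
  have /existsNP[m /not_implyP[nm /negP]] := H n.
  rewrite -ltNge => /ltW; apply: le_trans.
  rewrite /ssum -[X in X <= _](big_mkord xpredT
    (fun k : nat => normc (x (Posz k)) ^+ 2 + normc (x (Negz k)) ^+ 2)).
  rewrite -[X in _ <= X](big_mkord xpredT (fun k : nat => normc (x (Posz k)) ^+ 2 + normc (x (Negz k)) ^+ 2)).
  rewrite (@big_cat_nat _ _ _ n 0 m)//= lerDl.
  by apply: sumr_ge0 => k _; rewrite addr_ge0 ?sqr_ge0.
by have := sqsum_le HH; rewrite sqsumE lee_fin; lra.
Qed.

Lemma ssum_tail x n m : ssum (x - truncl2 x n : l2 R) m <= ssum x (maxn n m) - ssum x n.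
Proof.
pose g (k : nat) : R := normc (x (Posz k)) ^+ 2 + normc (x (Negz k)) ^+ 2.
have g0 (k : nat) : 0 <= g k by rewrite addr_ge0 ?sqr_ge0.
have gE n' : ssum x n' = \sum_(0 <= i < n') g i by rewrite big_mkord.
rewrite !gE (@big_cat_nat _ _ _ n 0 (maxn n m))//= ?leq_maxl// [leRHS]addrC addKr.
rewrite /ssum; have -> : \sum_(n <= i < maxn n m) g i = \sum_(0 <= i < maxn n m | (n <= i)%N) g i.
  rewrite (@big_cat_nat _ _ _ n 0)//= ?leq_maxl//.
  rewrite [X in _ = X + _]big_nat_cond [X in _ = X + _]big1 ?add0r; last first.
    by move=> i; rewrite (leqNgt n) /=; case: (i < n)%N.
  by rewrite big_nat_cond [RHS]big_nat_cond; apply: eq_bigl => i; case: (leqP n i); rewrite ?andbF ?andbT.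
rewrite -(big_mkord xpredT (fun k : nat => normc ((x - truncl2 x n : l2 R) (Posz k)) ^+ 2 +
   normc ((x - truncl2 x n : l2 R) (Negz k)) ^+ 2)).
rewrite [leRHS]big_mkcond/= [leRHS](@big_cat_nat _ _ _ m)//= ?leq_maxr//.
apply: (@le_trans _ _ (\sum_(0 <= i < m) (if (n <= i)%N then g i else 0))); last first.
  by rewrite lerDl; apply: sumr_ge0 => i _; case: ifP.
  apply: ler_sum => k _.
  have H i : ((l2_val x : int -> R[i]^o) - l2_val (truncl2 x n)) i = x i - truncl2 x n i by [].
  rewrite !H !truncl2E; case: leqP => _; first by rewrite !subr0.
by rewrite !subrr normc0 expr0n addr0.
Qed.

Lemma truncl2_cvg x (e : R) : 0 < e -> exists N, forall n, (N <= n)%N ->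
  l2norm (x - truncl2 x n) <= e.
Proof.
move=> e0; have e2 : 0 < e ^+ 2 by rewrite exprn_gt0.
have [N HN] := ssum_cvg x e2; exists N => n Nn.
apply: l2norm_le => [|m]; first exact: ltW.
apply: le_trans (ssum_tail _ _ _) _.
have := HN n Nn; have := ssum_l2norm x (maxn n m); lra.
Qed.

(** Density of finite combinations of basis vectors, as an induction principle: identities between
    bounded maps are proved on the basis and carried over. *)
Lemma l2_dense (P : l2 R -> Prop) : P 0 -> (forall l, P (E l)) ->
  (forall c x y, P x -> P y -> P (c *: x + y)) ->
  forall x (e : R), 0 < e -> exists2 y, P y & l2norm (x - y) <= e.
Proof.
move=> P0 PE PD x e e0; have [N HN] := truncl2_cvg x e0.
exists (truncl2 x N); last exact: HN.
rewrite /truncl2; elim: N {HN} => [|N IH]; first by rewrite big_ord0.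
rewrite big_ord_recr/= addrC -addrA; apply: (PD) => //; exact: (PD).
Qed.

Lemma l2_mk f (B : R) : 0 <= B -> (forall n, ssum f n <= B ^+ 2) ->
  exists2 x : l2 R, (forall k, x k = f k :> R[i]) & l2norm x <= B.
Proof.
by move=> B0 fB; exists (L2 (ssum_mem fB)) => //; exact: l2norm_le.
Qed.

(** Fatou's lemma: the norm is lower semicontinuous for convergence of coordinates. It turns
    coordinatewise limits into vectors, and then into operators. *)
Lemma l2_fatou (u : nat -> l2 R) f (B : R) : 0 <= B ->
  (exists N, forall n, (N <= n)%N -> l2norm (u n) <= B) ->
  (forall k, ccvg (fun n => u n k) (f k)) ->
  exists2 x : l2 R, (forall k, x k = f k :> R[i]) & l2norm x <= B.
Proof.
move=> B0 [N uB] uf; apply: l2_mk => // n.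
have sq k (e : R) : 0 < e -> exists N, forall m, (N <= m)%N ->
    normc (f k) ^+ 2 <= normc (u m k) ^+ 2 + e.
  move=> e0; pose M := normc (f k); have M0 : 0 <= M := normc_ge0 _.
  (* With [v] the norm of the nearby coordinate, [M ^+ 2 - v ^+ 2 <= 2 * M * (M - v)] when
     [v <= M]. *)
  have [|N' HN'] := uf k (e / (2 * M + 1)); first by rewrite divr_gt0// ltr_wpDl// mulr_ge0.
  exists N' => m /HN' mk.
  have fu : M - normc (u m k) <= normc (u m k - f k).
    by rewrite lerBlDr; have := normc_triangle (f k) (u m k) 0; rewrite !subr0 normc_distC.
  have := le_trans fu mk; rewrite -/M.
  have d0 : 0 < 2 * M + 1 by rewrite ltr_wpDl// mulr_ge0.
  rewrite ler_pdivlMr//; set v := normc _; have v0 : 0 <= v := normc_ge0 _.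
  by move=> H; have [vM|Mv] := leP v M; nra.
have sn n' (e : R) : 0 < e -> exists N, forall m, (N <= m)%N -> ssum f n' <= ssum (u m) n' + e.
  elim: n' e => [|n' IH] e e0.
    by exists 0%N => m _; rewrite /ssum !big_ord0 add0r ltW.
  have e3 : 0 < e / 3 by rewrite divr_gt0.
  have [N0 H0] := IH _ e3.
  have [N1 H1] := sq (Posz n') _ e3; have [N2 H2] := sq (Negz n') _ e3.
  exists (maxn N0 (maxn N1 N2)) => m; rewrite !geq_max => /and3P[m0 m1 m2].
  have := H0 m m0; have := H1 m m1; have := H2 m m2.
  rewrite /ssum !big_ord_recr/=; lra.
apply/ler_addgt0Pr => e e0; have [N' HN'] := sn n e e0.
apply: le_trans (HN' (maxn N N') (leq_maxr _ _)) _; rewrite lerD2r.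
apply: le_trans (ssum_l2norm _ _) _.
by rewrite lerXn2r ?nnegrE ?l2norm_ge0// uB// leq_maxl.
Qed.

End Density.

(** * Operator norm: estimates and completeness *)

Section OperatorNorm.
Variable R : realType.
Implicit Types (A B C : bop R) (x y : l2 R) (n : nat) (k l : int) (c : R[i]).

Notation E := (basis_vec R).

Lemma bopD A x y : A (x + y) = A x + A y.
Proof. by have := bop_linear A 1 x y; rewrite !scale1r. Qed.

Lemma bop0 A : A 0 = 0.
Proof. by have := bopZ A 0 0; rewrite !scale0r. Qed.

Lemma bopN A x : A (- x) = - A x.
Proof. by rewrite -scaleN1r bopZ scaleN1r. Qed.

Lemma bopB A x y : A (x - y) = A x - A y.
Proof. by rewrite bopD bopN. Qed.

Lemma bop_sum A (I : Type) (r : seq I) (F : I -> l2 R) :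
  A (\sum_(i <- r) F i) = \sum_(i <- r) A (F i).
Proof. by elim: r => [|i r IH]; rewrite ?big_nil ?bop0// !big_cons bopD IH. Qed.

Lemma bop_addE A B x : (A + B) x = A x + B x. Proof. by []. Qed.
Lemma bop_oppE A x : (- A) x = - A x. Proof. by []. Qed.
Lemma bop_subE A B x : (A - B) x = A x - B x. Proof. by []. Qed.
Lemma bop_mulE A B x : (A * B) x = A (B x). Proof. by []. Qed.
Lemma bop_scaleE c A x : (c *: A) x = c *: A x. Proof. by []. Qed.
Lemma bop_oneE x : (1 : bop R) x = x. Proof. by []. Qed.
Lemma bop_zeroE x : (0 : bop R) x = 0. Proof. by []. Qed.

Lemma bop_sumE (I : Type) (r : seq I) (F : I -> bop R) x :
  (\sum_(i <- r) F i) x = \sum_(i <- r) F i x.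
Proof. by elim: r => [|i r IH]; rewrite ?big_nil ?bop_zeroE// !big_cons bop_addE IH. Qed.

Lemma bop_eq A B : (forall x, A x = B x) -> A = B.
Proof. by move=> AB; apply/val_inj/funext. Qed.

Lemma bop_scaleAl c A B : c *: (A * B) = (c *: A) * B.
Proof. exact: bop_eq. Qed.

Lemma bop_scaleAr c A B : c *: (A * B) = A * (c *: B).
Proof. by apply: bop_eq => x; rewrite bop_scaleE !bop_mulE bop_scaleE bopZ. Qed.

Lemma opnorm_le_bound A (M : R) : 0 <= M -> (forall x, l2norm (A x) <= M * l2norm x) ->
  opnorm A <= M.
Proof.
move=> M0 AM; apply: opnorm_le => x x1; apply: le_trans (AM x) _.
by rewrite -[leRHS]mulr1 ler_wpM2l.
Qed.

Lemma opnormD A B : opnorm (A + B) <= opnorm A + opnorm B.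
Proof.
apply: opnorm_le_bound => [|x]; first by rewrite addr_ge0 ?opnorm_ge0.
rewrite bop_addE mulrDl; apply: le_trans (l2normD _ _) _.
by apply: lerD; exact: opnorm_ub.
Qed.

Lemma opnormM A B : opnorm (A * B) <= opnorm A * opnorm B.
Proof.
apply: opnorm_le_bound => [|x]; first by rewrite mulr_ge0 ?opnorm_ge0.
rewrite bop_mulE -mulrA; apply: le_trans (opnorm_ub _ _) _.
by rewrite ler_wpM2l ?opnorm_ge0//; exact: opnorm_ub.
Qed.

Lemma opnormN A : opnorm (- A) = opnorm A.
Proof.
have H B : opnorm (- B) <= opnorm B.
  apply: opnorm_le_bound => [|x]; first exact: opnorm_ge0.
  by rewrite bop_oppE l2normN opnorm_ub.
by apply/eqP; rewrite eq_le H -{1}[A]opprK H.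
Qed.

Lemma opnorm_distC A B : opnorm (A - B) = opnorm (B - A).
Proof. by rewrite -opnormN opprB. Qed.

Lemma opnorm0 : opnorm (0 : bop R) = 0.
Proof.
apply/eqP; rewrite eq_le opnorm_ge0 andbT; apply: opnorm_le_bound => // x.
by rewrite bop_zeroE l2norm0 mul0r.
Qed.

Lemma opnorm1 : opnorm (1 : bop R) <= 1.
Proof. by apply: opnorm_le_bound => // x; rewrite bop_oneE mul1r. Qed.

Lemma opnorm_sum (I : Type) (r : seq I) (F : I -> bop R) :
  opnorm (\sum_(i <- r) F i) <= \sum_(i <- r) opnorm (F i).
Proof.
elim: r => [|i r IH]; rewrite ?big_nil ?opnorm0// !big_cons.
by apply: le_trans (opnormD _ _) _; rewrite lerD2l.
Qed.

Lemma opnormX A n : opnorm A <= 1 -> opnorm (A ^+ n) <= 1.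
Proof.
move=> A1; elim: n => [|n IH]; first by rewrite expr0 opnorm1.
rewrite exprS; apply: le_trans (opnormM _ _) _.
by rewrite -[leRHS]mulr1 ler_pM ?opnorm_ge0.
Qed.

Lemma bop_ext A B : (forall l, A (E l) = B (E l)) -> A = B.
Proof.
move=> AB; apply/eqP; rewrite -subr_eq0; apply/eqP; apply: bop_eq => x.
rewrite bop_zeroE; set D := A - B.
apply: l2norm0_eq0; apply/eqP; rewrite eq_le l2norm_ge0 andbT.
apply/ler_addgt0Pl => e e0; rewrite addr0.
have D1 : 0 < opnorm D + 1 by rewrite ltr_wpDl ?opnorm_ge0.
have [||c y z Dy Dz||y Dy xy] := @l2_dense R (fun y => D y = 0) _ _ _ x (e / (opnorm D + 1)).
- exact: bop0.
- by move=> l; rewrite /D bop_subE AB subrr.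
- by rewrite bopD bopZ Dy Dz scaler0 addr0.
- by rewrite divr_gt0.
have -> : D x = D (x - y) by rewrite bopB Dy subr0.
apply: le_trans (opnorm_ub _ _) _.
apply: (@le_trans _ _ ((opnorm D + 1) * l2norm (x - y))).
  by rewrite ler_wpM2r ?l2norm_ge0// lerDl.
by rewrite -ler_pdivlMl// mulrC.
Qed.

Definition opcvg (u : nat -> bop R) A := forall e : R, 0 < e ->
  exists N, forall n, (N <= n)%N -> opnorm (u n - A) <= e.

Lemma opcvg_app u A x : opcvg u A -> forall e : R, 0 < e ->
  exists N, forall n, (N <= n)%N -> l2norm (u n x - A x) <= e.
Proof.
move=> uA e e0; have x1 : 0 < l2norm x + 1 by rewrite ltr_wpDl ?l2norm_ge0.
have [|N HN] := uA (e / (l2norm x + 1)); first by rewrite divr_gt0.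
exists N => n /HN un; rewrite -bop_subE; apply: le_trans (opnorm_ub _ _) _.
apply: (@le_trans _ _ (opnorm (u n - A) * (l2norm x + 1))).
  by rewrite ler_wpM2l ?opnorm_ge0// lerDl.
by rewrite -ler_pdivlMr.
Qed.

Lemma opcvg_coord u A x k : opcvg u A -> ccvg (fun n => u n x k) (A x k).
Proof.
move=> uA e e0; have [N HN] := opcvg_app x uA e0; exists N => n /HN.
by apply: le_trans; rewrite -l2B coord_le.
Qed.

Lemma opcvg_unique u A B : opcvg u A -> opcvg u B -> A = B.
Proof.
move=> uA uB; apply: bop_eq => x; apply: l2_ext => k.
exact: ccvg_unique (opcvg_coord x k uA) (opcvg_coord x k uB).
Qed.

(** The limit is taken coordinate by coordinate; [l2_fatou] makes it a bounded operator, and a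
    second use on differences of the sequence turns the Cauchy condition into convergence in
    norm. *)
Lemma opcvg_complete (u : nat -> bop R) : (forall e : R, 0 < e -> exists N,
    forall m n, (N <= m)%N -> (N <= n)%N -> opnorm (u m - u n) <= e) ->
  exists A, opcvg u A.
Proof.
move=> cu.
have cux x (e : R) : 0 < e -> exists N, forall m n, (N <= m)%N -> (N <= n)%N ->
    l2norm (u m x - u n x) <= e.
  move=> e0; have x1 : 0 < l2norm x + 1 by rewrite ltr_wpDl ?l2norm_ge0.
  have [|N HN] := cu (e / (l2norm x + 1)); first by rewrite divr_gt0.
  exists N => m n Nm Nn; rewrite -bop_subE; apply: le_trans (opnorm_ub _ _) _.
  apply: (@le_trans _ _ (opnorm (u m - u n) * (l2norm x + 1))).
    by rewrite ler_wpM2l ?opnorm_ge0// lerDl.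
  by rewrite -ler_pdivlMr// HN.
have H x : {L : int -> R[i]^o | forall k, ccvg (fun n => u n x k) (L k)}.
  apply: cid; have Hk k : {l | ccvg (fun n => u n x k) l}.
    apply: cid; apply: ccvg_complete => e e0; have [N HN] := cux x e e0.
    by exists N => m n Nm Nn; apply: le_trans (HN m n Nm Nn); rewrite -l2B coord_le.
  by exists (fun k => sval (Hk k)) => k; exact: svalP (Hk k).
have [M M0 uM] : exists2 M : R, 0 <= M & exists N, forall n, (N <= n)%N -> opnorm (u n) <= M.
  have [N HN] := cu 1 ltr01; exists (opnorm (u N) + 1); first by rewrite addr_ge0 ?opnorm_ge0.
  exists N => n Nn; rewrite -[u n](subrK (u N)); apply: le_trans (opnormD _ _) _.
  by rewrite [leRHS]addrC; apply: lerD => //; exact: HN.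
have F x : exists2 y : l2 R, (forall k, y k = sval (H x) k :> R[i]) & l2norm y <= M * l2norm x.
  apply: (@l2_fatou R (fun n => u n x)).
  - by rewrite mulr_ge0 ?l2norm_ge0.
  - have [N HN] := uM; exists N => n /HN un; apply: le_trans (opnorm_ub _ _) _.
    by rewrite ler_wpM2r ?l2norm_ge0.
  - exact: svalP (H x).
pose L x := s2val (cid2 (F x)).
have LE x k : L x k = sval (H x) k :> R[i] by exact: (s2valP (cid2 (F x)) k).
have Lc x k : ccvg (fun n => u n x k) (L x k) by rewrite LE; exact: svalP (H x) k.
have Lb : L \in @bounded_op R.
  apply/bounded_opP; split; last by exists M => // x; exact: (s2valP' (cid2 (F x))).
  move=> c x y; apply: l2_ext => k; apply: (ccvg_unique (Lc _ k)).
  have := ccvgD (ccvgZ c (Lc x k)) (Lc y k); apply: ccvg_eq.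
  by exists 0%N => n _; rewrite bopD bopZ l2D l2Z.
exists (Bop Lb) => e e0; have [N HN] := cu e e0; exists N => n Nn.
apply: opnorm_le_bound => [|x]; first exact: ltW.
rewrite bop_subE /=.
have [||k|y yE ny] := @l2_fatou R (fun m => u n x - u m x) (u n x - L x) (e * l2norm x).
- by rewrite mulr_ge0 ?l2norm_ge0// ltW.
- exists N => m Nm; rewrite -bop_subE; apply: le_trans (opnorm_ub _ _) _.
  by rewrite ler_wpM2r ?l2norm_ge0// HN.
- have := ccvgB (@ccvg_cst _ (u n x k)) (Lc x k).
  by apply: ccvg_eq; exists 0%N => m _; rewrite l2B.
- by have -> : u n x - L x = y by apply: l2_ext => k; rewrite yE.
Qed.

Lemma opcvg_series (u : nat -> bop R) (B : R) : (forall n, \sum_(k < n) opnorm (u k) <= B) ->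
  exists A, opcvg (series u) A.
Proof.
move=> uB; apply: opcvg_complete => e e0.
have : cvgn (series (fun i => opnorm (u i))).
  apply: nondecreasing_is_cvgn.
    by apply: nondecreasing_series => k _ _; exact: opnorm_ge0.
  by exists B => _ [n _ <-]; rewrite /series/= big_mkord.
move=> /cauchy_cvgP/cauchy_seriesP/(_ e e0)[[X Y] /= [[N1 _ HX] [N2 _ HY]] HXY].
have H m n : (maxn N1 N2 <= m)%N -> (m <= n)%N -> opnorm (series u n - series u m) <= e.
  move=> Nm mn; rewrite /series/= (@big_cat_nat _ _ _ m 0 n)//= [X in opnorm X]addrC addKr.
  apply: le_trans (opnorm_sum _ _) _.
  have /= := HXY (m, n); rewrite ger0_norm ?sumr_ge0//; last by move=> ? _; exact: opnorm_ge0.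
  move=> HH; apply/ltW/HH; split.
    by apply: HX; exact: leq_trans (leq_maxl _ _) Nm.
  by apply: HY; apply: leq_trans mn; exact: leq_trans (leq_maxr _ _) Nm.
exists (maxn N1 N2) => m n Nm Nn; have [mn|/ltnW nm] := leqP m n.
  by rewrite opnorm_distC H.
exact: H.
Qed.

Lemma normbE A : `|A| = (opnorm A)%:C. Proof. by []. Qed.

Lemma opcvgP (u : nat -> bop R) A : u @ \oo --> A <-> opcvg u A.
Proof.
split=> [/cvgrPdist_le uA e e0|uA].
  have [|N _ HN] := uA e%:C; first by rewrite ltcR.
  by exists N => n /HN; rewrite normbE lecR opnorm_distC.
apply/cvgrPdist_le => -[e e'] /=; rewrite ltcE/= => /andP[/eqP -> e0].
have [N HN] := uA _ e0; exists N => // n /= Nn.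
by rewrite normbE lecR opnorm_distC HN.
Qed.

Lemma opcvg_lim (u : nat -> bop R) A : opcvg u A -> limn u = A.
Proof. by move=> /opcvgP uA; apply: cvg_lim. Qed.

Lemma closed_opcvg (S : set (bop R)) u A : closed S -> (forall n, S (u n)) -> opcvg u A -> S A.
Proof.
move=> cS Su /opcvgP uA; apply: cS => V /uA[N _ HN]; exists (u N).
by split; [exact: Su|apply: HN => /=].
Qed.

Lemma closed_approx (S : set (bop R)) :
  closed [set A | forall e : R, 0 < e -> exists2 B, S B & opnorm (A - B) <= e].
Proof.
move=> A clA e e0; have e2 : 0 < e / 2 by rewrite divr_gt0.
have [|B [HB AB]] := clA (ball A (e / 2)%:C).
  by apply: nbhsx_ballx; rewrite ltcR.
have [C SC BC] := HB _ e2; exists C => //.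
rewrite -[A](subrK B) -addrA; apply: le_trans (opnormD _ _) _.
rewrite [e]splitr lerD//; move: AB; rewrite -ball_normE/= normbE ltcR => /ltW//.
Qed.

End OperatorNorm.

(** * Inner product and adjoints *)

Section InnerProduct.
Variable R : realType.
Implicit Types (A B C : bop R) (x y z : l2 R) (n : nat) (l : int) (c : R[i]).

Notation E := (basis_vec R).

Lemma normc_conj c : normc (conjc c) = normc c.
Proof. by case: c => a b /=; rewrite sqrrN. Qed.

Lemma conjcB (a b : R[i]) : conjc (a - b) = conjc a - conjc b.
Proof. exact: rmorphB. Qed.

Lemma conjcD (a b : R[i]) : conjc (a + b) = conjc a + conjc b.
Proof. exact: rmorphD. Qed.

Lemma conjcM (a b : R[i]) : conjc (a * b) = conjc a * conjc b.
Proof. exact: rmorphM. Qed.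

Definition dpart x y n : R[i] :=
  \sum_(k < n) (x (Posz k) * conjc (y (Posz k)) + x (Negz k) * conjc (y (Negz k))).

Lemma normc_sum (I : Type) (r : seq I) (P : pred I) (F : I -> R[i]) :
  normc (\sum_(i <- r | P i) F i) <= \sum_(i <- r | P i) normc (F i).
Proof.
elim/big_ind2: _ => [|a b c d ab cd|//]; first by rewrite normc0.
by apply: le_trans (le_normcD _ _) _; exact: lerD.
Qed.

(** Cauchy-Schwarz for partial sums, from the weighted inequality [2 a b <= c a^2 + b^2 / c]; the
    ratio of the two norms is the weight that makes it sharp. *)
Lemma dpart_le x y n : normc (dpart x y n) <= l2norm x * l2norm y.
Proof.
have [x0|x0] := eqVneq (l2norm x) 0.
  rewrite (l2norm0_eq0 x0) l2norm0 mul0r /dpart big1 ?normc0// => k _.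
  by rewrite !l2_0 !mul0r addr0.
have [y0|y0] := eqVneq (l2norm y) 0.
  rewrite (l2norm0_eq0 y0) l2norm0 mulr0 /dpart big1 ?normc0// => k _.
  by rewrite !l2_0 conjc0 !mulr0 addr0.
have {}x0 : 0 < l2norm x by rewrite lt_def x0 l2norm_ge0.
have {}y0 : 0 < l2norm y by rewrite lt_def y0 l2norm_ge0.
pose c := l2norm y / l2norm x; have c0 : 0 < c by exact: divr_gt0.
have AM (u v : R[i]) : normc (u * conjc v) <= (c * normc u ^+ 2 + c^-1 * normc v ^+ 2) / 2.
  rewrite normcM normc_conj; set a := normc u; set b := normc v.
  rewrite -subr_ge0.
  have -> : (c * a ^+ 2 + c^-1 * b ^+ 2) / 2 - a * b = (c * a - b) ^+ 2 * c^-1 / 2.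
    by field; rewrite gt_eqF.
  by rewrite divr_ge0// mulr_ge0 ?sqr_ge0// invr_ge0 ltW.
apply: (@le_trans _ _ ((c * ssum x n + c^-1 * ssum y n) / 2)).
  apply: le_trans (normc_sum _ _ _) _.
  rewrite /ssum !mulr_sumr -big_split/= mulr_suml; apply: ler_sum => k _.
  apply: le_trans (le_normcD _ _) _.
  apply: le_trans (lerD (AM _ _) (AM _ _)) _.
  by rewrite le_eqVlt; apply/orP; left; apply/eqP; field; rewrite gt_eqF.
apply: (@le_trans _ _ ((c * l2norm x ^+ 2 + c^-1 * l2norm y ^+ 2) / 2)).
  rewrite ler_pM2r ?invr_gt0//; apply: lerD.
    by rewrite ler_pM2l// ssum_l2norm.
  by rewrite ler_pM2l ?invr_gt0// ssum_l2norm.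
by rewrite le_eqVlt; apply/orP; left; apply/eqP; rewrite /c; field; rewrite !gt_eqF.
Qed.

Lemma dpartDl c x y z n : dpart (c *: x + y) z n = c * dpart x z n + dpart y z n.
Proof.
rewrite /dpart mulr_sumr -big_split; apply: eq_bigr => k _.
by rewrite !l2D !l2Z -[RHS]/(_ + _); ring.
Qed.

Lemma dpart_conj x y n : dpart y x n = conjc (dpart x y n).
Proof.
rewrite /dpart rmorph_sum/=; apply: eq_bigr => k _.
by rewrite rmorphD !rmorphM/= !conjcK; congr (_ + _); rewrite mulrC.
Qed.

Lemma dpart_basis l y : ccvg (dpart (E l) y) (conjc (y l)).
Proof.
apply: ccvg_eq (@ccvg_cst _ (conjc (y l))); exists (`|l|.+1) => n ln.
rewrite /dpart; case: l ln => l ln.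
  rewrite (bigD1 (Ordinal ln))//= ?basis_vecE eqxx mul1r mul0r addr0.
  rewrite big1 ?addr0// => k kl; rewrite ?basis_vecE ?eqz_nat.
  have -> : (k == l :> nat) = false by apply: contraNF kl => /eqP kl; apply/eqP/val_inj.
  by rewrite !mul0r addr0.
have ln' : (l < n)%N by exact: ltnW.
rewrite (bigD1 (Ordinal ln'))//= ?basis_vecE eqxx mul1r mul0r add0r.
rewrite big1 ?addr0// => k kl; rewrite ?basis_vecE.
have -> : (Negz k == Negz l) = false.
  by apply: contraNF kl => /eqP [kl]; apply/eqP/val_inj.
by rewrite !mul0r addr0.
Qed.

(** The vectors [x] for which the partial sums converge include the basis and form a closed
    subspace, by the uniform bound [dpart_le]. *)
Lemma dpart_is_cvg x y : exists w, ccvg (dpart x y) w.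
Proof.
pose P x := exists w, ccvg (dpart x y) w.
apply: ccvg_complete => e e0.
have y1 : 0 < l2norm y + 1 by rewrite ltr_wpDl ?l2norm_ge0.
have e3 : 0 < e / 3 / (l2norm y + 1) by rewrite divr_gt0// divr_gt0.
have [|l|c u v [a ua] [b vb]|x' [a x'a] xx'] := @l2_dense R P _ _ _ x _ e3.
- exists 0; apply: ccvg_eq (@ccvg_cst _ 0); exists 0%N => n _.
  by rewrite /dpart big1// => k _; rewrite !l2_0 !mul0r addr0.
- by exists (conjc (y l)); exact: dpart_basis.
- exists (c * a + b); have := ccvgD (ccvgZ c ua) vb; apply: ccvg_eq.
  by exists 0%N => n _; rewrite dpartDl.
have [|N HN] := x'a (e / 6); first by rewrite divr_gt0.
have d n : normc (dpart x y n - dpart x' y n) <= e / 3.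
  have -> : dpart x y n - dpart x' y n = dpart (x - x') y n.
    rewrite (_ : x - x' = (-1) *: x' + x); last by rewrite scaleN1r [LHS]addrC.
    by rewrite dpartDl; ring.
  apply: le_trans (dpart_le _ _ _) _.
  apply: (@le_trans _ _ (l2norm (x - x') * (l2norm y + 1))).
    by rewrite ler_wpM2l ?l2norm_ge0// lerDl.
  by rewrite -ler_pdivlMr.
exists N => m n /HN Nm /HN Nn.
apply: le_trans (normc_triangle _ (dpart x' y m) _) _.
have := normc_triangle (dpart x' y m) (dpart x' y n) (dpart x y n).
have := normc_triangle (dpart x' y m) a (dpart x' y n).
rewrite (normc_distC a) (normc_distC (dpart x' y n) (dpart x y n)).
have := d m; have := d n; move: Nm Nn.
by set u1 := normc _; set u2 := normc _; lra.
Qed.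

Lemma dotp_cvg x y : ccvg (dpart x y) (dotp x y).
Proof.
have [l xl] := dpart_is_cvg x y; suff -> : dotp x y = l by [].
rewrite /dotp /bilateral_sum; apply: ccvg_lim; apply: ccvg_eq xl.
by exists 0%N => n _; rewrite /bilateral_series /series/= big_mkord.
Qed.

Lemma dotpDl c x y z : dotp (c *: x + y) z = c * dotp x z + dotp y z.
Proof.
apply: (ccvg_unique (dotp_cvg _ _)).
apply: ccvg_eq (ccvgD (ccvgZ c (dotp_cvg x z)) (dotp_cvg y z)).
by exists 0%N => n _; rewrite dpartDl.
Qed.

Lemma dotp_conj x y : dotp y x = conjc (dotp x y).
Proof.
apply: (ccvg_unique (dotp_cvg _ _)) => e e0; have [N HN] := dotp_cvg x y e0.
by exists N => n /HN; rewrite (dpart_conj x y) -conjcB normc_conj.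
Qed.

Lemma dotpDr c x y z : dotp z (c *: x + y) = conjc c * dotp z x + dotp z y.
Proof. by rewrite dotp_conj dotpDl conjcD conjcM -!dotp_conj. Qed.

Lemma dotp_basisl l y : dotp (E l) y = conjc (y l).
Proof. exact: ccvg_unique (dotp_cvg _ _) (dpart_basis _ _). Qed.

Lemma dotp_basisr l x : dotp x (E l) = x l.
Proof. by rewrite dotp_conj dotp_basisl conjcK. Qed.

Lemma dotp_le x y : normc (dotp x y) <= l2norm x * l2norm y.
Proof.
apply: (ccvg_normc_le (dotp_cvg x y)); exists 0%N => n _; exact: dpart_le.
Qed.

Lemma dotpxx x : dotp x x = (l2norm x ^+ 2)%:C.
Proof.
apply: (ccvg_unique (dotp_cvg _ _)) => e e0; have [N HN] := ssum_cvg x e0.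
exists N => n /HN xn.
have -> : dpart x x n = (ssum x n)%:C.
  have sq (c : R[i]) : c * conjc c = (normc c ^+ 2)%:C.
    case: c => a b; rewrite /normc sqr_sqrtr ?addr_ge0 ?sqr_ge0//.
    by rewrite /GRing.mul/=; congr (_ +i* _); ring.
  rewrite /dpart /ssum rmorph_sum/=; apply: eq_bigr => k _.
  by rewrite !sq rmorphD.
rewrite -rmorphB /normc/= expr0n/= addr0 sqrtr_sqr ler_norml.
have := ssum_l2norm x n; lra.
Qed.

Lemma dotp0l y : dotp 0 y = 0.
Proof. by apply/eq0_normc/eqP; rewrite eq_le normc_ge0 andbT -(mul0r (l2norm y)) -(l2norm0 R) dotp_le. Qed.

(** Both sides are bounded and sesquilinear, so agreement on the basis extends, one variable at a
    time. *)
Lemma adjoint_entries A B : (forall k l, A (E l) k = conjc (B (E k) l) :> R[i]) -> adjoint A B.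
Proof.
move=> AB.
have cont (f : l2 R -> R[i]) (M : R) x : 0 <= M -> (forall x, normc (f x) <= M * l2norm x) ->
    (forall c x y, f (c *: x + y) = c * f x + f y) -> (forall l, f (E l) = 0) -> f x = 0.
  move=> M0 fM fD fE; apply/eq0_normc/eqP; rewrite eq_le normc_ge0 andbT.
  apply/ler_addgt0Pl => e e0; rewrite addr0.
  have M1 : 0 < M + 1 by rewrite ltr_wpDl.
  have f0 : f 0 = 0.
    by apply/eq0_normc/eqP; rewrite eq_le normc_ge0 andbT (le_trans (fM 0))// l2norm0 mulr0.
  have [c u v fu fv||y fy xy] := @l2_dense R (fun y => f y = 0) f0 fE _ x (e / (M + 1)).
  - by rewrite fD fu fv mulr0 addr0.
  - by rewrite divr_gt0.
  have -> : f x = f (x - y).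
    rewrite (_ : x - y = (-1) *: y + x); last by rewrite scaleN1r [LHS]addrC.
    by rewrite fD fy mulr0 add0r.
  apply: le_trans (fM _) _; apply: (@le_trans _ _ ((M + 1) * l2norm (x - y))).
    by rewrite ler_wpM2r ?l2norm_ge0// lerDl.
  by rewrite -ler_pdivlMl// mulrC.
have H1 x k : dotp (A x) (E k) = dotp x (B (E k)).
  apply/eqP; rewrite -subr_eq0; apply/eqP.
  apply: (cont (fun x => dotp (A x) (E k) - dotp x (B (E k))) (opnorm A + l2norm (B (E k)))).
  - by rewrite addr_ge0 ?opnorm_ge0 ?l2norm_ge0.
  - move=> y; apply: le_trans (le_normcD _ _) _; rewrite normcN mulrDl; apply: lerD.
      by apply: le_trans (dotp_le _ _) _; rewrite l2norm_basis mulr1 opnorm_ub.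
    by rewrite mulrC dotp_le.
  - by move=> c y z; rewrite bopD bopZ !dotpDl; ring.
  - by move=> l; rewrite dotp_basisr dotp_basisl AB subrr.
(* Conjugation makes the difference linear in [y], so that [cont] applies. *)
move=> x y; apply/eqP; rewrite -subr_eq0; apply/eqP; apply: (inv_inj (@conjcK R)); rewrite conjc0.
apply: (cont (fun y => conjc (dotp (A x) y - dotp x (B y))) (l2norm (A x) + l2norm x * opnorm B)).
- by rewrite addr_ge0 ?mulr_ge0 ?opnorm_ge0 ?l2norm_ge0.
- move=> z; rewrite normc_conj; apply: le_trans (le_normcD _ _) _; rewrite normcN mulrDl; apply: lerD.
    exact: dotp_le.
  by rewrite -mulrA; apply: le_trans (dotp_le _ _) _; rewrite ler_wpM2l ?l2norm_ge0// opnorm_ub.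
- move=> c u v; rewrite bopD bopZ !dotpDr -[in RHS](conjcK c) -conjcM -conjcD; congr conjc.
  by ring.
- by move=> l; rewrite H1 subrr conjc0.
Qed.

Lemma adjointE A B : adjoint A B -> forall k l, A (E l) k = conjc (B (E k) l) :> R[i].
Proof. by move=> AB k l; rewrite -dotp_basisr AB dotp_basisl. Qed.

Lemma adjoint_unique A B C : adjoint A B -> adjoint A C -> B = C.
Proof.
move=> AB AC; apply: bop_ext => k; apply: l2_ext => l.
by apply: (inv_inj (@conjcK R)); rewrite -!(adjointE AB, adjointE AC).
Qed.

(** [l2norm (B y) ^+ 2] is the inner product of [A (B y)] with [y]. *)
Lemma adjoint_opnorm A B : adjoint A B -> opnorm B <= opnorm A.
Proof.
move=> AB; apply: opnorm_le_bound => [|y]; first exact: opnorm_ge0.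
have [->|By0] := eqVneq (l2norm (B y)) 0; first by rewrite mulr_ge0 ?opnorm_ge0 ?l2norm_ge0.
have {}By0 : 0 < l2norm (B y) by rewrite lt_def By0 l2norm_ge0.
rewrite -(ler_pM2l By0) -[leLHS]expr2.
have := AB (B y) y; rewrite dotpxx => /(congr1 (@normc R)).
rewrite [in RHS]/normc/= expr0n/= addr0 sqrtr_sqr ger0_norm ?sqr_ge0// => <-.
apply: le_trans (dotp_le _ _) _; rewrite mulrA ler_wpM2r ?l2norm_ge0// mulrC.
exact: opnorm_ub.
Qed.

Lemma adjD A B A' B' c : adjoint A B -> adjoint A' B' ->
  adjoint (c *: A + A') (conjc c *: B + B').
Proof.
move=> AB AB'; apply: adjoint_entries => k l.
rewrite !bop_addE !bop_scaleE !l2D !l2Z (adjointE AB) (adjointE AB').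
by rewrite conjcD conjcM conjcK.
Qed.

Lemma adjM A B A' B' : adjoint A B -> adjoint A' B' -> adjoint (A * A') (B' * B).
Proof. by move=> AB AB' x y; rewrite !bop_mulE AB AB'. Qed.

Lemma adjC A B : adjoint A B -> adjoint B A.
Proof. by move=> AB x y; rewrite dotp_conj -AB -dotp_conj. Qed.

Lemma adjE A B : adjoint A B -> adj A = B.
Proof.
move=> AB; have H : [set B | adjoint A B] (adj A) by apply: xgetPex; exists B.
exact: adjoint_unique H AB.
Qed.

End InnerProduct.

(** * Shifts and diagonal operators *)

Section ConcreteOperators.
Variables (R : realType) (s : nat).
Hypothesis hs : (2 <= s)%N.
Implicit Types (A B : bop R) (x y : l2 R) (n : nat) (k l : int) (c : R[i]) (W : int -> R[i]).

Notation E := (basis_vec R).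
Notation sz := (s%:Z).

(** Diagonal operators, [V] and its adjoint all have this shape: multiplication after composition
    with a map that is injective on the support of the weight. *)
Lemma weighted_pullback W (p : int -> int) (B : R) : (forall k, normc (W k) <= B) ->
  (forall k l, W k != 0 -> W l != 0 -> p k = p l -> k = l) ->
  exists2 A : bop R, (forall x k, A x k = W k * x (p k) :> R[i]) & opnorm A <= B.
Proof.
move=> WB pinj; have B0 : 0 <= B := le_trans (normc_ge0 _) (WB 0).
pose f x : int -> R[i]^o := fun k => W k * x (p k).
pose D : set int := [set k | W k != 0].
have sqf x : (sqsum (f x) <= ((B * l2norm x) ^+ 2)%:E)%E.
  rewrite exprMn EFinM -sqsumE /sqsum (esumID D); last by move=> k _; rewrite lee_fin sqr_ge0.
  rewrite !setTI [X in (_ + X)%E]esum1 ?adde0; last first.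
    by move=> k /= /negP; rewrite negbK => /eqP W0; rewrite /f W0 mul0r normc0 expr0n.
  apply: (@le_trans _ _ (\esum_(k in D) (B ^+ 2 * normc (x (p k)) ^+ 2)%:E)%E).
    apply: le_esum => k _; rewrite lee_fin /f normcM exprMn.
    by rewrite ler_wpM2r ?sqr_ge0// lerXn2r ?nnegrE ?normc_ge0.
  rewrite -(@esum_image _ _ _ D p (fun k => (B ^+ 2 * normc (x k) ^+ 2)%:E)); last first.
    by move=> k l; rewrite !inE/= => Wk Wl; exact: pinj.
  apply: le_trans (le_esumZ (sqr_ge0 _) (fun k => sqr_ge0 _)).
  rewrite [leRHS](esumID (p @` D)); last first.
    by move=> k _; rewrite lee_fin mulr_ge0 ?sqr_ge0.
  by rewrite setTI leeDl// esum_ge0// => k _; rewrite lee_fin mulr_ge0 ?sqr_ge0.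
have f2 x : f x \in @square_summable R.
  by rewrite unfold_in; apply: le_lt_trans (sqf x) (ltry _).
pose A x : l2 R := L2 (f2 x).
have nA x : l2norm (A x) <= B * l2norm x.
  rewrite -(@ler_pXn2r _ 2) ?nnegrE ?mulr_ge0 ?l2norm_ge0//.
  by rewrite -lee_fin -sqsumE; exact: sqf.
have Abd : A \in @bounded_op R.
  apply/bounded_opP; split; last by exists B.
  move=> c x y; apply: l2_ext => k.
  have E1 : W k * (c * x (p k) + y (p k)) = c * (W k * x (p k)) + W k * y (p k).
    by rewrite mulrDr mulrCA.
  exact: E1.
exists (Bop Abd); first by [].
exact: opnorm_le_bound.
Qed.

Definition bdd W := exists B : R, forall l, normc (W l) <= B.

(** Total in [W], with value 0 when no such operator exists; boundedness of the symbol is carried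
    separately as [bdd W]. *)
Definition dg W : bop R := xget 0 [set A : bop R | forall x k, A x k = W k * x k :> R[i]].

Lemma dgP W (B : R) : (forall l, normc (W l) <= B) ->
  (forall x k, dg W x k = W k * x k :> R[i]) /\ opnorm (dg W) <= B.
Proof.
move=> WB; have [A AE nA] := @weighted_pullback W id B WB (fun k l _ _ e => e).
have H : [set A : bop R | forall x k, A x k = W k * x k :> R[i]] (dg W) by apply: xgetPex; exists A.
split=> //; suff -> : dg W = A by [].
by apply: bop_eq => x; apply: l2_ext => k; rewrite H AE.
Qed.

Lemma dgE W : bdd W -> forall x k, dg W x k = W k * x k :> R[i].
Proof. by move=> [B WB]; have [] := dgP WB. Qed.

Lemma dg_opnorm W (B : R) : (forall l, normc (W l) <= B) -> opnorm (dg W) <= B.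
Proof. by move=> WB; have [] := dgP WB. Qed.

Lemma dg_basis W l : bdd W -> dg W (E l) = W l *: E l.
Proof.
move=> bW; apply: l2_ext => k; rewrite dgE// l2Z !basis_vecE.
by case: eqP => [->|]; rewrite ?mulr0.
Qed.

Lemma sz_gt0 : 0 < sz. Proof. by rewrite ltz_nat ltnW. Qed.
Lemma szX_neq0 n : sz ^+ n != 0. Proof. by rewrite expf_neq0// gt_eqF// sz_gt0. Qed.
Lemma szXK n l : (sz ^+ n * l %/ sz ^+ n)%Z = l.
Proof. by rewrite mulrC mulzK// szX_neq0. Qed.

(** [V] and [Vs] are given by their action on coordinates, which makes products computable;
    [shiftVE'] and [adj_shiftVE] identify them with [shiftV] and its adjoint. *)
Definition V : bop R := xget 0 [set A : bop R | forall x k,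
  A x k = (if (sz %| k)%Z then x (k %/ sz)%Z else 0) :> R[i]].
Definition Vs : bop R := xget 0 [set A : bop R | forall x k, A x k = x (sz * k) :> R[i]].

Lemma VP : (forall x k, V x k = (if (sz %| k)%Z then x (k %/ sz)%Z else 0) :> R[i]) /\
  opnorm V <= 1.
Proof.
have [|k l|A AE nA] := @weighted_pullback (fun k => if (sz %| k)%Z then 1 else 0)
  (fun k => (k %/ sz)%Z) 1.
- by move=> k; case: ifP => _; rewrite ?normc1 ?normc0.
- case: ifPn => [dk _|]; last by rewrite eqxx.
  case: ifPn => [dl _|]; last by rewrite eqxx.
  by move=> e; rewrite -(divzK dk) -(divzK dl) e.
have AE' x k : A x k = (if (sz %| k)%Z then x (k %/ sz)%Z else 0) :> R[i].
  by rewrite AE; case: ifP => _; rewrite ?mul1r ?mul0r.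
have H : [set A : bop R | forall x k, A x k = (if (sz %| k)%Z then x (k %/ sz)%Z else 0) :> R[i]] V.
  by apply: xgetPex; exists A.
split=> //; suff -> : V = A by [].
by apply: bop_eq => x; apply: l2_ext => k; rewrite H AE'.
Qed.

Lemma VsP : (forall x k, Vs x k = x (sz * k) :> R[i]) /\ opnorm Vs <= 1.
Proof.
have [|k l _ _|A AE nA] := @weighted_pullback (fun k => 1) (fun k => sz * k) 1.
- by move=> k; rewrite normc1.
- by apply: mulfI; rewrite gt_eqF// sz_gt0.
have AE' x k : A x k = x (sz * k) :> R[i] by rewrite AE mul1r.
have H : [set A : bop R | forall x k, A x k = x (sz * k) :> R[i]] Vs by apply: xgetPex; exists A.
split=> //; suff -> : Vs = A by [].
by apply: bop_eq => x; apply: l2_ext => k; rewrite H AE'.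
Qed.

Lemma dvdz_szS n k : (sz ^+ n.+1 %| k)%Z = (sz %| k)%Z && (sz ^+ n %| (k %/ sz))%Z.
Proof.
have s0 : sz != 0 by rewrite gt_eqF// sz_gt0.
apply/idP/andP => [/dvdzP[q ->]|[/dvdzP[q ->]]].
  rewrite exprSr mulrA mulzK//; split; first exact: dvdz_mull.
  exact: dvdz_mull.
by rewrite mulzK// => /dvdzP[r ->]; rewrite -mulrA -exprSr dvdz_mull.
Qed.

Lemma VXE n x k : (V ^+ n) x k = (if (sz ^+ n %| k)%Z then x (k %/ sz ^+ n)%Z else 0) :> R[i].
Proof.
elim: n x k => [|n IH] x k; first by rewrite !expr0 dvd1z divz1.
rewrite [in LHS]exprS bop_mulE VP.1 dvdz_szS; case: ifP => //= dk.
rewrite IH; case: ifP => // dk'; congr (l2_val x _).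
rewrite -{2}(divzK dk) -{2}(divzK dk') -mulrA -exprSr mulzK//.
exact: szX_neq0.
Qed.

Lemma VsXE n x k : (Vs ^+ n) x k = x (sz ^+ n * k) :> R[i].
Proof.
elim: n x k => [|n IH] x k; first by rewrite !expr0 mul1r.
by rewrite [in LHS]exprS bop_mulE VsP.1 IH [in RHS]exprSr mulrA.
Qed.

Lemma opnorm_VX n : opnorm (V ^+ n) <= 1. Proof. exact: opnormX VP.2. Qed.
Lemma opnorm_VsX n : opnorm (Vs ^+ n) <= 1. Proof. exact: opnormX VsP.2. Qed.

Lemma VX_basis n l : (V ^+ n) (E l) = E (sz ^+ n * l).
Proof.
apply: l2_ext => k; rewrite VXE !basis_vecE; case: ifPn => [/dvdzP[q ->]|dk].
  rewrite mulzK ?szX_neq0// mulrC; congr (_%:R); congr nat_of_bool.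
  by apply/eqP/eqP => [->//|]; apply: mulfI; exact: szX_neq0.
by case: eqP dk => // ->; rewrite dvdz_mulr.
Qed.

Lemma VsX_basis n l : (Vs ^+ n) (E (sz ^+ n * l)) = E l.
Proof.
apply: l2_ext => k; rewrite VsXE !basis_vecE; congr (_%:R); congr nat_of_bool.
by apply/eqP/eqP => [|->//]; apply: mulfI; exact: szX_neq0.
Qed.

Lemma VsX_basis0 n l : ~~ (sz ^+ n %| l)%Z -> (Vs ^+ n) (E l) = 0.
Proof.
move=> dl; apply: l2_ext => k; rewrite VsXE basis_vecE l2_0.
by case: eqP dl => // <-; rewrite dvdz_mulr.
Qed.

Lemma VsV : Vs * V = 1.
Proof.
apply: bop_eq => x; apply: l2_ext => k; rewrite bop_mulE VsP.1 VP.1 dvdz_mulr//.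
by rewrite mulrC mulzK// gt_eqF// sz_gt0.
Qed.

Lemma VsXVX n : Vs ^+ n * V ^+ n = 1.
Proof.
elim: n => [|n IH]; first by rewrite !expr0 mulr1.
by rewrite exprSr exprS mulrA -[X in X * _](mulrA _ Vs V) VsV mulr1.
Qed.

Lemma bddM W W' : bdd W -> bdd W' -> bdd (fun k => W k * W' k).
Proof.
move=> [B WB] [B' WB']; exists (B * B') => l; rewrite normcM.
by apply: ler_pM => //; exact: normc_ge0.
Qed.

Lemma bdd_comp W (p : int -> int) : bdd W -> bdd (fun k => W (p k)).
Proof. by move=> [B WB]; exists B => l. Qed.

Lemma dgM W W' : bdd W -> bdd W' -> dg W * dg W' = dg (fun k => W k * W' k).
Proof.
move=> bW bW'; apply: bop_eq => x; apply: l2_ext => k.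
by rewrite bop_mulE !dgE ?mulrA//; exact: bddM.
Qed.

Lemma dg_VX W n : bdd W -> dg W * V ^+ n = V ^+ n * dg (fun k => W (sz ^+ n * k)).
Proof.
move=> bW; apply: bop_eq => x; apply: l2_ext => k; rewrite !bop_mulE dgE// !VXE.
case: ifPn => [dk|_]; last by rewrite mulr0.
by rewrite dgE; [rewrite [sz ^+ n * _]mulrC divzK|exact: bdd_comp].
Qed.

Lemma VsX_dg W n : bdd W -> Vs ^+ n * dg W = dg (fun k => W (sz ^+ n * k)) * Vs ^+ n.
Proof.
move=> bW; apply: bop_eq => x; apply: l2_ext => k; rewrite !bop_mulE VsXE dgE//.
by rewrite dgE ?VsXE//; exact: bdd_comp.
Qed.

Lemma V_adj : adjoint V Vs.
Proof.
apply: adjoint_entries => k l; have := VX_basis 1 l; rewrite !expr1 => ->.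
have := VsXE 1 (E k) l; rewrite !expr1 => ->; rewrite !basis_vecE eq_sym.
by case: eqP => _; rewrite ?conjc1 ?conjc0.
Qed.

Lemma dg_adj W : bdd W -> adjoint (dg W) (dg (fun k => conjc (W k))).
Proof.
move=> bW; have bW' : bdd (fun k => conjc (W k)).
  by case: bW => B WB; exists B => l; rewrite normc_conj.
apply: adjoint_entries => k l; rewrite !dgE// !basis_vecE conjcM conjcK.
by rewrite eq_sym; case: eqP => [->|_]; rewrite ?conjc1 ?conjc0 ?mulr0.
Qed.

Lemma adjX A B n : adjoint A B -> adjoint (A ^+ n) (B ^+ n).
Proof.
move=> AB; elim: n => [|n IH]; first by move=> x y; rewrite !expr0.
by rewrite exprSr exprS; exact: adjM.
Qed.

Lemma shiftVE' : shiftV R s = V.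
Proof.
apply: bop_ext => l; rewrite shiftVE; last exact: ltnW.
by have := VX_basis 1 l; rewrite !expr1 => ->.
Qed.

Lemma adj_shiftVE : adj (shiftV R s) = Vs.
Proof. by rewrite shiftVE'; exact: adjE V_adj. Qed.

(** Exponents up to [|l|] suffice because [m < s ^ m]. At [l = 0] the range contains only 0, so that
    [nu 0 = 0]. *)
Definition nu (l : int) : nat := \max_(m < `|l|.+1 | (sz ^+ m %| l)%Z) m.

Lemma szX_dvd_cop n m l : ~~ (sz %| l)%Z -> (sz ^+ n %| sz ^+ m * l)%Z = (n <= m)%N.
Proof.
move=> dl; apply/idP/idP => [|nm]; last by rewrite dvdz_mulr// dvdz_exp2l.
apply: contraTT; rewrite -ltnNge => mn; have [j ->] : exists j : nat, n = (m + j.+1)%N.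
  by exists (n - m.+1)%N; lia.
rewrite exprD dvdz_mul2l; last exact: szX_neq0.
apply: contra dl; apply: dvdz_trans; rewrite exprS; exact: dvdz_mulr.
Qed.

Lemma nu_cop m l : ~~ (sz %| l)%Z -> nu (sz ^+ m * l) = m.
Proof.
move=> dl; rewrite /nu; apply/eqP; rewrite eqn_leq; apply/andP; split.
  by apply/bigmax_leqP => i; rewrite szX_dvd_cop.
have l0 : l != 0 by apply: contraNneq dl => ->; rewrite dvdz0.
have mb : (m < `|(sz ^+ m * l)%R|.+1)%N.
  rewrite ltnS abszM abszX absz_nat; apply: leq_trans (leq_pmulr _ _); last by rewrite absz_gt0.
  by apply: ltnW; apply: ltn_expl.
apply: (@leq_bigmax_cond _ (fun i : 'I_(`|(sz ^+ m * l)%R|.+1) => (sz ^+ i %| sz ^+ m * l)%Z)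
  (fun i => nat_of_ord i) (Ordinal mb)).
by rewrite szX_dvd_cop.
Qed.

Lemma cop_decomp l : l != 0 -> exists m l', l = sz ^+ m * l' /\ ~~ (sz %| l')%Z.
Proof.
move: {2}(`|l|.+1)%N (ltnSn `|l|%N) => n; elim: n l => [//|n IH] l ln l0.
have [/dvdzP[q lq]|dl] := boolP (sz %| l)%Z; last by exists 0%N, l; rewrite expr0 mul1r.
have q0 : q != 0 by apply: contraNneq l0 => q0; rewrite lq q0 mul0r.
have [|m [l' [qE dl']]] := IH q _ q0.
  rewrite lq abszM absz_nat in ln; rewrite -absz_gt0 in q0; nia.
by exists m.+1, l'; split=> //; rewrite lq qE exprS mulrC mulrA.
Qed.

Lemma nu_szX n l : l != 0 -> nu (sz ^+ n * l) = (n + nu l)%N.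
Proof.
by move=> /cop_decomp[m [l' [-> dl']]]; rewrite mulrA -exprD !nu_cop.
Qed.

Lemma nu_cop0 l : ~~ (sz %| l)%Z -> nu l = 0%N.
Proof. by move=> dl; rewrite -[l]mul1r -(expr0 sz) nu_cop. Qed.

Definition unit_part l : int := (l %/ sz ^+ nu l)%Z.

Lemma unit_part_cop m l : ~~ (sz %| l)%Z -> unit_part (sz ^+ m * l) = l.
Proof. by move=> dl; rewrite /unit_part nu_cop// szXK. Qed.

End ConcreteOperators.

(** * Commutator estimates *)

Section Seminorms.
Variable R : realType.
Implicit Types (A B N X Y D : bop R) (n r k : nat) (c : R[i]).

Definition comm A X : bop R := A * X - X * A.

Lemma commD A X Y : comm A (X + Y) = comm A X + comm A Y.
Proof. by rewrite /comm mulrDr mulrDl opprD addrACA. Qed.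

Lemma commN A X : comm A (- X) = - comm A X.
Proof. by rewrite /comm mulrN mulNr opprB opprK addrC. Qed.

Lemma commM A X Y : comm A (X * Y) = comm A X * Y + X * comm A Y.
Proof.
rewrite /comm mulrBl mulrBr !mulrA.
by rewrite addrA subrK.
Qed.

Lemma opnormZ c A : opnorm (c *: A) = normc c * opnorm A.
Proof. by have := normrZ c A; rewrite normbE -[`|c|]/((normc c)%:C) normbE -rmorphM => /complexI. Qed.

(* comm_norm is submultiplicative and weight_norm, which dominates N^p D N^q for
   p + q <= r, is a bimodule norm over it. *)
Fixpoint comm_norm N r X : R := if r is r'.+1 then comm_norm N r' X + comm_norm N r' (comm N X) else opnorm X.

Fixpoint weight_norm N r D : R :=
  if r is r'.+1 then weight_norm N r' D + weight_norm N r' (N * D) + weight_norm N r' (D * N) else opnorm D.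

Lemma commZ A c X : comm A (c *: X) = c *: comm A X.
Proof. by rewrite /comm scalerBr bop_scaleAr bop_scaleAl. Qed.

Lemma comm_norm_ge0 N r X : 0 <= comm_norm N r X.
Proof. by elim: r X => [|r IH] X /=; [exact: opnorm_ge0|rewrite addr_ge0]. Qed.

Lemma weight_norm_ge0 N r X : 0 <= weight_norm N r X.
Proof. by elim: r X => [|r IH] X /=; [exact: opnorm_ge0|rewrite !addr_ge0]. Qed.

Lemma comm_normD N r X Y : comm_norm N r (X + Y) <= comm_norm N r X + comm_norm N r Y.
Proof.
elim: r X Y => [|r IH] X Y /=; first exact: opnormD.
by rewrite commD [leRHS]addrACA; apply: lerD; exact: IH.
Qed.

Lemma weight_normD N r X Y : weight_norm N r (X + Y) <= weight_norm N r X + weight_norm N r Y.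
Proof.
elim: r X Y => [|r IH] X Y /=; first exact: opnormD.
rewrite mulrDr mulrDl.
apply: le_trans (lerD (lerD (IH _ _) (IH _ _)) (IH _ _)) _.
by rewrite le_eqVlt; apply/orP; left; apply/eqP; ring.
Qed.

Lemma comm_normZ N r c X : comm_norm N r (c *: X) = normc c * comm_norm N r X.
Proof.
by elim: r X => [|r IH] X /=; rewrite ?opnormZ// commZ !IH mulrDr.
Qed.

Lemma weight_normZ N r c X : weight_norm N r (c *: X) = normc c * weight_norm N r X.
Proof.
elim: r X => [|r IH] X /=; rewrite ?opnormZ// -bop_scaleAr -bop_scaleAl !IH.
by ring.
Qed.

Lemma comm_norm0 N r : comm_norm N r 0 = 0.
Proof. by rewrite -(scale0r (0 : bop R)) comm_normZ normc0 mul0r. Qed.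

Lemma weight_norm0 N r : weight_norm N r 0 = 0.
Proof. by rewrite -(scale0r (0 : bop R)) weight_normZ normc0 mul0r. Qed.

Lemma weight_normN N r X : weight_norm N r (- X) = weight_norm N r X.
Proof. by rewrite -scaleN1r weight_normZ normcN normc1 mul1r. Qed.

Lemma comm_norm_sum N r (I : Type) (s : seq I) (F : I -> bop R) :
  comm_norm N r (\sum_(i <- s) F i) <= \sum_(i <- s) comm_norm N r (F i).
Proof.
elim: s => [|i s IH]; rewrite ?big_nil ?comm_norm0// !big_cons.
by apply: le_trans (comm_normD _ _ _ _) _; rewrite lerD2l.
Qed.

Lemma weight_norm_sum N r (I : Type) (s : seq I) (F : I -> bop R) :
  weight_norm N r (\sum_(i <- s) F i) <= \sum_(i <- s) weight_norm N r (F i).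
Proof.
elim: s => [|i s IH]; rewrite ?big_nil ?weight_norm0// !big_cons.
by apply: le_trans (weight_normD _ _ _ _) _; rewrite lerD2l.
Qed.

Lemma comm_norm_comm N r X : comm_norm N r (comm N X) <= comm_norm N r.+1 X.
Proof. by rewrite /= lerDr comm_norm_ge0. Qed.

(** Leibniz rule; the product on the right contains one further nonnegative term, the product of the
    two commutator norms. *)
Lemma comm_normM N r X Y : comm_norm N r (X * Y) <= comm_norm N r X * comm_norm N r Y.
Proof.
elim: r X Y => [|r IH] X Y /=; first exact: opnormM.
rewrite commM; apply: le_trans (lerD (IH _ _) (comm_normD _ _ _ _)) _.
apply: le_trans (lerD (lexx _) (lerD (IH _ _) (IH _ _))) _.
have := mulr_ge0 (comm_norm_ge0 N r (comm N X)) (comm_norm_ge0 N r (comm N Y)).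
set a := comm_norm _ _ X; set b := comm_norm _ _ Y; set a' := comm_norm _ _ (comm N X); set b' := comm_norm _ _ (comm N Y).
move=> ab; rewrite -subr_ge0 (_ : _ - _ = a' * b')//; ring.
Qed.

(* Moving N past X costs one commutator, which the next seminorm absorbs. *)
Lemma weight_normM N r X D Y : weight_norm N r (X * D * Y) <= comm_norm N r X * weight_norm N r D * comm_norm N r Y.
Proof.
elim: r X D Y => [|r IH] X D Y /=.
  apply: le_trans (opnormM _ _) _; rewrite ler_wpM2r ?opnorm_ge0//.
  exact: opnormM.
have -> : N * (X * D * Y) = X * (N * D) * Y + comm N X * D * Y.
  by rewrite /comm !mulrBl !mulrA addrC subrK.
have -> : X * D * Y * N = X * (D * N) * Y - X * D * comm N Y.
  by rewrite /comm mulrBr opprB !mulrA addrC subrK.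
apply: le_trans (lerD (lerD (IH _ _ _) (weight_normD _ _ _ _)) (weight_normD _ _ _ _)) _; rewrite weight_normN.
apply: le_trans (lerD (lerD (lexx _) (lerD (IH _ _ _) (IH _ _ _))) (lerD (IH _ _ _) (IH _ _ _))) _.
set a := comm_norm _ _ X; set b := comm_norm _ _ Y; set a' := comm_norm _ _ (comm N X); set b' := comm_norm _ _ (comm N Y).
set d := weight_norm _ _ D; set d1 := weight_norm _ _ (N * D); set d2 := weight_norm _ _ (D * N).
rewrite -subr_ge0.
have -> : (a + a') * (d + d1 + d2) * (b + b') -
   (a * d * b + (a * d1 * b + a' * d * b) + (a * d2 * b + a * d * b')) =
   a' * (d1 + d2) * b + a * (d1 + d2) * b' + a' * (d + d1 + d2) * b' by ring.
have [a0 b0 a'0 b'0] : [/\ 0 <= a, 0 <= b, 0 <= a' & 0 <= b'] by split; exact: comm_norm_ge0.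
have [d0 d10 d20] : [/\ 0 <= d, 0 <= d1 & 0 <= d2] by split; exact: weight_norm_ge0.
by rewrite !addr_ge0// !mulr_ge0// !addr_ge0.
Qed.

(** The constant involves [opnorm N] and so may grow with the truncation: it serves to make
    [comm_norm] continuous, not as an estimate. *)
Lemma comm_norm_bound N r X : comm_norm N r X <= (1 + 2 * opnorm N) ^+ r * opnorm X.
Proof.
have N0 := opnorm_ge0 N.
elim: r X => [|r IH] X /=; first by rewrite expr0 mul1r.
apply: le_trans (lerD (IH _) (IH _)) _; rewrite -mulrDr exprSr -mulrA.
rewrite ler_wpM2l ?exprn_ge0 ?addr_ge0 ?mulr_ge0// mulrDl mul1r lerD2l.
apply: le_trans (opnormD _ _) _; rewrite opnormN.
apply: le_trans (lerD (opnormM _ _) (opnormM _ _)) _.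
by rewrite [opnorm X * _]mulrC -mulrA mulr2n mulrDl mul1r.
Qed.

Lemma weight_norm_bound N r X : weight_norm N r X <= (1 + 2 * opnorm N) ^+ r * opnorm X.
Proof.
have N0 := opnorm_ge0 N.
elim: r X => [|r IH] X /=; first by rewrite expr0 mul1r.
apply: le_trans (lerD (lerD (IH _) (IH _)) (IH _)) _; rewrite -!mulrDr exprSr -mulrA.
rewrite ler_wpM2l ?exprn_ge0 ?addr_ge0 ?mulr_ge0// mulrDl mul1r -addrA lerD2l.
apply: le_trans (lerD (opnormM _ _) (opnormM _ _)) _.
by rewrite [opnorm X * _]mulrC -mulrA mulr2n mulrDl mul1r.
Qed.

(** The bound [B] passes to the limit without loss however large the continuity constant [K] is,
    which keeps the estimates uniform in the truncation. *)
Lemma seminorm_lim (p : bop R -> R) (K : R) (u : nat -> bop R) A (B : R) :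
  (forall X Y, p (X + Y) <= p X + p Y) -> (forall X, p X <= K * opnorm X) ->
  opcvg u A -> (exists n0, forall n, (n0 <= n)%N -> p (u n) <= B) -> p A <= B.
Proof.
move=> pD pK uA [n0 uB]; apply/ler_addgt0Pr => e e0.
have K1 : 0 < `|K| + 1 by rewrite ltr_wpDl.
have [|n1 H1] := uA (e / (`|K| + 1)); first by rewrite divr_gt0.
rewrite -[A](subrK (u (maxn n0 n1))); apply: le_trans (pD _ _) _.
rewrite [leRHS]addrC; apply: lerD; last by apply: uB; exact: leq_maxl.
apply: le_trans (pK _) _; apply: (@le_trans _ _ ((`|K| + 1) * opnorm (A - u (maxn n0 n1)))).
  by rewrite ler_wpM2r ?opnorm_ge0// (le_trans (ler_norm _))// lerDl.
rewrite opnorm_distC -ler_pdivlMl// mulrC; apply: H1; exact: leq_maxr.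
Qed.

End Seminorms.

(** * Growth of commutators with Chebyshev polynomials *)

Section ChebyshevGrowth.
Variable R : realType.
Implicit Types (N X Y x y v : bop R) (r k : nat).

(* chebS (x + x) k is the Chebyshev polynomial U_(k-1) at x. *)
Fixpoint chebS y k : bop R :=
  match k with
  | 0%N => 0
  | 1%N => 1
  | (k'.+1 as k1).+1 => y * chebS y k1 - chebS y k'
  end.

Lemma chebSS y k : chebS y k.+2 = y * chebS y k.+1 - chebS y k.
Proof. by []. Qed.

Lemma comm1 x : comm x 1 = 0.
Proof. by rewrite /comm mulr1 mul1r subrr. Qed.

(** Variation of constants: the commutators satisfy the recursion of [chebS] with source term
    [comm x y * chebS y k.+1], and [chebS], starting from 0 and 1, is the fundamental solution. *)
Lemma comm_chebS x y k : comm x (chebS y k) =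
  \sum_(j < k) chebS y (k - j) * comm x y * chebS y j.
Proof.
suff: comm x (chebS y k) = \sum_(j < k) chebS y (k - j) * comm x y * chebS y j /\
    comm x (chebS y k.+1) = \sum_(j < k.+1) chebS y (k.+1 - j) * comm x y * chebS y j.
  by case.
elim: k => [|k [IH1 IH2]].
  split; first by rewrite big_ord0 /= /comm mulr0 mul0r subrr.
  by rewrite big_ord1/= comm1 mulr0.
split=> //; rewrite chebSS commD commN commM IH1 IH2.
pose t i j := chebS y i * comm x y * chebS y j.
have tS i j : t i.+2 j = y * t i.+1 j - t i j by rewrite /t chebSS !mulrBl !mulrA.
have S : y * (\sum_(j < k.+1) t (k.+1 - j)%N j) - \sum_(j < k) t (k - j)%N j =
    \sum_(j < k.+1) t (k.+2 - j)%N j.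
  rewrite mulr_sumr [in LHS]big_ord_recr [RHS]big_ord_recr [in LHS]addrAC; congr (_ + _).
    rewrite -sumrN -big_split; apply: eq_bigr => j _; have jk := ltn_ord j.
    rewrite [nat_of_ord _]/=.
    have -> : (k.+2 - j = (k - j).+2)%N by lia.
    have -> : (k.+1 - j = (k - j).+1)%N by lia.
    by rewrite tS.
  rewrite [nat_of_ord _]/= subSnn (_ : (k.+2 - k)%N = 2%N); last lia.
  by rewrite tS /t !mul0r subr0.
transitivity (comm x y * chebS y k.+1 + \sum_(j < k.+1) t (k.+2 - j)%N j).
  by rewrite -S addrA.
rewrite [RHS]big_ord_recr [nat_of_ord _]/= subSnn [chebS y 1]/= mul1r [LHS]addrC.
by [].
Qed.

Lemma poly_growth_sum (F : nat -> nat -> R) (D C : R) (e k : nat) : 0 <= D -> 0 <= C ->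
  (forall j, (j < k)%N -> F (k - j)%N j <= (D * (k%:R + 1) ^+ e) * C * (D * (k%:R + 1) ^+ e)) ->
  \sum_(j < k) F (k - j)%N j <= D ^+ 2 * C * (k%:R + 1) ^+ (2 * e).+1.
Proof.
move=> D0 C0 H; have k1 : 1 <= k%:R + 1 :> R by rewrite lerDr.
apply: (@le_trans _ _ (\sum_(j < k) D ^+ 2 * C * (k%:R + 1) ^+ (2 * e))).
  apply: ler_sum => j _; apply: le_trans (H j (ltn_ord j)) _.
  by rewrite mulnC exprM le_eqVlt; apply/orP; left; apply/eqP; ring.
rewrite sumr_const card_ord -[leLHS]mulr_natr (exprSr (k%:R + 1)) mulrA ler_wpM2l ?lerDl//.
by rewrite !mulr_ge0 ?exprn_ge0// addr_ge0.
Qed.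

(** The convolution formula has [k] summands, each with two polynomially bounded factors, so the
    exponent passes from [e] to [2 * e + 1]. [D] and [e] are chosen before [N] and [y], hence are
    the same at all truncation levels. *)
Lemma comm_norm_chebS_growth (C : nat -> R) r : (forall i, 0 <= C i) -> exists D e, 0 <= D /\
  forall N y, (forall i, comm_norm N i y <= C i) -> (forall k, opnorm (chebS y k) <= k%:R) ->
  forall k, comm_norm N r (chebS y k) <= D * (k%:R + 1) ^+ e.
Proof.
move=> C0; elim: r => [|r [D [e [D0 IH]]]].
  exists 1, 1%N; split=> // N y _ Sy k /=; rewrite mul1r expr1.
  by apply: le_trans (Sy k) _; rewrite lerDl.
exists (D + D ^+ 2 * C r.+1), (2 * e).+1; split=> [|N y Cy Sy k].
  by rewrite addr_ge0 ?mulr_ge0 ?exprn_ge0.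
have k1 : 1 <= k%:R + 1 :> R by rewrite lerDr.
have Q j : (j <= k)%N -> comm_norm N r (chebS y j) <= D * (k%:R + 1) ^+ e.
  move=> jk; apply: le_trans (IH N y Cy Sy j) _; rewrite ler_wpM2l//.
  by rewrite lerXn2r ?nnegrE ?addr_ge0// lerD2r ler_nat.
rewrite mulrDl /=; apply: lerD.
  apply: le_trans (Q k (leqnn k)) _; rewrite ler_wpM2l// ler_weXn2l//; lia.
rewrite comm_chebS; apply: le_trans (comm_norm_sum _ _ _ _) _.
apply: (@poly_growth_sum (fun i j => comm_norm N r (chebS y i * comm N y * chebS y j))) => // j jk.
apply: le_trans (comm_normM _ _ _ _) _.
apply: ler_pM; rewrite ?comm_norm_ge0//; last by apply: Q; lia.
apply: le_trans (comm_normM _ _ _ _) _.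
apply: ler_pM; rewrite ?comm_norm_ge0//; first by apply: Q; lia.
by apply: le_trans (comm_norm_comm _ _ _) _.
Qed.

(** In each summand only [comm v y] carries the weights; the polynomials on both sides are measured
    by [comm_norm], as [weight_normM] allows. *)
Lemma weight_norm_comm_chebS_growth (C Cw : nat -> R) r : (forall i, 0 <= C i) -> (forall i, 0 <= Cw i) ->
  exists D e, 0 <= D /\
  forall N y v, (forall i, comm_norm N i y <= C i) -> (forall i, weight_norm N i (comm v y) <= Cw i) ->
  (forall k, opnorm (chebS y k) <= k%:R) ->
  forall k, weight_norm N r (comm v (chebS y k)) <= D * (k%:R + 1) ^+ e.
Proof.
move=> C0 Cw0; have [D [e [D0 H]]] := comm_norm_chebS_growth r C0.
exists (D ^+ 2 * Cw r), (2 * e).+1; split=> [|N y v Cy Cv Sy k].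
  by rewrite ?mulr_ge0 ?exprn_ge0.
have k1 : 1 <= k%:R + 1 :> R by rewrite lerDr.
have Q j : (j <= k)%N -> comm_norm N r (chebS y j) <= D * (k%:R + 1) ^+ e.
  move=> jk; apply: le_trans (H N y Cy Sy j) _; rewrite ler_wpM2l//.
  by rewrite lerXn2r ?nnegrE ?addr_ge0// lerD2r ler_nat.
rewrite comm_chebS; apply: le_trans (weight_norm_sum _ _ _ _) _.
apply: (@poly_growth_sum (fun i j => weight_norm N r (chebS y i * comm v y * chebS y j))) => // j jk.
apply: le_trans (weight_normM _ _ _ _ _) _.
apply: ler_pM; rewrite ?mulr_ge0 ?comm_norm_ge0 ?weight_norm_ge0//; last by apply: Q; lia.
by apply: ler_pM; rewrite ?comm_norm_ge0 ?weight_norm_ge0//; apply: Q; lia.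
Qed.

Fixpoint chebTop x k : bop R :=
  match k with
  | 0%N => 1
  | 1%N => x
  | (k'.+1 as k1).+1 => (x + x) * chebTop x k1 - chebTop x k'
  end.

(** The relation [T_k = U_k - x U_(k-1)], through which bounds on [chebS] pass to [chebTop]. *)
Lemma chebTop_chebS x k : chebTop x k = chebS (x + x) k.+1 - x * chebS (x + x) k.
Proof.
suff: chebTop x k = chebS (x + x) k.+1 - x * chebS (x + x) k /\
    chebTop x k.+1 = chebS (x + x) k.+2 - x * chebS (x + x) k.+1 by case.
have cx j : (x + x) * (x * chebS (x + x) j) = x * ((x + x) * chebS (x + x) j).
  by rewrite !mulrA mulrDl mulrDr.
elim: k => [|k [IH1 IH2]]; first by split; rewrite /= ?mulr0 ?subr0 ?mulr1 ?addrK.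
split=> //; rewrite [LHS]/= -/(chebTop x k.+1) IH1 IH2.
have Ek : x * chebS (x + x) k.+2 = x * ((x + x) * chebS (x + x) k.+1) - x * chebS (x + x) k.
  by rewrite chebSS mulrBr.
rewrite [in RHS]Ek (chebSS _ k.+1) mulrBr cx !opprB -!addrA; congr (_ + _).
by rewrite addrCA [RHS]addrCA; congr (_ + _); rewrite [LHS]addrC.
Qed.

Lemma comm_norm_one N r : comm_norm N r 1 <= 1.
Proof.
elim: r => [|r IH] /=; first exact: opnorm1.
by rewrite comm1 comm_norm0 addr0.
Qed.

Lemma weight_norm_comm_chebTop_growth (C Cw : nat -> R) r : (forall i, 0 <= C i) -> (forall i, 0 <= Cw i) ->
  exists D e, 0 <= D /\
  forall N x v, (forall i, comm_norm N i x <= C i) -> (forall i, weight_norm N i (comm v x) <= Cw i) ->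
  (forall k, opnorm (chebS (x + x) k) <= k%:R) ->
  forall k, weight_norm N r (comm v (chebTop x k)) <= D * (1 + k%:R) ^+ e.
Proof.
move=> C0 Cw0.
have C20 i : 0 <= 2 * C i by rewrite mulr_ge0.
have Cw20 i : 0 <= 2 * Cw i by rewrite mulr_ge0.
have [D [e [D0 H]]] := weight_norm_comm_chebS_growth r C20 Cw20.
have [D' [e' [D'0 H']]] := comm_norm_chebS_growth r C20.
exists (2 ^+ e * D + C r * D + Cw r * D'), (e + e')%N; split.
  by rewrite !addr_ge0 ?mulr_ge0 ?exprn_ge0.
move=> N x v Cx Cv Sx k.
have Cy i : comm_norm N i (x + x) <= 2 * C i.
  by apply: le_trans (comm_normD _ _ _ _) _; rewrite [2 * _]mulr_natl mulr2n lerD.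
have Cvy i : weight_norm N i (comm v (x + x)) <= 2 * Cw i.
  by rewrite commD; apply: le_trans (weight_normD _ _ _ _) _; rewrite [2 * _]mulr_natl mulr2n lerD.
have k1 : 1 <= 1 + k%:R :> R by rewrite lerDl.
have w1 : weight_norm N r (comm v (chebS (x + x) k.+1)) <= 2 ^+ e * D * (1 + k%:R) ^+ (e + e').
  apply: le_trans (H N _ v Cy Cvy Sx k.+1) _; rewrite mulrAC [leRHS]mulrC ler_wpM2l//.
  apply: (@le_trans _ _ ((2 * (1 + k%:R)) ^+ e)).
    rewrite lerXn2r ?nnegrE ?addr_ge0 ?mulr_ge0 ?addr_ge0// -natr1; lra.
  by rewrite exprMn ler_wpM2l ?exprn_ge0// ler_weXn2l// leq_addr.
have w2 : weight_norm N r (x * comm v (chebS (x + x) k) * 1) <= C r * D * (1 + k%:R) ^+ (e + e').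
  apply: le_trans (weight_normM _ _ _ _ _) _; rewrite -[leRHS]mulr1.
  apply: ler_pM; rewrite ?mulr_ge0 ?comm_norm_ge0 ?weight_norm_ge0 ?comm_norm_one//.
  rewrite -mulrA; apply: ler_pM; rewrite ?comm_norm_ge0 ?weight_norm_ge0//.
  apply: le_trans (H N _ v Cy Cvy Sx k) _; rewrite ler_wpM2l// [k%:R + 1]addrC.
  by rewrite ler_weXn2l// leq_addr.
have w3 : weight_norm N r (1 * comm v x * chebS (x + x) k) <= Cw r * D' * (1 + k%:R) ^+ (e + e').
  apply: le_trans (weight_normM _ _ _ _ _) _; rewrite -[leRHS]mulrA.
  apply: ler_pM; rewrite ?mulr_ge0 ?comm_norm_ge0 ?weight_norm_ge0//.
    by rewrite -[leRHS]mul1r; apply: ler_pM; rewrite ?comm_norm_ge0 ?weight_norm_ge0 ?comm_norm_one.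
  apply: le_trans (H' N _ Cy Sx k) _; rewrite ler_wpM2l// [k%:R + 1]addrC.
  by rewrite ler_weXn2l// leq_addl.
have -> : comm v (chebTop x k) = comm v (chebS (x + x) k.+1) -
    (1 * comm v x * chebS (x + x) k + x * comm v (chebS (x + x) k) * 1).
  by rewrite chebTop_chebS commD commN commM mul1r mulr1.
apply: le_trans (weight_normD _ _ _ _) _; rewrite weight_normN.
apply: le_trans (lerD w1 (le_trans (weight_normD _ _ _ _) (lerD w3 w2))) _.
by rewrite le_eqVlt; apply/orP; left; apply/eqP; ring.
Qed.

End ChebyshevGrowth.

(** * Matrix entries of elements of HS(s) *)

Section Adic.
Variables (R : realType) (s : nat).
Hypothesis hs : (2 <= s)%N.
Notation sz := (s%:Z).

Definition cyl (x : Zs s) (K : nat) : set (Zs s) := [set y | forall j, (j < K)%N -> y j = x j].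

Lemma cyl_nbhs x K : nbhs x (cyl x K).
Proof.
have H j : nbhs x [set y : Zs s | y j = x j].
  have := @proj_continuous nat (fun _ => discrete_topology 'Z_s) j x [set x j]; apply.
  by rewrite nbhs_principalE.
elim: K => [|K IH]; first by apply: filterS filterT => y _ j.
apply: filterS (filterI IH (H K)) => y [yK ye] j.
by rewrite ltnS leq_eqVlt => /orP[/eqP ->//|]; exact: yK.
Qed.

(** The sets containing a cylinder around [x] form a filter that converges to [x] in each
    coordinate, hence in the product topology. *)
Lemma nbhs_cyl x (U : set (Zs s)) : nbhs x U -> exists K, cyl x K `<=` U.
Proof.
pose F : set_system (Zs s) := [set U | exists K, cyl x K `<=` U].
have FF : Filter F.
  split; first by exists 0%N.
    move=> A B [K KA] [L LB]; exists (maxn K L) => y yKL; split.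
      by apply: KA => j jK; apply: yKL; apply: leq_trans jK _; exact: leq_maxl.
    by apply: LB => j jK; apply: yKL; apply: leq_trans jK _; exact: leq_maxr.
  by move=> A B AB [K KA]; exists K; apply: subset_trans AB.
suff Fx : F --> x by exact: Fx.
apply/cvg_sup => i A /= [_ [[B Bop <-] Bfs sBfA]].
exists i.+1 => y yx; apply: sBfA; rewrite /preimage/= (yx i)//.
Qed.

Lemma Zs_compact : compact [set: Zs s].
Proof.
have := @tychonoff nat (fun _ => discrete_topology 'Z_s) (fun _ => setT).
have -> : [set f : forall i : nat, discrete_topology 'Z_s | forall i, setT (f i)] = setT.
  by apply/seteqP; split.
apply=> i; apply: finite_compact.
exact: (@finite_finset 'Z_s setT).
Qed.

Lemma continuous_dist (T : topologicalType) (f : T -> R[i]) x :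
  {for x, continuous (f : T -> R[i]^o)} <->
  forall e : R, 0 < e -> \forall y \near x, normc (f x - f y) <= e.
Proof.
split=> [/cvgrPdist_le H e e0|H].
  have := H e%:C; rewrite ltcR => /(_ e0); apply: filterS => y.
  by rewrite -[X in X <= _]/((normc (f x - f y))%:C) lecR.
apply/cvgrPdist_le => -[e e'] /=; rewrite ltcE/= => /andP[/eqP -> e0].
apply: filterS (H e e0) => y fy.
by rewrite -[X in X <= _]/((normc (f x - f y))%:C) -[X in _ <= X]/(e%:C) lecR.
Qed.

Lemma Zs_unif_cont (f : Zs s -> R[i]) : continuous (f : Zs s -> R[i]^o) ->
  forall e : R, 0 < e -> exists K, forall x y, cyl x K y -> normc (f x - f y) <= e.
Proof.
move=> cf e e0; have e2 : 0 < e / 2 by rewrite divr_gt0.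
have /compact_near_coveringP cZ := Zs_compact.
pose P K (x : Zs s) := forall y, cyl x K y -> normc (f x - f y) <= e.
have [x _|K _ HK] := cZ _ \oo P _.
  have := (continuous_dist f x).1 (cf x) _ e2 => /nbhs_cyl[K0 HK0].
  exists (cyl x K0, [set K | (K0 <= K)%N]).
    by split; [exact: cyl_nbhs|exists K0].
  move=> [x' K] [/= xx' K0K] y yx'.
  apply: le_trans (normc_triangle _ (f x) _) _; rewrite [e]splitr; apply: lerD.
    by rewrite normc_distC; apply: HK0.
  apply: HK0 => j jK; rewrite -xx'//; apply: yx'; exact: leq_trans jK K0K.
by exists K => x y xy; exact: (HK K (leqnn K) x I y xy).
Qed.

Lemma sZ_eq0 : (sz%:~R : 'Z_s) = 0.
Proof. by apply/val_inj; rewrite /= -pmulrn Zp_nat/= Zp_cast// modnn. Qed.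

Lemma Zs_of_int_cyl (l l' : int) K : (sz ^+ K %| l - l')%Z -> cyl (Zs_of_int s l) K (Zs_of_int s l').
Proof.
move=> /dvdzP[q e] j jK; rewrite /Zs_of_int.
have -> : l = q * sz ^+ K + l' by rewrite -e subrK.
have sj0 : sz ^+ j != 0 by exact: szX_neq0.
have -> : q * sz ^+ K = q * sz ^+ (K - j) * sz ^+ j by rewrite -mulrA -exprD subnK// ltnW.
rewrite divzMDl//; have -> : (K - j = (K - j.+1).+1)%N by lia.
by rewrite intrD intrM rmorphXn/= exprS sZ_eq0 mul0r mulr0 add0r.
Qed.

Lemma Zs_of_int_unit (l : int) : Zs_unit (Zs_of_int s l) <-> ~~ (sz %| l)%Z.
Proof.
rewrite /Zs_unit/= /Zs_of_int expr0 divz1.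
have E : ((l%:~R : 'Z_s) == 0) = (sz %| l)%Z.
  apply/eqP/idP => [l0|/dvdzP[q ->]]; last by rewrite intrM sZ_eq0 mulr0.
  have s0 : sz != 0 by rewrite eqz_nat -lt0n ltnW.
  move: l0; rewrite (divz_eq l sz) intrD intrM sZ_eq0 mulr0 add0r.
  have := modz_ge0 l s0; have := ltz_pmod l (_ : 0 < sz); rewrite ltz_nat => /(_ (ltnW hs)).
  case: (l %% sz)%Z => // r; rewrite ltz_nat => rs _.
  move=> /(congr1 val); rewrite /= -pmulrn Zp_nat/= Zp_cast// modn_small// => ->.
  by rewrite addr0 dvdz_mull.
by rewrite E.
Qed.

(** What operators see of a continuous function on [Zs s]: its values at the integers, uniformly
    continuous for the s-adic distance. *)
Definition adic_unif (W : int -> R[i]) := forall e : R, 0 < e ->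
  exists K, forall l l', (sz ^+ K %| l - l')%Z -> normc (W l - W l') <= e.

Lemma adic_unif_Zs (f : Zs s -> R[i]) : continuous (f : Zs s -> R[i]^o) ->
  adic_unif (fun l => f (Zs_of_int s l)).
Proof.
move=> cf e e0; have [K HK] := Zs_unif_cont cf e0.
by exists K => l l' /Zs_of_int_cyl; exact: HK.
Qed.

(** Modulo [s ^ K] there are finitely many residues, and within a residue class [W] varies by at
    most 1. *)
Lemma adic_unif_bdd W : adic_unif W -> bdd W.
Proof.
move=> uW; have [K HK] := uW 1 ltr01.
exists (1 + \sum_(i < s ^ K) normc (W i%:Z)) => l.
have m0 : sz ^+ K != 0 by exact: szX_neq0.
have r0 := modz_ge0 l m0.
have sK : 0 < sz ^+ K by rewrite exprn_gt0// sz_gt0.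
have rl := ltz_pmod l sK.
have [r rE] : exists r : nat, (l %% sz ^+ K)%Z = r by case: (l %% sz ^+ K)%Z r0 => // r _; exists r.
rewrite rE in rl; have rs : (r < s ^ K)%N.
  by rewrite -ltz_nat; have -> : (s ^ K)%N%:Z = sz ^+ K by rewrite -!natz natrX.
have := HK l r; rewrite -rE {1}(divz_eq l (sz ^+ K)) addrK dvdz_mull// => /(_ isT) Wl.
rewrite -[W l](subrK (W r)); apply: le_trans (le_normcD _ _) _; rewrite -rE.
apply: lerD => //; rewrite rE (bigD1 (Ordinal rs))//= lerDl.
by apply: sumr_ge0 => i _; exact: normc_ge0.
Qed.

End Adic.

Section UniformContinuity.
Variables (R : realType) (s : nat).
Hypothesis hs : (2 <= s)%N.
Notation sz := (s%:Z).
Implicit Types (W : int -> R[i]).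

Lemma adic_unif_cst (c : R[i]) : adic_unif s (fun=> c).
Proof. by move=> e e0; exists 0%N => l l' _; rewrite subrr normc0 ltW. Qed.

Lemma adic_unifM W W' : adic_unif s W -> adic_unif s W' -> adic_unif s (fun l => W l * W' l).
Proof.
move=> uW uW' e e0.
have [B WB] := adic_unif_bdd hs uW; have [B' WB'] := adic_unif_bdd hs uW'.
have B0 : 0 <= B := le_trans (normc_ge0 _) (WB 0).
have B'0 : 0 <= B' := le_trans (normc_ge0 _) (WB' 0).
have c0 : 0 < B + B' + 1 by rewrite ltr_wpDl// addr_ge0.
have e1 : 0 < e / (B + B' + 1) by rewrite divr_gt0.
have [K HK] := uW _ e1; have [K' HK'] := uW' _ e1.
exists (maxn K K') => l l' d.
have d1 : (sz ^+ K %| l - l')%Z by apply: dvdz_trans d; rewrite dvdz_exp2l// leq_maxl.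
have d2 : (sz ^+ K' %| l - l')%Z by apply: dvdz_trans d; rewrite dvdz_exp2l// leq_maxr.
have -> : W l * W' l - W l' * W' l' = W l * (W' l - W' l') + (W l - W l') * W' l' by ring.
apply: le_trans (le_normcD _ _) _; rewrite !normcM.
apply: (@le_trans _ _ (B * (e / (B + B' + 1)) + e / (B + B' + 1) * B')).
  by apply: lerD; apply: ler_pM; rewrite ?normc_ge0// ?WB ?WB' ?HK ?HK'.
rewrite mulrC -mulrDr mulrAC ler_pdivrMr// ler_pM2l//; lra.
Qed.

Lemma adic_unif_conj W : adic_unif s W -> adic_unif s (fun l => conjc (W l)).
Proof.
by move=> uW e e0; have [K HK] := uW e e0; exists K => l l' /HK; rewrite -conjcB normc_conj.
Qed.

Lemma adic_unif_shift W n : adic_unif s W -> adic_unif s (fun l => W (sz ^+ n * l)).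
Proof.
move=> uW e e0; have [K HK] := uW e e0; exists K => l l' d; apply: HK.
by rewrite -mulrBr dvdz_mull.
Qed.

End UniformContinuity.

(** * Finite sums of normally ordered products *)

Section Span.
Variables (R : realType) (s : nat).
Hypothesis hs : (2 <= s)%N.
Notation sz := (s%:Z).
Notation E := (basis_vec R).
Notation V := (V R s).
Notation Vs := (Vs R s).
Implicit Types (A B : bop R) (W : int -> R[i]).

Definition gen p W q : bop R := V ^+ p * dg W * Vs ^+ q.

(** Inductive, so that properties of matrix entries are proved by adding one generator at a time;
    their stability under norm limits then reaches all of [HS s]. *)
Inductive span : bop R -> Prop :=
| span0 : span 0
| spanD A p W q : span A -> adic_unif s W -> span (A + gen p W q).

Lemma span_gen p W q : adic_unif s W -> span (gen p W q).
Proof. by move=> uW; rewrite -[gen p W q]add0r; apply: spanD => //; exact: span0. Qed.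

Lemma span_add A B : span A -> span B -> span (A + B).
Proof.
by move=> sA; elim=> [|B' p W q sB IH uW]; rewrite ?addr0// addrA; exact: spanD.
Qed.

Lemma dgZ (c : R[i]) W : bdd W -> c *: dg W = dg (fun l => c * W l).
Proof.
move=> bW; apply: bop_eq => x; apply: l2_ext => k; rewrite bop_scaleE l2Z !dgE ?mulrA//.
by case: bW => B WB; exists (normc c * B) => l; rewrite normcM ler_wpM2l ?normc_ge0.
Qed.

Lemma span_scale (c : R[i]) A : span A -> span (c *: A).
Proof.
move=> sA; elim: sA => [|B' p W q sB IH uW]; first by rewrite scaler0; exact: span0.
rewrite scalerDr /gen bop_scaleAl bop_scaleAr dgZ; last exact: adic_unif_bdd uW.
by apply: spanD => //; apply: adic_unifM => //; exact: adic_unif_cst.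
Qed.

(** [Vs ^+ q * V ^+ p'] cancels down to the excess of one exponent over the other, and that power
    moves past the adjacent diagonal, dilating its symbol. *)
Lemma gen_mul p W q p' W' q' : adic_unif s W -> adic_unif s W' -> span (gen p W q * gen p' W' q').
Proof.
move=> uW uW'; rewrite /gen.
have bW := adic_unif_bdd hs uW; have bW' := adic_unif_bdd hs uW'.
have [qp|/ltnW pq] := leqP q p'.
  have -> : V ^+ p * dg W * Vs ^+ q * (V ^+ p' * dg W' * Vs ^+ q') =
      gen (p + (p' - q)) (fun l => W (sz ^+ (p' - q) * l) * W' l) q'.
    rewrite -{1}(subnKC qp) exprD !mulrA -(mulrA _ (Vs ^+ q)) VsXVX// mulr1.
    rewrite -(mulrA _ (dg W)) dg_VX// !mulrA -exprD -(mulrA _ _ (dg W')) dgM//.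
    exact: bdd_comp.
  by apply: span_gen; apply: adic_unifM => //; exact: adic_unif_shift.
have -> : V ^+ p * dg W * Vs ^+ q * (V ^+ p' * dg W' * Vs ^+ q') =
    gen p (fun l => W l * W' (sz ^+ (q - p') * l)) ((q - p') + q').
  rewrite -{1}(subnK pq) exprD !mulrA -(mulrA _ (Vs ^+ p')) VsXVX// mulr1.
  rewrite -(mulrA _ (Vs ^+ (q - p'))) VsX_dg// !mulrA -(mulrA _ (dg W)) dgM//; last exact: bdd_comp.
  by rewrite /gen exprD mulrA.
by apply: span_gen; apply: adic_unifM => //; exact: adic_unif_shift.
Qed.

Lemma span_mul A B : span A -> span B -> span (A * B).
Proof.
move=> sA; elim=> [|B' p W q sB IH uW]; first by rewrite mulr0; exact: span0.
rewrite mulrDr; apply: span_add => //; elim: sA {IH} => [|A' p' W' q' sA IH uW'].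
  by rewrite mul0r; exact: span0.
by rewrite mulrDl; apply: span_add => //; exact: gen_mul.
Qed.

Lemma adj_sum A B A' B' : adjoint A B -> adjoint A' B' -> adjoint (A + A') (B + B').
Proof. by move=> AB AB'; have := adjD 1 AB AB'; rewrite conjc1 !scale1r. Qed.

Lemma adj_sub A B A' B' : adjoint A B -> adjoint A' B' -> adjoint (A - A') (B - B').
Proof.
move=> AB AB'; apply: adjoint_entries => k l.
by rewrite !bop_subE !l2B (adjointE AB) (adjointE AB') conjcB.
Qed.

Lemma span_adj A : span A -> exists2 B, span B & adjoint A B.
Proof.
elim=> [|A' p W q sA [B sB AB] uW].
  by exists 0; [exact: span0|move=> x y; rewrite !bop_zeroE !dotp0l dotp_conj dotp0l conjc0].
exists (B + gen q (fun l => conjc (W l)) p); first by apply: spanD => //; exact: adic_unif_conj.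
apply: adj_sum => //; rewrite /gen -mulrA.
have aV n : adjoint (V ^+ n) (Vs ^+ n) by apply: adjX; exact: V_adj.
have := adjM (aV p) (adjM (dg_adj (adic_unif_bdd hs uW)) (adjC (aV q))).
by [].
Qed.

Definition approx (P : bop R -> Prop) : set (bop R) :=
  [set A | forall e : R, 0 < e -> exists2 B, P B & opnorm (A - B) <= e].

Lemma approx_in (P : bop R -> Prop) A : P A -> approx P A.
Proof. by move=> PA e e0; exists A => //; rewrite subrr opnorm0 ltW. Qed.

Lemma cstar_span : cstar_subalgebra (approx span).
Proof.
split.
- exact: closed_approx.
- move=> c A B HA HB e e0.
  have c1 : 0 < normc c + 1 by rewrite ltr_wpDl ?normc_ge0.
  have [|A' sA' AA'] := HA (e / (normc c + 1) / 2); first by rewrite !divr_gt0.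
  have [|B' sB' BB'] := HB (e / 2); first by rewrite divr_gt0.
  exists (c *: A' + B'); first by apply: span_add => //; exact: span_scale.
  have -> : c *: A + B - (c *: A' + B') = c *: (A - A') + (B - B').
    by rewrite scalerBr opprD addrACA.
  apply: le_trans (opnormD _ _) _; rewrite [e]splitr; apply: lerD => //.
  rewrite opnormZ; apply: (@le_trans _ _ ((normc c + 1) * opnorm (A - A'))).
    by rewrite ler_wpM2r ?opnorm_ge0// lerDl.
  rewrite -ler_pdivlMl// mulrC; apply: le_trans AA' _.
  by rewrite mulrAC.
- move=> A B HA HB e e0.
  pose a := opnorm A; pose b := opnorm B + 1.
  have a0 : 0 <= a := opnorm_ge0 A.
  have b0 : 0 < b by rewrite ltr_wpDl ?opnorm_ge0.
  have [|A' sA' AA'] := HA (e / 2 / b); first by rewrite !divr_gt0.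
  have d0 : 0 < Num.min 1 (e / 2 / (a + 1)).
    by rewrite lt_min ltr01 !divr_gt0// ltr_wpDl.
  have [B' sB' BB'] := HB _ d0.
  exists (A' * B'); first exact: span_mul.
  have -> : A * B - A' * B' = A * (B - B') + (A - A') * B'.
    by rewrite mulrBr mulrBl addrA subrK.
  have nB' : opnorm B' <= b.
    rewrite -[B'](subrK B); apply: le_trans (opnormD _ _) _; rewrite /b [leRHS]addrC.
    by apply: lerD => //; rewrite opnorm_distC (le_trans BB')// ge_min lexx.
  apply: le_trans (opnormD _ _) _; rewrite [e]splitr; apply: lerD.
    apply: le_trans (opnormM _ _) _; apply: (@le_trans _ _ ((a + 1) * opnorm (B - B'))).
      by rewrite ler_wpM2r ?opnorm_ge0// lerDl.
    rewrite -ler_pdivlMl ?ltr_wpDl// mulrC (le_trans BB')// ge_min.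
    by apply/orP; right.
  apply: le_trans (opnormM _ _) _; rewrite -(@divfK _ b _ (e / 2)) ?gt_eqF//.
  by apply: ler_pM; rewrite ?opnorm_ge0.
- move=> A B AB HA e e0; have [A' sA' AA'] := HA e e0.
  have [B' sB' AB'] := span_adj sA'; exists B' => //; apply: le_trans AA'.
  by apply: adjoint_opnorm; exact: adj_sub.
Qed.

Lemma multE (f : Zs s -> R[i]) : continuous (f : Zs s -> R[i]^o) ->
  mult f = dg (fun l => f (Zs_of_int s l)).
Proof.
move=> cf; have bW := adic_unif_bdd hs (adic_unif_Zs hs cf).
have H : [set A : bop R | forall l, A (E l) = f (Zs_of_int s l) *: E l] (mult f).
  by apply: xgetPex; exists (dg (fun l => f (Zs_of_int s l))) => l; rewrite dg_basis.
by apply: bop_ext => l; rewrite H dg_basis.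
Qed.

Lemma HS_approx : HS s `<=` approx span.
Proof.
apply: smallest_sub; first exact: cstar_span.
move=> A [->|[f cf <-]].
  apply: approx_in; have := span_gen 1 0 (adic_unif_cst s (1 : R[i])).
  rewrite /gen expr1 expr0 mulr1 shiftVE'//.
  have -> : dg (fun=> 1 : R[i]) = 1.
    apply: bop_ext => l; rewrite dg_basis ?scale1r//.
    by exists 1 => k; rewrite normc1.
  by rewrite mulr1.
apply: approx_in; rewrite multE//; have := span_gen 0 0 (adic_unif_Zs hs cf).
by rewrite /gen !expr0 mulr1 mul1r.
Qed.

Lemma HS_cstar : cstar_subalgebra (HS s : set (bop R)).
Proof.
split.
- by apply: closed_bigI => M [[]].
- by move=> c A B HA HB M MM; have [[? H ? ?] _] := MM; apply: H; [exact: HA|exact: HB].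
- by move=> A B HA HB M MM; have [[? ? H ?] _] := MM; apply: H; [exact: HA|exact: HB].
- by move=> A B AB HA M MM; have [[? ? ? H] _] := MM; apply: H AB _; exact: HA.
Qed.

(** A [cstar_subalgebra] is not assumed unital; the unit arises as [Vs * V]. *)
Lemma HS1 : HS s (1 : bop R).
Proof.
have VH : HS s V by rewrite -shiftVE'// => M [_]; apply; left.
have VsH : HS s Vs by apply: (cstar_adjoint HS_cstar) VH; exact: V_adj.
by rewrite -(VsV R hs); exact: (cstar_mul HS_cstar).
Qed.

End Span.

(** * Properties of matrix entries stable under norm limits *)

Section Entries.
Variables (R : realType) (s : nat).
Hypothesis hs : (2 <= s)%N.
Notation sz := (s%:Z).
Notation E := (basis_vec R).
Notation V := (V R s).
Notation Vs := (Vs R s).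
Implicit Types (A B : bop R) (W : int -> R[i]) (k l : int) (i j n p q r K : nat).

Definition ent A k l : R[i] := A (E l) k.

Lemma entD A B k l : ent (A + B) k l = ent A k l + ent B k l.
Proof. by []. Qed.

Lemma entB A B k l : ent (A - B) k l = ent A k l - ent B k l.
Proof. by rewrite /ent bop_subE l2B. Qed.

Lemma ent_le A k l : normc (ent A k l) <= opnorm A.
Proof.
apply: le_trans (coord_le _ _) _; apply: le_trans (opnorm_ub _ _) _.
by rewrite l2norm_basis mulr1.
Qed.

Lemma ent0 k l : ent 0 k l = 0. Proof. by []. Qed.

Lemma ent_cvg u A k l : opcvg u A -> ccvg (fun n => ent (u n) k l) (ent A k l).
Proof. exact: opcvg_coord. Qed.

Lemma ent_gen p W q k l : bdd W ->
  ent (gen s p W q) k l =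
    (if (sz ^+ q %| l)%Z && (k == sz ^+ p * (l %/ sz ^+ q)%Z) then W (l %/ sz ^+ q)%Z else 0).
Proof.
move=> bW; rewrite /ent /gen bop_mulE.
case: ifP => [/andP[dl /eqP ->]|].
  rewrite -{1}(divzK dl) mulrC VsX_basis// bop_mulE dg_basis// bopZ VX_basis//.
  by rewrite l2Z basis_vecE eqxx mulr1.
case: (boolP (sz ^+ q %| l)%Z) => [dl /= kl|dl _]; last by rewrite VsX_basis0// bop0 l2_0.
rewrite -{1}(divzK dl) mulrC VsX_basis// dg_basis// bopZ VX_basis//.
by rewrite l2Z basis_vecE kl mulr0.
Qed.

Lemma ent_gen_cop p W q i j l : bdd W -> ~~ (sz %| l)%Z ->
  ent (gen s p W q) (sz ^+ i * l) (sz ^+ j * l) =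
    (if (q <= j)%N && (i + q == p + j)%N then W (sz ^+ (j - q) * l) else 0).
Proof.
move=> bW dl; rewrite ent_gen// szX_dvd_cop//; case: leqP => //= qj.
have -> : (sz ^+ j * l %/ sz ^+ q)%Z = sz ^+ (j - q) * l.
  by rewrite -{1}(subnK qj) exprD -mulrA mulrCA szXK.
have -> : (sz ^+ i * l == sz ^+ p * (sz ^+ (j - q) * l)) = (i + q == p + j)%N; last by [].
rewrite mulrA -exprD; apply/eqP/eqP => [e|e]; last first.
  by congr (_ * _); congr (_ ^+ _); lia.
have := congr1 (nu s) e; rewrite !nu_cop//; lia.
Qed.

Definition orb k l := exists i j, sz ^+ i * k = sz ^+ j * l.

(** [V], its adjoint and the diagonals only connect indices in the same orbit of multiplication by
    [s]. *)
Definition supp_orb A := forall k l, ~ orb k l -> ent A k l = 0.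

(** Continuity of each entry in [l], which later extends the diagonals from integers to Z_s^x. *)
Definition unif_entries A := forall i j (e : R), 0 < e -> exists K, forall l l',
  ~~ (sz %| l)%Z -> ~~ (sz %| l')%Z -> (sz ^+ K %| l - l')%Z ->
  normc (ent A (sz ^+ i * l) (sz ^+ j * l) - ent A (sz ^+ i * l') (sz ^+ j * l')) <= e.

(** Far along a diagonal the indices tend to 0 in Z_s, where a continuous symbol takes a single
    value; this makes the Toeplitz coefficients scalars. *)
Definition const_symbol A := forall i j (e : R), 0 < e -> exists r0, forall r l l', (r0 <= r)%N ->
  ~~ (sz %| l)%Z -> ~~ (sz %| l')%Z ->
  normc (ent A (sz ^+ (i + r) * l) (sz ^+ (j + r) * l) -
         ent A (sz ^+ (i + r) * l') (sz ^+ (j + r) * l')) <= e.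

Lemma supp_orb_approx A : approx supp_orb A -> supp_orb A.
Proof.
move=> HA k l kl; apply/eq0_normc/eqP; rewrite eq_le normc_ge0 andbT.
apply/ler_addgt0Pl => e e0; rewrite addr0; have [B HB AB] := HA e e0.
by rewrite -[ent A k l]subr0 -(HB k l kl) -entB; apply: le_trans (ent_le _ _ _) _.
Qed.

Lemma ent_dist A B k l k' l' : normc (ent A k l - ent A k' l') <=
  opnorm (A - B) + normc (ent B k l - ent B k' l') + opnorm (A - B).
Proof.
apply: le_trans (normc_triangle _ (ent B k l) _) _; rewrite -addrA; apply: lerD.
  by rewrite -entB ent_le.
apply: le_trans (normc_triangle _ (ent B k' l') _) _; rewrite lerD2l.
by rewrite normc_distC -entB ent_le.
Qed.

Lemma unif_entries_approx A : approx unif_entries A -> unif_entries A.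
Proof.
move=> HA i j e e0; have e3 : 0 < e / 3 by rewrite divr_gt0.
have [B HB AB] := HA _ e3; have [K HK] := HB i j _ e3; exists K => l l' dl dl' dll.
apply: le_trans (ent_dist A B _ _ _ _) _; have := HK l l' dl dl' dll; lra.
Qed.

Lemma const_symbol_approx A : approx const_symbol A -> const_symbol A.
Proof.
move=> HA i j e e0; have e3 : 0 < e / 3 by rewrite divr_gt0.
have [B HB AB] := HA _ e3; have [r0 Hr] := HB i j _ e3; exists r0 => r l l' r0r dl dl'.
apply: le_trans (ent_dist A B _ _ _ _) _; have := Hr r l l' r0r dl dl'; lra.
Qed.

Lemma span_supp_orb A : span s A -> supp_orb A.
Proof.
elim=> [//|A' p W q sA IH uW] k l kl; rewrite entD IH// add0r ent_gen; last exact: adic_unif_bdd uW.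
case: ifP => // /andP[dl /eqP e]; case: kl; exists q, p.
by rewrite e mulrCA [sz ^+ q * _]mulrC divzK.
Qed.

Lemma span_unif_entries A : span s A -> unif_entries A.
Proof.
elim=> [|A' p W q sA IH uW] i j e e0.
  by exists 0%N => l l' _ _ _; rewrite !ent0 subrr normc0 ltW.
have e2 : 0 < e / 2 by rewrite divr_gt0.
have [K HK] := IH i j _ e2; have [K' HK'] := adic_unif_shift (j - q) uW e2.
exists (maxn K K') => l l' dl dl' dll; rewrite !entD opprD addrACA.
apply: le_trans (le_normcD _ _) _; rewrite [e]splitr; apply: lerD.
  by apply: HK => //; apply: dvdz_trans dll; rewrite dvdz_exp2l// leq_maxl.
rewrite !ent_gen_cop//; try exact: adic_unif_bdd uW.
case: ifP => _; last by rewrite subrr normc0 ltW.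
by apply: HK'; apply: dvdz_trans dll; rewrite dvdz_exp2l// leq_maxr.
Qed.

Lemma span_const_symbol A : span s A -> const_symbol A.
Proof.
elim=> [|A' p W q sA IH uW] i j e e0.
  by exists 0%N => r l l' _ _ _; rewrite !ent0 subrr normc0 ltW.
have e2 : 0 < e / 2 by rewrite divr_gt0.
have [r0 Hr] := IH i j _ e2; have [K HK] := uW _ e2.
(* In [gen p W q] the symbol is sampled at [s ^ (j + r - q) * l], hence the extra [q]. *)
exists (maxn r0 (K + q)) => r l l'; rewrite geq_max => /andP[r0r Kr] dl dl'.
rewrite !entD opprD addrACA.
apply: le_trans (le_normcD _ _) _; rewrite [e]splitr; apply: lerD; first exact: Hr.
rewrite !ent_gen_cop//; try exact: adic_unif_bdd uW.
case: ifP => _; last by rewrite subrr normc0 ltW.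
apply: HK; rewrite -mulrBr dvdz_mulr// dvdz_exp2l//; lia.
Qed.

Lemma approxW (P Q : bop R -> Prop) A : (forall B, P B -> Q B) -> approx P A -> approx Q A.
Proof. by move=> PQ HA e e0; have [B PB AB] := HA e e0; exists B => //; exact: PQ. Qed.

Lemma HS_entries A : HS s A -> [/\ supp_orb A, unif_entries A & const_symbol A].
Proof.
move=> /(HS_approx hs) HA; split.
- by apply: supp_orb_approx; apply: approxW HA; exact: span_supp_orb.
- by apply: unif_entries_approx; apply: approxW HA; exact: span_unif_entries.
- by apply: const_symbol_approx; apply: approxW HA; exact: span_const_symbol.
Qed.

Definition xi K : l2 R := \sum_(r < K) E (sz ^+ r).

Lemma szX_inj i j : (sz ^+ i == sz ^+ j) = (i == j).
Proof.
apply/eqP/eqP => [e|->//]; have d1 : ~~ (sz %| 1)%Z.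
  by rewrite dvdz1 absz_nat; case: s hs => [|[|]].
by have := congr1 (nu s) e; rewrite -[sz ^+ i]mulr1 -[sz ^+ j]mulr1 !nu_cop.
Qed.

Lemma l2norm_xi K : l2norm (xi K) = Num.sqrt K%:R.
Proof.
rewrite -[LHS]ger0_norm ?l2norm_ge0// -sqrtr_sqr; congr Num.sqrt.
apply: (@complexI R); rewrite -dotpxx.
have D x : dotp (xi K) x = \sum_(r < K) conjc (x (sz ^+ r)).
  rewrite /xi; elim: K => [|K IH]; first by rewrite !big_ord0 dotp0l.
  by rewrite !big_ord_recr/= -IH addrC -[E _]scale1r dotpDl mul1r dotp_basisl addrC.
rewrite D (eq_bigr (fun=> 1)); last first.
  move=> r _; suff -> : xi K (sz ^+ r) = 1 by rewrite conjc1.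
  rewrite /xi l2_sum (bigD1 r)// basis_vecE eqxx big1; first exact: (addr0 (1 : R[i])).
  by move=> i ir; rewrite basis_vecE szX_inj eq_sym -[(_ == _ :> nat)]/(i == r) (negbTE ir).
by rewrite sumr_const card_ord rmorph_nat.
Qed.

Lemma xi_large (M e : R) : 0 < e -> exists K0, forall K, (K0 <= K)%N -> M <= e * l2norm (xi K).
Proof.
move=> e0; exists (Num.truncn ((M / e) ^+ 2)).+1 => K HK.
rewrite l2norm_xi -ler_pdivrMl// mulrC; apply: le_trans (ler_norm _) _.
rewrite -sqrtr_sqr ler_wsqrtr//; apply: ltW; apply: lt_le_trans (truncnS_gt _) _.
by rewrite ler_nat.
Qed.

(* The point mass at 0 is a weak limit of the normalized xi K, so the value of
   an operator at the fixed vector E_0 is determined by its action on them. *)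
Definition at_zero A := (forall k, k != 0 -> ent A k 0 = 0) /\
  forall e : R, 0 < e -> exists K0, forall K, (K0 <= K)%N ->
    l2norm (A (xi K) - ent A 0 0 *: xi K) <= e * l2norm (xi K).

Lemma at_zero_basis A : at_zero A -> A (E 0) = ent A 0 0 *: E 0.
Proof.
move=> [A0 _]; apply: l2_ext => k; rewrite l2Z basis_vecE -[LHS]/(ent A k 0).
by case: eqP => [->|/eqP/A0 ->]; rewrite ?mulr1 ?mulr0.
Qed.

Lemma at_zeroD A B : at_zero A -> at_zero B -> at_zero (A + B).
Proof.
move=> [A0 HA] [B0 HB]; split=> [k k0|e e0]; first by rewrite entD A0// B0// addr0.
have e2 : 0 < e / 2 by rewrite divr_gt0.
have [K1 H1] := HA _ e2; have [K2 H2] := HB _ e2.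
exists (maxn K1 K2) => K; rewrite geq_max => /andP[k1 k2].
rewrite bop_addE entD scalerDl opprD addrACA; apply: le_trans (l2normD _ _) _.
by rewrite [e]splitr mulrDl; apply: lerD; [exact: H1|exact: H2].
Qed.

Lemma at_zeroM A B : at_zero A -> at_zero B -> at_zero (A * B).
Proof.
move=> zA zB; have eA := at_zero_basis zA; have eB := at_zero_basis zB.
have eAB k : ent (A * B) k 0 = ent B 0 0 * ent A 0 0 * E 0 k.
  by rewrite {1}/ent bop_mulE eB bopZ eA !l2Z mulrA.
have [_ HA] := zA; have [_ HB] := zB; split=> [k k0|e e0].
  by rewrite eAB basis_vecE (negbTE k0) mulr0.
have eAB0 : ent (A * B) 0 0 = ent B 0 0 * ent A 0 0 by rewrite eAB basis_vecE eqxx mulr1.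
have c1 : 0 < opnorm A + 1 by rewrite ltr_wpDl ?opnorm_ge0.
have c2 : 0 < normc (ent B 0 0) + 1 by rewrite ltr_wpDl ?normc_ge0.
have [|K1 H1] := HB (e / 2 / (opnorm A + 1)); first by rewrite !divr_gt0.
have [|K2 H2] := HA (e / 2 / (normc (ent B 0 0) + 1)); first by rewrite !divr_gt0.
exists (maxn K1 K2) => K; rewrite geq_max => /andP[/H1 k1 /H2 k2].
rewrite eAB0; set b := ent B 0 0 in k1 k2 c2 *; set a := ent A 0 0 in k2 *.
have -> : (A * B) (xi K) - (b * a) *: xi K =
    A (B (xi K) - b *: xi K) + b *: (A (xi K) - a *: xi K).
  by rewrite bop_mulE bopB bopZ scalerBr scalerA addrA subrK.
apply: le_trans (l2normD _ _) _; rewrite [e]splitr mulrDl; apply: lerD.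
  apply: le_trans (opnorm_ub _ _) _.
  apply: (@le_trans _ _ ((opnorm A + 1) * l2norm (B (xi K) - b *: xi K))).
    by rewrite ler_wpM2r ?l2norm_ge0// lerDl.
  by rewrite -ler_pdivlMl//; apply: le_trans k1 _; rewrite mulrA [_^-1 * _]mulrC.
rewrite l2normZ; apply: (@le_trans _ _ ((normc b + 1) * l2norm (A (xi K) - a *: xi K))).
  by rewrite ler_wpM2r ?l2norm_ge0// lerDl.
by rewrite -ler_pdivlMl//; apply: le_trans k2 _; rewrite mulrA [_^-1 * _]mulrC.
Qed.

Lemma at_zero_approx A : approx at_zero A -> at_zero A.
Proof.
move=> HA; split=> [k k0|e e0].
  apply/eq0_normc/eqP; rewrite eq_le normc_ge0 andbT.
  apply/ler_addgt0Pl => e e0; rewrite addr0; have [B [HB _] AB] := HA e e0.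
  by rewrite -[ent A k 0]subr0 -(HB k k0) -entB; apply: le_trans (ent_le _ _ _) _.
have e3 : 0 < e / 3 by rewrite divr_gt0.
have [B [_ HB] AB] := HA _ e3; have [K0 HK] := HB _ e3; exists K0 => K /HK BK.
have -> : A (xi K) - ent A 0 0 *: xi K =
    ((A - B) (xi K) + (B (xi K) - ent B 0 0 *: xi K)) + (ent B 0 0 - ent A 0 0) *: xi K.
  by rewrite bop_subE scalerBl !subrKA.
apply: le_trans (l2normD _ _) _; rewrite l2normZ.
have -> : e = e / 3 + e / 3 + e / 3 by field.
rewrite !mulrDl; apply: lerD; last first.
  by rewrite ler_wpM2r ?l2norm_ge0// normc_distC -entB (le_trans (ent_le _ _ _)).
apply: le_trans (l2normD _ _) _; apply: lerD => //.
by apply: le_trans (opnorm_ub _ _) _; rewrite ler_wpM2r ?l2norm_ge0.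
Qed.

(** The sum telescopes along the orbit of 1. A defect of norm at most 2, against vectors of norm
    [sqrt K], makes [xi K] almost invariant. *)
Lemma V_xi K : V (xi K) - xi K = E (sz ^+ K) - E 1.
Proof.
have VE l : V (E l) = E (sz * l) by have := VX_basis R hs 1 l; rewrite !expr1.
rewrite /xi bop_sum; under eq_bigr do rewrite VE -exprS.
have -> : \sum_(r < K) E (sz ^+ r.+1) = \sum_(r < K) E (sz ^+ r) + E (sz ^+ K) - E 1.
  have -> : \sum_(r < K) E (sz ^+ r) + E (sz ^+ K) = \sum_(r < K.+1) E (sz ^+ r).
    by rewrite [RHS]big_ord_recr.
  by rewrite big_ord_recl expr0 [RHS]addrAC subrr add0r; apply: eq_bigr.
by rewrite [LHS]addrC addrA addrA addNr add0r.
Qed.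

Lemma at_zeroV : at_zero V /\ at_zero Vs.
Proof.
have VE l : V (E l) = E (sz * l) by have := VX_basis R hs 1 l; rewrite !expr1.
have V0 k : ent V k 0 = (k == 0)%:R by rewrite /ent VE mulr0 basis_vecE.
have VsE k : ent Vs k 0 = (k == 0)%:R.
  rewrite /ent; have := VsX_basis R hs 1 0; rewrite !expr1 mulr0 => ->.
  by rewrite basis_vecE.
have n2 K : l2norm (E (sz ^+ K) - E 1) <= 2.
  by apply: le_trans (l2normD _ _) _; rewrite l2normN !l2norm_basis.
split; split=> [k /negbTE k0|e e0]; try by rewrite ?V0 ?VsE k0.
  have [K0 HK] := xi_large 2 e0; exists K0 => K /HK; apply: le_trans.
  by rewrite V0 eqxx scale1r V_xi.
have [K0 HK] := xi_large 2 e0; exists K0 => K /HK; apply: le_trans.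
rewrite VsE eqxx scale1r.
have -> : Vs (xi K) - xi K = - Vs (V (xi K) - xi K).
  by rewrite bopB -bop_mulE VsV// bop_oneE opprB.
rewrite l2normN V_xi; apply: le_trans (opnorm_ub _ _) _; rewrite -[leRHS]mul1r.
by apply: ler_pM; rewrite ?opnorm_ge0 ?l2norm_ge0//; exact: (VsP R hs).2.
Qed.

(** Continuity at 0 only; for the diagonals rebuilt from an operator it follows directly from decay
    in the valuation. *)
Definition lim_zero W := forall e : R, 0 < e ->
  exists K, forall l, (sz ^+ K %| l)%Z -> normc (W l - W 0) <= e.

Lemma adic_unif_lim_zero W : adic_unif s W -> lim_zero W.
Proof.
by move=> uW e e0; have [K HK] := uW e e0; exists K => l dl; apply: HK; rewrite subr0.
Qed.

Lemma ent_dg W k l : bdd W -> ent (dg W) k l = W l * (k == l)%:R.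
Proof. by move=> bW; rewrite /ent dg_basis// l2Z basis_vecE. Qed.

Lemma at_zero_dg W : bdd W -> lim_zero W -> at_zero (dg W).
Proof.
move=> bW lW; split=> [k /negbTE k0|e e0]; first by rewrite ent_dg// k0 mulr0.
have e2 : 0 < e / 2 by rewrite divr_gt0.
have [K1 HK] := lW _ e2; have [B WB] := bW.
rewrite ent_dg// eqxx mulr1.
(* [W1] is small everywhere; [W2] vanishes on multiples of [s ^ K1], so it sees only the first [K1]
   terms of [xi K], a fixed vector against a growing norm. *)
pose W1 l := if (sz ^+ K1 %| l)%Z then W l - W 0 else 0.
pose W2 l := if (sz ^+ K1 %| l)%Z then 0 else W l - W 0.
have W1e l : normc (W1 l) <= e / 2.
  by rewrite /W1; case: ifP => [/HK//|_]; rewrite normc0 ltW.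
have W2B l : normc (W2 l) <= B + B.
  have B0 : 0 <= B := le_trans (normc_ge0 _) (WB 0).
  rewrite /W2; case: ifP => _; first by rewrite normc0 addr_ge0.
  by apply: le_trans (le_normcD _ _) _; rewrite normcN lerD.
have [K2 H2] := xi_large ((B + B) * l2norm (xi K1)) e2.
exists (maxn K1 K2) => K; rewrite geq_max => /andP[K1K /H2 K2K].
have -> : dg W (xi K) - W 0 *: xi K = dg W1 (xi K) + dg W2 (xi K1).
  have -> : dg W2 (xi K1) = dg W2 (xi K).
    rewrite /xi -(subnKC K1K) big_split_ord/= bopD -[LHS]addr0; congr (_ + _).
    rewrite bop_sum big1// => r _; rewrite dg_basis; last by exists (B + B).
    by rewrite /W2 dvdz_exp2l ?leq_addr// scale0r.
  apply: l2_ext => k; rewrite l2B l2D l2Z !dgE//; [|by exists (B + B)|by exists (e / 2)].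
  by rewrite /W1 /W2; case: ifP => _; ring.
apply: le_trans (l2normD _ _) _; rewrite [e]splitr mulrDl; apply: lerD.
  by apply: le_trans (opnorm_ub _ _) _; rewrite ler_wpM2r ?l2norm_ge0// dg_opnorm.
apply: le_trans K2K; apply: le_trans (opnorm_ub _ _) _.
by rewrite ler_wpM2r ?l2norm_ge0// dg_opnorm.
Qed.

Lemma at_zero0 : at_zero 0.
Proof.
split=> [//|e e0]; exists 0%N => K _.
by rewrite bop_zeroE ent0 scale0r subrr l2norm0 mulr_ge0 ?l2norm_ge0// ltW.
Qed.

Lemma at_zero1 : at_zero 1.
Proof. by have [zV zVs] := at_zeroV; rewrite -(VsV R hs); exact: at_zeroM. Qed.

Lemma at_zeroX A n : at_zero A -> at_zero (A ^+ n).
Proof.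
move=> zA; elim: n => [|n IH]; first by rewrite expr0; exact: at_zero1.
by rewrite exprS; exact: at_zeroM.
Qed.

Lemma HS_at_zero A : HS s A -> at_zero A.
Proof.
have [zV zVs] := at_zeroV.
move=> /(HS_approx hs) HA; apply: at_zero_approx; apply: approxW HA => B.
elim=> [|A' p W q sA IH uW]; first exact: at_zero0.
have zW := at_zero_dg (adic_unif_bdd hs uW) (adic_unif_lim_zero uW).
exact: at_zeroD IH (at_zeroM (at_zeroM (at_zeroX p zV) zW) (at_zeroX q zVs)).
Qed.

End Entries.

(** * Commutator bounds in the smooth algebra *)

Section Weights.
Variables (R : realType) (s : nat).
Hypothesis hs : (2 <= s)%N.
Notation sz := (s%:Z).
Notation E := (basis_vec R).
Notation V := (V R s).
Notation Vs := (Vs R s).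
Implicit Types (A : bop R) (W : int -> R[i]) (k l : int) (i j n r M : nat).

(* Truncating the valuation keeps the number operator bounded; all estimates
   below are uniform in the truncation level M. *)
Definition trunc_nu M l : nat := minn (nu s l) M.
Definition Nw M : bop R := dg (fun l => (trunc_nu M l)%:R).

Lemma normc_nat n : normc (n%:R : R[i]) = n%:R.
Proof.
have -> : (n%:R : R[i]) = (n%:R : R)%:C by rewrite rmorph_nat.
by rewrite /normc/= expr0n/= addr0 sqrtr_sqr ger0_norm.
Qed.

Lemma bdd_trunc M : bdd (fun l => (trunc_nu M l)%:R : R[i]).
Proof. by exists M%:R => l; rewrite normc_nat ler_nat geq_minr. Qed.

Lemma trunc_nu_szX M n l : (trunc_nu M l <= trunc_nu M (sz ^+ n * l) <= trunc_nu M l + n)%N.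
Proof.
rewrite /trunc_nu; have [->|l0] := eqVneq l 0; first by rewrite mulr0 leqnn leq_addr.
by rewrite nu_szX//; lia.
Qed.

(** [V ^+ n] raises the truncated valuation by at most [n] whatever the level [M], so a commutator
    with the number operator multiplies the symbol by a factor between 0 and [n]. *)
Lemma comm_Nw_VX M n W : bdd W -> comm (Nw M) (V ^+ n * dg W) =
  V ^+ n * dg (fun l => ((trunc_nu M (sz ^+ n * l))%:R - (trunc_nu M l)%:R) * W l).
Proof.
move=> bW; have bN := bdd_trunc M; have bN' := bdd_comp (fun l => sz ^+ n * l) bN.
rewrite /comm /Nw mulrA dg_VX// -!mulrA -mulrBr; congr (_ * _).
rewrite !dgM//; apply: bop_ext => l; rewrite bop_subE !dg_basis; try exact: bddM.
  by rewrite -scalerBl mulrBl [W l * _]mulrC.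
apply: bddM => //; case: bN => B HB; case: bN' => B' HB'; exists (B' + B) => k.
by apply: le_trans (le_normcD _ _) _; rewrite normcN lerD.
Qed.

Lemma comm_Nw_VsX M n W : bdd W -> comm (Nw M) (dg W * Vs ^+ n) =
  dg (fun l => ((trunc_nu M l)%:R - (trunc_nu M (sz ^+ n * l))%:R) * W l) * Vs ^+ n.
Proof.
move=> bW; have bN := bdd_trunc M; have bN' := bdd_comp (fun l => sz ^+ n * l) bN.
rewrite /comm /Nw -(mulrA (dg W)) VsX_dg// !mulrA -mulrBl; congr (_ * _).
rewrite !dgM//; apply: bop_ext => l; rewrite bop_subE !dg_basis; try exact: bddM.
  by rewrite -scalerBl mulrBl [W l * _]mulrC.
apply: bddM => //; case: bN => B HB; case: bN' => B' HB'; exists (B + B') => k.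
by apply: le_trans (le_normcD _ _) _; rewrite normcN lerD.
Qed.

Lemma normc_natB i j n : (i <= j <= i + n)%N -> normc (j%:R - i%:R : R[i]) <= n%:R.
Proof.
by move=> /andP[ij jn]; rewrite -natrB// normc_nat ler_nat leq_subLR.
Qed.

Lemma comm_norm_shift M r n W (B : R) : (forall l, normc (W l) <= B) ->
  comm_norm (Nw M) r (V ^+ n * dg W) <= (2 * (1 + n%:R)) ^+ r * B /\
  comm_norm (Nw M) r (dg W * Vs ^+ n) <= (2 * (1 + n%:R)) ^+ r * B.
Proof.
elim: r W B => [|r IH] W B WB.
  rewrite expr0 mul1r /=; split; apply: le_trans (opnormM _ _) _.
    rewrite -[leRHS]mul1r; apply: ler_pM;
      [exact: opnorm_ge0|exact: opnorm_ge0|exact: opnorm_VX|exact: dg_opnorm].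
  rewrite -[leRHS]mulr1; apply: ler_pM;
    [exact: opnorm_ge0|exact: opnorm_ge0|exact: dg_opnorm|exact: opnorm_VsX].
have B0 : 0 <= B := le_trans (normc_ge0 _) (WB 0).
have bW : bdd W by exists B.
rewrite /= comm_Nw_VX// comm_Nw_VsX//.
have fin (x y : R) : x <= (2 * (1 + n%:R)) ^+ r * B ->
    y <= (2 * (1 + n%:R)) ^+ r * (n%:R * B) -> x + y <= (2 * (1 + n%:R)) ^+ r.+1 * B.
  move=> hx hy; apply: le_trans (lerD hx hy) _.
  rewrite exprSr; set X := _ ^+ r.
  have XB : 0 <= X * B by rewrite mulr_ge0// exprn_ge0// mulr_ge0// addr_ge0.
  rewrite -subr_ge0 (_ : _ - _ = X * B * (1 + n%:R)); last by ring.
  by rewrite mulr_ge0// addr_ge0.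
split; apply: fin; try by have [] := IH W B WB.
  apply: (IH _ _ _).1 => l; rewrite normcM; apply: ler_pM; rewrite ?normc_ge0//.
  exact/normc_natB/trunc_nu_szX.
apply: (IH _ _ _).2 => l; rewrite normcM; apply: ler_pM; rewrite ?normc_ge0//.
rewrite normc_distC; exact/normc_natB/trunc_nu_szX.
Qed.

Definition wt M n l : R := 1 + (trunc_nu M (sz ^+ n * l))%:R + (trunc_nu M l)%:R.

(** Each step of [weight_norm] is a sum of three terms, whence [3 ^+ r], and in each the symbol
    gains at most one factor [wt], which collects the valuations of row and column. *)
Lemma weight_norm_shift M r n W (B : R) : bdd W -> (forall l, normc (W l) * wt M n l ^+ r <= B) ->
  weight_norm (Nw M) r (V ^+ n * dg W) <= 3 ^+ r * B /\
  weight_norm (Nw M) r (dg W * Vs ^+ n) <= 3 ^+ r * B.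
Proof.
have bN := bdd_trunc M; have bN' := bdd_comp (fun l => sz ^+ n * l) bN.
elim: r W B => [|r IH] W B bW WB.
  have {}WB l : normc (W l) <= B by have := WB l; rewrite expr0 mulr1.
  have := comm_norm_shift M 0 n WB; rewrite /= !expr0 !mul1r//.
have wt1 l : 1 <= wt M n l by rewrite /wt -addrA lerDl addr_ge0.
have W1 (f : int -> nat) l : (f l)%:R <= wt M n l ->
    normc ((f l)%:R * W l) * wt M n l ^+ r <= B.
  move=> fw; apply: le_trans (WB l); rewrite normcM normc_nat exprS mulrCA !mulrA.
  rewrite ler_wpM2r ?exprn_ge0 ?(le_trans ler01)//.
  by rewrite ler_wpM2r ?normc_ge0.
have W0 l : normc (W l) * wt M n l ^+ r <= B.
  apply: le_trans (WB l); rewrite exprSr mulrA ler_peMr// mulr_ge0 ?normc_ge0// exprn_ge0//.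
  exact: le_trans (wt1 l).
have Wa l : normc ((trunc_nu M (sz ^+ n * l))%:R * W l) * wt M n l ^+ r <= B.
  by apply: (W1 (fun l => trunc_nu M (sz ^+ n * l))); rewrite /wt -addrA addrCA lerDl addr_ge0.
have Wb l : normc ((trunc_nu M l)%:R * W l) * wt M n l ^+ r <= B.
  by apply: (W1 (fun l => trunc_nu M l)); rewrite /wt lerDr addr_ge0.
have [h1 h1'] := IH W B bW W0.
have [h2 h2'] := IH _ B (bddM bN' bW) Wa.
have [h3 h3'] := IH _ B (bddM bN bW) Wb.
have -> : 3 ^+ r.+1 * B = 3 ^+ r * B + 3 ^+ r * B + 3 ^+ r * B by rewrite exprSr; ring.
rewrite /=; split.
  rewrite {1}/Nw mulrA dg_VX// -mulrA dgM// -mulrA {2}/Nw dgM//.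
  apply: lerD; first by apply: lerD.
  by rewrite (_ : (fun k => W k * _) = fun l => (trunc_nu M l)%:R * W l)//; apply/funext => l; rewrite mulrC.
rewrite {1}/Nw mulrA dgM// -mulrA {2}/Nw VsX_dg// mulrA dgM//.
apply: lerD; first by apply: lerD.
by rewrite (_ : (fun k => W k * _) = fun l => (trunc_nu M (sz ^+ n * l))%:R * W l)//;
   apply/funext => l; rewrite mulrC.
Qed.

Lemma bil_sum_le (F : int -> R) (c : R) n : 0 <= c ->
  (forall j, F (Posz j) <= c * (1 + j%:R) ^- 2) -> (forall j, F (Negz j) <= c * (1 + j%:R) ^- 2) ->
  \sum_(j < n) (F (Posz j) + F (Negz j)) <= 4 * c.
Proof.
move=> c0 H1 H2; rewrite big_split/=.
have -> : 4 * c = c * 2 + c * 2 by ring.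
apply: lerD; apply: (@le_trans _ _ (c * \sum_(j < n) (1 + j%:R) ^- 2)).
- by rewrite mulr_sumr; apply: ler_sum.
- by rewrite ler_wpM2l// sum_inv_sq.
- by rewrite mulr_sumr; apply: ler_sum.
- by rewrite ler_wpM2l// sum_inv_sq.
Qed.

Lemma bilateral_seriesE (u : int -> bop R) n :
  bilateral_series u n = \sum_(j < n) (u (Posz j) + u (Negz j)).
Proof. by rewrite /bilateral_series /series/= big_mkord. Qed.

Lemma bil_cvg (u : int -> bop R) (c : R) : 0 <= c ->
  (forall j, opnorm (u (Posz j)) <= c * (1 + j%:R) ^- 2) ->
  (forall j, opnorm (u (Negz j)) <= c * (1 + j%:R) ^- 2) ->
  exists A, opcvg (bilateral_series u) A.
Proof.
move=> c0 H1 H2; apply: (@opcvg_series _ _ (4 * c)) => n.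
apply: le_trans (bil_sum_le (F := fun k => opnorm (u k)) n c0 H1 H2).
by apply: ler_sum => j _; exact: opnormD.
Qed.

(** [p] stands for any of the seminorms above; [K] certifies its continuity, and the bound depends
    on the terms alone. *)
Lemma bil_bound (p : bop R -> R) (K : R) (u : int -> bop R) A (c : R) : 0 <= c ->
  p 0 = 0 -> (forall X Y, p (X + Y) <= p X + p Y) -> (forall X, p X <= K * opnorm X) ->
  opcvg (bilateral_series u) A ->
  (forall j, p (u (Posz j)) <= c * (1 + j%:R) ^- 2) ->
  (forall j, p (u (Negz j)) <= c * (1 + j%:R) ^- 2) -> p A <= 4 * c.
Proof.
move=> c0 p0 pD pK uA H1 H2; apply: (seminorm_lim pD pK uA); exists 0%N => n _.
apply: le_trans (bil_sum_le n c0 (F := fun k => p (u k)) H1 H2).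
rewrite bilateral_seriesE; elim: n => [|n IH]; first by rewrite !big_ord0 p0.
rewrite !big_ord_recr/=; apply: le_trans (pD _ _) _; apply: lerD => //.
Qed.

End Weights.

(** * Terms of the Toeplitz series and of the ideal *)

Section SeriesTerms.
Variables (R : realType) (s : nat).
Hypothesis hs : (2 <= s)%N.
Notation sz := (s%:Z).
Notation E := (basis_vec R).
Notation V := (V R s).
Notation Vs := (Vs R s).
Notation Nw := (Nw R s).
Implicit Types (A : bop R) (W : int -> R[i]) (l : int) (i j n r M m : nat).

Lemma dg1 : dg (fun=> 1 : R[i]) = 1.
Proof.
apply: bop_ext => l; rewrite dg_basis ?scale1r//.
by exists 1 => k; rewrite normc1.
Qed.

Lemma inv_sq_bound (x C : R) j (a : R) : a = 1 + j%:R -> x * a ^+ 2 <= C -> x <= C * (1 + j%:R) ^- 2.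
Proof. by move=> ->; rewrite ler_pdivlMr// exprn_gt0// ltr_pwDl. Qed.

Lemma toeplitz_termE (phi : R -> R[i]) (k : int) : toeplitz_term s phi k = fourier_coef phi k *:
  match k with Posz j => V ^+ j | Negz j => Vs ^+ j.+1 end.
Proof. by case: k => j; rewrite /toeplitz_term ?(adj_shiftVE _ hs) ?(shiftVE' _ hs). Qed.

(** [Negz j] has absolute value [j + 1], hence the base [2 + j] at negative indices; two further
    powers of decay become the summable factor. *)
Lemma rapid_int_term (u : int -> R[i]) (p : nat) : rapid_int u -> exists2 C, 0 <= C &
  (forall j, normc (u (Posz j)) * (1 + j%:R) ^+ p <= C * (1 + j%:R) ^- 2) /\
  (forall j, normc (u (Negz j)) * (2 + j%:R) ^+ p <= C * (1 + j%:R) ^- 2).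
Proof.
move=> ru; have [C C0 HC] := ru (p + 2)%N; exists C => //; split=> j.
  by apply: (@inv_sq_bound _ _ _ (1 + j%:R)) => //; rewrite -mulrA -exprD; exact: HC (Posz j).
rewrite ler_pdivlMr ?exprn_gt0 ?ltr_pwDl// -mulrA; apply: le_trans (HC (Negz j)).
rewrite ler_wpM2l ?normc_ge0// exprD.
have -> : 1 + `|Negz j|%:R = 2 + j%:R :> R by rewrite -[`|Negz j|%N]/(j.+1) -natr1; ring.
rewrite ler_wpM2l ?exprn_ge0 ?addr_ge0// lerXn2r ?nnegrE ?addr_ge0//; lra.
Qed.

Lemma toeplitz_cvg (phi : R -> R[i]) : rapid_int (fourier_coef phi) ->
  opcvg (bilateral_series (toeplitz_term s phi)) (toeplitz s phi).
Proof.
move=> rp; suff [A cA] : exists A, opcvg (bilateral_series (toeplitz_term s phi)) A.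
  by rewrite /toeplitz /bilateral_sum (opcvg_lim cA).
have [C C0 [H1 H2]] := rapid_int_term 0 rp.
apply: (@bil_cvg _ _ C) => // j; rewrite toeplitz_termE opnormZ.
  have := H1 j; rewrite expr0 mulr1; apply: le_trans.
  by rewrite ler_piMr ?normc_ge0// opnorm_VX.
have := H2 j; rewrite expr0 mulr1; apply: le_trans.
by rewrite ler_piMr ?normc_ge0// opnorm_VsX.
Qed.

(** The diagonal symbol of [mult_units F]; its value at 0 encodes [M_F E_0 = 0]. *)
Definition WF (F : nat * Zs s -> R[i]) l : R[i] :=
  if l == 0 then 0 else F (nu s l, Zs_of_int s (unit_part s l)).

Lemma unit_part_decomp l : l != 0 -> l = sz ^+ nu s l * unit_part s l /\ ~~ (sz %| unit_part s l)%Z.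
Proof.
by move=> /(cop_decomp hs)[m [l' [-> dl']]]; rewrite nu_cop// unit_part_cop.
Qed.

Lemma mult_unitsE (F : nat * Zs s -> R[i]) : bdd (WF F) -> mult_units F = dg (WF F).
Proof.
move=> bW.
have H : [set A : bop R | A (E 0) = 0 /\ forall (m : nat) (l : int), ~~ (sz %| l)%Z ->
    A (E (sz ^+ m * l)) = F (m, Zs_of_int s l) *: E (sz ^+ m * l)] (mult_units F).
  apply: xgetPex; exists (dg (WF F)); split; first by rewrite dg_basis// /WF eqxx scale0r.
  move=> m l dl; rewrite dg_basis// /WF nu_cop// unit_part_cop//.
  have l0 : l != 0 by apply: contraNneq dl => ->; rewrite dvdz0.
  by rewrite mulf_eq0 (negbTE l0) (negbTE (szX_neq0 hs m)).
apply: bop_ext => l; rewrite dg_basis//; case: H => H0 H1.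
have [->|l0] := eqVneq l 0; first by rewrite H0 /WF eqxx scale0r.
have [e dl] := unit_part_decomp l0; rewrite {1}e H1// -e.
by rewrite /WF (negbTE l0).
Qed.

(** Off a compact set the values are below 1, and on it continuity bounds them. Boundedness is what
    makes the [sup] in [rapid_decay] an actual upper bound. *)
Lemma C0_units_bounded (F : nat * Zs s -> R[i]) : C0_units F ->
  exists B : R, forall m x, Zs_unit x -> normc (F (m, x)) <= B.
Proof.
move=> [cF /(_ 1 ltr01)[K [cK KX HK]]].
have cN : {within K, continuous (fun p => normc (F p))}.
  apply: (@continuous_subspaceW _ _ _ [set p : nat * Zs s | Zs_unit p.2]) => //.
  move=> x; apply/cvgrPdist_le => e e0.
  have := (continuous_dist (F : subspace _ -> R[i]) x).1 (cF x) e e0.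
  apply: filterS => y; apply: le_trans.
  rewrite -[X in `|X| <= _]/(normc (F x) - normc (F y)) -[X in _ <= X]/(normc (F x - F y)).
  have := normc_triangle (F x) (F y) 0; have := normc_triangle (F y) (F x) 0.
  rewrite !subr0 (normc_distC (F y) (F x)) => t1 t2; rewrite ler_norml.
  by apply/andP; split; lra.
have [B [_ HB]] := compact_bounded (continuous_compact cN cK).
exists (Num.max 1 (B + 1)) => m x ux; have [Kx|Kx] := pselect (K (m, x)).
  rewrite le_max; apply/orP; right; apply: le_trans (ler_norm _) _.
  by apply: (HB (B + 1)); [rewrite ltrDl|exists (m, x)].
by rewrite le_max; apply/orP; left; apply: ltW; exact: HK.
Qed.

Lemma Iinf_data (F : int -> nat * Zs s -> R[i]) : (forall n : int, C0_units (F n)) ->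
  rapid_decay (fun (m : nat) (n : int) => sup [set normc (F n (m, x)) | x in @Zs_unit s]) ->
  forall p, exists2 C, 0 <= C & forall (n : int) l,
    normc (WF (F n) l) * (1 + (nu s l)%:R + `|n|%:R) ^+ p <= C.
Proof.
move=> cF rF p; have [C HC] := rF p.
exists (Num.max C 0) => [|n l]; first by rewrite le_max lexx orbT.
rewrite /WF; case: eqP => [_|/eqP l0]; first by rewrite normc0 mul0r le_max lexx orbT.
have [B HB] := C0_units_bounded (cF n).
have [_ dl] := unit_part_decomp l0.
rewrite le_max; apply/orP; left; apply: le_trans (HC (nu s l) n).
rewrite ler_wpM2r ?exprn_ge0 ?addr_ge0//; apply: le_trans (ler_norm _).
apply: ub_le_sup; first by exists B => _ [x ux <-]; exact: HB.
by exists (Zs_of_int s (unit_part s l)) => //; apply/(Zs_of_int_unit hs).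
Qed.

Lemma WF_bdd (F : nat * Zs s -> R[i]) : C0_units F -> bdd (WF F).
Proof.
move=> cF; have [B HB] := C0_units_bounded cF; exists (Num.max B 0) => l.
rewrite /WF; case: eqP => [_|/eqP l0]; first by rewrite normc0 le_max lexx orbT.
rewrite le_max; apply/orP; left; apply: HB; apply/(Zs_of_int_unit hs).
by have [] := unit_part_decomp l0.
Qed.

Lemma Iinf_termE (F : int -> nat * Zs s -> R[i]) (n : int) : bdd (WF (F n)) -> Iinf_term F n =
  match n with Posz j => V ^+ j * dg (WF (F n)) | Negz j => dg (WF (F n)) * Vs ^+ j.+1 end.
Proof.
move=> bW; case: n bW => j bW; rewrite /Iinf_term mult_unitsE//.
  by rewrite (shiftVE' _ hs).
by rewrite (adj_shiftVE _ hs).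
Qed.

End SeriesTerms.

(** * Uniform bounds for elements of HS^oo(s) *)

Section ElementBounds.
Variables (R : realType) (s : nat).
Hypothesis hs : (2 <= s)%N.
Notation sz := (s%:Z).
Notation E := (basis_vec R).
Notation V := (V R s).
Notation Vs := (Vs R s).
Notation Nw := (Nw R s).
Implicit Types (A X : bop R) (W : int -> R[i]) (l : int) (i j n r M m : nat).

(** Of the [r + 2] powers of decay, [r] pay for commutators or weights and two make the terms
    summable. [6 ^+ r] is [3 ^+ r] from [weight_norm_shift] times [2 ^+ r] from
    [wt <= 2 * (1 + nu + n)]; it also covers the commutator bound. *)
Lemma shift_bounds r n W (C : R) M : bdd W ->
  (forall l, normc (W l) * (1 + (nu s l)%:R + n%:R) ^+ (r + 2) <= C) ->
  [/\ comm_norm (Nw M) r (V ^+ n * dg W) <= 6 ^+ r * C * (1 + n%:R) ^- 2,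
      comm_norm (Nw M) r (dg W * Vs ^+ n) <= 6 ^+ r * C * (1 + n%:R) ^- 2,
      weight_norm (Nw M) r (V ^+ n * dg W) <= 6 ^+ r * C * (1 + n%:R) ^- 2 &
      weight_norm (Nw M) r (dg W * Vs ^+ n) <= 6 ^+ r * C * (1 + n%:R) ^- 2].
Proof.
move=> bW WC.
have w1 l : 1 <= 1 + (nu s l)%:R + n%:R :> R by rewrite -addrA lerDl addr_ge0.
have n0 : 0 < 1 + n%:R :> R by rewrite ltr_pwDl.
have C0 : 0 <= C by apply: le_trans (WC 0); rewrite mulr_ge0 ?normc_ge0// exprn_ge0 ?(le_trans ler01).
have nw l : 1 + n%:R <= 1 + (nu s l)%:R + n%:R :> R by rewrite addrAC lerDl.
have Wq l : normc (W l) <= C * (1 + n%:R) ^- (r + 2).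
  rewrite ler_pdivlMr ?exprn_gt0//; apply: le_trans (WC l).
  by rewrite ler_wpM2l ?normc_ge0// lerXn2r// nnegrE ?(ltW n0)// (le_trans ler01).
have Ww l : normc (W l) * wt R s M n l ^+ r <= 2 ^+ r * C * (1 + n%:R) ^- 2.
  rewrite ler_pdivlMr ?exprn_gt0//.
  have wl : wt R s M n l <= 2 * (1 + (nu s l)%:R + n%:R).
    have /andP[_ h] := trunc_nu_szX hs M n l.
    have h2 : (trunc_nu s M l <= nu s l)%N by exact: geq_minl.
    have : (trunc_nu s M (sz ^+ n * l))%:R <= (nu s l)%:R + n%:R :> R.
      by rewrite -natrD ler_nat (leq_trans h)// leq_add2r.
    have : (trunc_nu s M l)%:R <= (nu s l)%:R :> R by rewrite ler_nat.
    have : 0 <= n%:R :> R by [].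
    rewrite /wt; lra.
  have wt0 : 0 <= wt R s M n l by rewrite /wt !addr_ge0.
  apply: (@le_trans _ _ (normc (W l) * (2 * (1 + (nu s l)%:R + n%:R)) ^+ r * (1 + (nu s l)%:R + n%:R) ^+ 2)).
    apply: ler_pM; rewrite ?mulr_ge0 ?normc_ge0 ?exprn_ge0 ?(ltW n0)//.
      rewrite ler_wpM2l ?normc_ge0// lerXn2r// nnegrE// mulr_ge0// (le_trans ler01)//.
    by rewrite lerXn2r// nnegrE ?(ltW n0)// (le_trans ler01).
  rewrite (_ : _ * _ * _ = 2 ^+ r * (normc (W l) * (1 + (nu s l)%:R + n%:R) ^+ (r + 2))).
    by rewrite ler_wpM2l ?exprn_ge0.
  by rewrite exprMn exprD; ring.
have [q1 q2] := comm_norm_shift hs M r n Wq.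
have [w1' w2'] := weight_norm_shift hs bW Ww.
have e1 : (2 * (1 + n%:R)) ^+ r * (C * (1 + n%:R) ^- (r + 2)) <= 6 ^+ r * C * (1 + n%:R) ^- 2 :> R.
  have -> : (2 * (1 + n%:R)) ^+ r * (C * (1 + n%:R) ^- (r + 2)) = 2 ^+ r * (C * (1 + n%:R) ^- 2) :> R.
    rewrite exprMn exprD; set x := (1 + n%:R) ^+ r.
    by field; rewrite (gt_eqF n0) /x expf_neq0 ?gt_eqF.
  rewrite -mulrA ler_wpM2r ?mulr_ge0 ?invr_ge0 ?exprn_ge0 ?(ltW n0)//.
  by rewrite lerXn2r ?nnegrE//; lra.
have e2 : 3 ^+ r * (2 ^+ r * C * (1 + n%:R) ^- 2) = 6 ^+ r * C * (1 + n%:R) ^- 2 :> R.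
  by rewrite !mulrA -exprMn; congr (_ ^+ _ * _ * _); ring.
rewrite e2 in w1' w2'.
by split => //; [exact: le_trans q1 e1|exact: le_trans q2 e1].
Qed.

Lemma inv_sqS n : (1 + n.+1%:R) ^- 2 <= (1 + n%:R) ^- 2 :> R.
Proof.
rewrite lef_pV2 ?posrE ?exprn_gt0 ?ltr_pwDl//.
by rewrite lerXn2r ?nnegrE ?addr_ge0// lerD2l ler_nat.
Qed.

Lemma Iinf_bounds (c : bop R) : Iinf s c -> forall r, exists2 C, 0 <= C &
  forall M, comm_norm (Nw M) r c <= C /\ weight_norm (Nw M) r c <= C.
Proof.
move=> [F [cF rF /opcvgP Fc]] r.
have [C C0 HC] := Iinf_data hs cF rF (r + 2).
have D0 : 0 <= 6 ^+ r * C by rewrite mulr_ge0// exprn_ge0.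
exists (4 * (6 ^+ r * C)) => [|M]; first by rewrite mulr_ge0.
have bW (n : int) := WF_bdd hs (cF n).
have E1 (j : nat) := Iinf_termE hs (bW (Posz j)).
have E2 (j : nat) := Iinf_termE hs (bW (Negz j)).
have B1 (j : nat) := shift_bounds M (bW (Posz j)) (HC (Posz j)).
have B2 (j : nat) := shift_bounds M (bW (Negz j)) (HC (Negz j)).
split.
  apply: (bil_bound D0 (comm_norm0 _ _) (comm_normD _ r) (comm_norm_bound _ r) Fc) => j.
    by rewrite E1; case: (B1 j).
  rewrite E2; apply: (le_trans (_ : _ <= 6 ^+ r * C * (1 + j.+1%:R) ^- 2)); first by case: (B2 j).
  by rewrite ler_wpM2l// inv_sqS.
apply: (bil_bound D0 (weight_norm0 _ _) (weight_normD _ r) (weight_norm_bound _ r) Fc) => j.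
  by rewrite E1; case: (B1 j).
rewrite E2; apply: (le_trans (_ : _ <= 6 ^+ r * C * (1 + j.+1%:R) ^- 2)); first by case: (B2 j).
by rewrite ler_wpM2l// inv_sqS.
Qed.

(** Symbol of the defect projection [1 - V V^*] of the isometry [V]. *)
Definition ndvd l : R[i] := if (sz %| l)%Z then 0 else 1.

Lemma ndvd_le l : normc (ndvd l) <= 1.
Proof. by rewrite /ndvd; case: ifP; rewrite ?normc0 ?normc1. Qed.

Lemma bdd_ndvd : bdd ndvd. Proof. by exists 1; exact: ndvd_le. Qed.

Lemma dg_ndvd : dg ndvd = 1 - V * Vs.
Proof.
apply: bop_eq => x; apply: l2_ext => k; rewrite bop_subE l2B bop_mulE bop_oneE (dgE bdd_ndvd).
rewrite (VP R s).1 /ndvd; case: ifP => dk; last by rewrite mul1r subr0.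
by rewrite mul0r (VsP R hs).1 mulrC divzK// subrr.
Qed.

(** As [V^* V = 1] while [V V^*] misses a projection, only this defect remains of the commutator. *)
Lemma comm_V_VsX j : comm V (Vs ^+ j.+1) = - (dg ndvd * Vs ^+ j).
Proof.
rewrite /comm dg_ndvd mulrBl mul1r opprB exprS mulrA; congr (_ - _).
by rewrite -exprS exprSr -mulrA (VsV R hs) mulr1.
Qed.

Lemma comm_Vs_VX j : comm Vs (V ^+ j.+1) = V ^+ j * dg ndvd.
Proof.
rewrite /comm dg_ndvd mulrBr mulr1 exprS mulrA (VsV R hs) mul1r; congr (_ - _).
by rewrite -exprS exprSr mulrA.
Qed.

Lemma comm_VX A j : comm A (A ^+ j) = 0.
Proof. by rewrite /comm -exprS exprSr subrr. Qed.

(** On the range of the defect projection the valuation vanishes, and [V ^+ j] raises it by at most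
    [j]; all weights are thus at most [1 + j]. *)
Lemma weight_norm_ndvd M r j : weight_norm (Nw M) r (V ^+ j * dg ndvd) <= 3 ^+ r * (1 + j%:R) ^+ r /\
  weight_norm (Nw M) r (dg ndvd * Vs ^+ j) <= 3 ^+ r * (1 + j%:R) ^+ r.
Proof.
apply: (weight_norm_shift hs bdd_ndvd) => l; rewrite /ndvd; case: ifPn => dl.
  by rewrite normc0 mul0r exprn_ge0// addr_ge0.
rewrite normc1 mul1r lerXn2r ?nnegrE ?addr_ge0// /wt.
have t0 : trunc_nu s M l = 0%N by rewrite /trunc_nu (nu_cop0 hs dl) min0n.
have /andP[_] := trunc_nu_szX hs M j l; rewrite t0 addr0 add0n => h.
by rewrite lerD2l ler_nat.
Qed.

(** [V] commutes with the terms of nonnegative index and [V^*] with those of negative index. The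
    other commutators carry the defect projection; their weights grow polynomially in the index and
    are absorbed by the decay of the coefficients. *)
Lemma toeplitz_bounds (phi : R -> R[i]) : rapid_int (fourier_coef phi) ->
  forall r, exists2 C, 0 <= C & forall M,
   [/\ comm_norm (Nw M) r (toeplitz s phi) <= C,
       weight_norm (Nw M) r (comm V (toeplitz s phi)) <= C &
       weight_norm (Nw M) r (comm Vs (toeplitz s phi)) <= C].
Proof.
move=> rp r; have cT := toeplitz_cvg hs rp.
have [C C0 [H1 H2]] := rapid_int_term r rp.
have D0 : 0 <= 3 ^+ r * C by rewrite mulr_ge0// exprn_ge0.
exists (4 * (3 ^+ r * C)) => [|M]; first by rewrite mulr_ge0.
have i0 j : 0 <= C * (1 + j%:R) ^- 2 by rewrite mulr_ge0// invr_ge0 exprn_ge0// addr_ge0.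
have P1 (p : bop R -> R) (c : R[i]) X (z y : R) : (forall c X, p (c *: X) = normc c * p X) ->
    p X <= 3 ^+ r * z -> normc c * z <= y -> p (c *: X) <= 3 ^+ r * y.
  move=> pZ pX zy; rewrite pZ; apply: le_trans (ler_wpM2l (normc_ge0 _) pX) _.
  by rewrite mulrCA ler_wpM2l// exprn_ge0.
have one l : normc (1 : R[i]) <= 1 by rewrite normc1.
have qV j : comm_norm (Nw M) r (V ^+ j) <= 3 ^+ r * (1 + j%:R) ^+ r.
  have [+ _] := comm_norm_shift hs M r j one; rewrite dg1 !mulr1 => /le_trans; apply.
  by rewrite exprMn ler_wpM2r ?exprn_ge0 ?addr_ge0// lerXn2r ?nnegrE ?ler_nat.
have qVs j : comm_norm (Nw M) r (Vs ^+ j) <= 3 ^+ r * (1 + j%:R) ^+ r.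
  have [_] := comm_norm_shift hs M r j one; rewrite dg1 mul1r mulr1 => /le_trans; apply.
  by rewrite exprMn ler_wpM2r ?exprn_ge0 ?addr_ge0// lerXn2r ?nnegrE ?ler_nat.
have j2 j : 1 + j.+1%:R = 2 + j%:R :> R by rewrite -natr1; ring.
have H2' j : normc (fourier_coef phi (Negz j)) * (1 + j.+1%:R) ^+ r <= C * (1 + j%:R) ^- 2.
  by rewrite j2; exact: H2.
have wcZ v c X : weight_norm (Nw M) r (comm v (c *: X)) = normc c * weight_norm (Nw M) r (comm v X).
  by rewrite commZ weight_normZ.
have wc0 v : weight_norm (Nw M) r (comm v 0) = 0 by rewrite /comm mulr0 mul0r subrr weight_norm0.
have wcD v X Y : weight_norm (Nw M) r (comm v (X + Y)) <= weight_norm (Nw M) r (comm v X) + weight_norm (Nw M) r (comm v Y).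
  by rewrite commD weight_normD.
have wcB v X : weight_norm (Nw M) r (comm v X) <=
    (1 + 2 * opnorm (Nw M)) ^+ r * (2 * opnorm v) * opnorm X.
  apply: le_trans (weight_norm_bound _ _ _) _; rewrite -mulrA ler_wpM2l//.
    by rewrite exprn_ge0// addr_ge0// mulr_ge0// opnorm_ge0.
  apply: le_trans (opnormD _ _) _; rewrite opnormN.
  apply: le_trans (lerD (opnormM _ _) (opnormM _ _)) _.
  by rewrite [opnorm X * _]mulrC -[leRHS]mulrA [leRHS]mulr_natl mulr2n.
split.
- apply: (bil_bound D0 (comm_norm0 _ _) (comm_normD _ r) (comm_norm_bound _ r) cT) => j;
    rewrite (toeplitz_termE hs) -mulrA.
    exact: P1 (comm_normZ _ _) (qV j) (H1 j).
  exact: P1 (comm_normZ _ _) (qVs j.+1) (H2' j).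
- apply: (bil_bound D0 (wc0 V) (wcD V) (wcB V) cT) => j;
    rewrite (toeplitz_termE hs) -mulrA.
    by rewrite commZ comm_VX scaler0 weight_norm0 mulr_ge0 ?exprn_ge0.
  rewrite commZ comm_V_VsX; apply: P1 (weight_normZ _ _) _ (H2 j).
  rewrite weight_normN; apply: le_trans (weight_norm_ndvd M r j).2 _.
  by rewrite ler_wpM2l ?exprn_ge0// lerXn2r ?nnegrE ?addr_ge0// lerD2r ler1n.
- apply: (bil_bound D0 (wc0 Vs) (wcD Vs) (wcB Vs) cT) => j;
    rewrite (toeplitz_termE hs) -mulrA.
    case: j => [|j].
      by rewrite expr0 commZ comm1 scaler0 weight_norm0 mulr_ge0 ?exprn_ge0.
    rewrite commZ comm_Vs_VX; apply: P1 (weight_normZ _ _) _ (H1 j.+1).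
    apply: le_trans (weight_norm_ndvd M r j).1 _.
    by rewrite ler_wpM2l ?exprn_ge0// lerXn2r ?nnegrE ?addr_ge0// lerD2l ler_nat.
  by rewrite commZ comm_VX scaler0 weight_norm0 mulr_ge0 ?exprn_ge0.
Qed.

Lemma HSinf_bounds (a : bop R) : HSinf s a -> exists C : nat -> R, forall r, 0 <= C r /\ forall M,
   [/\ comm_norm (Nw M) r a <= C r, weight_norm (Nw M) r (comm V a) <= C r & weight_norm (Nw M) r (comm Vs a) <= C r].
Proof.
move=> [phi [c [sp Ic ->]]]; have rp := fourier_coef_decay sp.
have H r : exists C : R, 0 <= C /\ forall M,
    [/\ comm_norm (Nw M) r (toeplitz s phi + c) <= C, weight_norm (Nw M) r (comm V (toeplitz s phi + c)) <= C &
        weight_norm (Nw M) r (comm Vs (toeplitz s phi + c)) <= C].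
  have [C C0 HC] := toeplitz_bounds rp r; have [D D0 HD] := Iinf_bounds Ic r.
  have t0 : 0 <= 4 ^+ r :> R by rewrite exprn_ge0.
  (* [4 ^+ r], from [2 * (1 + 1)] in [comm_norm_shift], bounds the commutator norms of [V] and [Vs];
     the ideal part [c] has bounded weight norm itself, so each of the two products in its
     commutator is bounded by [4 ^+ r * D]. *)
  exists (C + (D + 2 * 4 ^+ r * D)); split=> [|M]; first by rewrite !addr_ge0// !mulr_ge0.
  have one l : normc (1 : R[i]) <= 1 by rewrite normc1.
  have [qV qVs] := comm_norm_shift hs M r 1 one.
  rewrite dg1 !expr1 !mulr1 mul1r (_ : 2 * (1 + 1) = 4) in qV qVs; last by ring.
  have wc v : comm_norm (Nw M) r v <= 4 ^+ r -> weight_norm (Nw M) r (comm v c) <= 2 * 4 ^+ r * D.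
    move=> qv; have -> : comm v c = v * c * 1 - 1 * c * v by rewrite mulr1 mul1r.
    apply: le_trans (weight_normD _ _ _ _) _; rewrite weight_normN.
    apply: le_trans (lerD (weight_normM _ _ _ _ _) (weight_normM _ _ _ _ _)) _.
    have [_ wcD] := HD M.
    have q1 : comm_norm (Nw M) r 1 <= 1 := comm_norm_one _ _.
    have h : comm_norm (Nw M) r v * weight_norm (Nw M) r c <= 4 ^+ r * D.
      by apply: ler_pM => //; [exact: comm_norm_ge0|exact: weight_norm_ge0].
    have -> : 2 * 4 ^+ r * D = 4 ^+ r * D * 1 + 1 * D * 4 ^+ r by ring.
    apply: lerD; apply: ler_pM => //; rewrite ?mulr_ge0 ?comm_norm_ge0 ?weight_norm_ge0//.
    by apply: ler_pM => //; rewrite ?comm_norm_ge0 ?weight_norm_ge0.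
  have [h1 h2 h3] := HC M; have [g1 _] := HD M.
  have D2 : 0 <= 2 * 4 ^+ r * D by rewrite !mulr_ge0.
  split.
  - by apply: le_trans (comm_normD _ _ _ _) _; apply: lerD => //; rewrite (le_trans g1)// lerDl.
  - rewrite commD; apply: le_trans (weight_normD _ _ _ _) _; apply: lerD => //.
    by rewrite (le_trans (wc _ qV))// lerDr.
  - rewrite commD; apply: le_trans (weight_normD _ _ _ _) _; apply: lerD => //.
    by rewrite (le_trans (wc _ qVs))// lerDr.
by exists (fun r => sval (cid (H r))) => r; exact: svalP (cid (H r)).
Qed.

End ElementBounds.

(** * Functional calculus *)

Section Spectrum.
Variables (R : realType) (s : nat).
Hypothesis hs : (2 <= s)%N.
Implicit Types (A a b c : bop R) (n : nat).

Lemma opcvg_mull A u b : opcvg u b -> opcvg (fun n => A * u n) (A * b).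
Proof.
move=> ub e e0; have [N HN] := ub (e / (opnorm A + 1)) (divr_gt0 e0 (ltr_wpDl (opnorm_ge0 A) ltr01)).
exists N => n nN; rewrite -mulrBr; apply: le_trans (opnormM _ _) _.
apply: le_trans (ler_wpM2l (opnorm_ge0 A) (HN n nN)) _.
rewrite mulrA ler_pdivrMr ?ltr_wpDl ?opnorm_ge0//.
by rewrite mulrC ler_wpM2l ?(ltW e0)// lerDl.
Qed.

Lemma opcvg_mulr A u b : opcvg u b -> opcvg (fun n => u n * A) (b * A).
Proof.
move=> ub e e0; have [N HN] := ub (e / (opnorm A + 1)) (divr_gt0 e0 (ltr_wpDl (opnorm_ge0 A) ltr01)).
exists N => n nN; rewrite -mulrBl; apply: le_trans (opnormM _ _) _.
apply: le_trans (ler_wpM2r (opnorm_ge0 A) (HN n nN)) _.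
rewrite mulrAC ler_pdivrMr ?ltr_wpDl ?opnorm_ge0//.
by rewrite ler_wpM2l ?(ltW e0)// lerDl.
Qed.

Lemma HS_span (z : R[i]) A B : HS s A -> HS s B -> HS s (z *: A + B).
Proof. by move=> HA HB; exact: (cstar_linear (HS_cstar R s)). Qed.
Lemma HS_mul A B : HS s A -> HS s B -> HS s (A * B).
Proof. by move=> HA HB; exact: (cstar_mul (HS_cstar R s)). Qed.
Lemma HS_scale (z : R[i]) A : HS s A -> HS s (z *: A).
Proof.
move=> HA; have -> : z *: A = (z - 1) *: A + A by rewrite scalerBl scale1r subrK.
exact: HS_span.
Qed.
Lemma HS_add A B : HS s A -> HS s B -> HS s (A + B).
Proof. by move=> HA HB; rewrite -[A]scale1r; exact: HS_span. Qed.
Lemma HS_opp A : HS s A -> HS s (- A).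
Proof. by move=> HA; rewrite -scaleN1r; exact: HS_scale. Qed.
Lemma HS_0 : HS s (0 : bop R).
Proof. by rewrite -(scale0r (1 : bop R)); apply: HS_scale; exact: HS1. Qed.
Lemma HS_exp A n : HS s A -> HS s (A ^+ n).
Proof.
move=> HA; elim: n => [|n IH]; first by rewrite expr0; exact: HS1.
by rewrite exprS; exact: HS_mul.
Qed.
Lemma HS_sum (I : Type) (r : seq I) (F : I -> bop R) :
  (forall i, HS s (F i)) -> HS s (\sum_(i <- r) F i).
Proof.
by move=> HF; elim/big_ind: _ => // [|A B]; [exact: HS_0|exact: HS_add].
Qed.

(** The inverse must lie in [HS s], since the spectrum is taken there; closedness of [HS s] puts the
    sum of the series in it. *)
Lemma neumann c : HS s c -> opnorm c < 1 ->
  exists b, [/\ HS s b, (1 - c) * b = 1 & b * (1 - c) = 1].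
Proof.
move=> Hc c1; have c0 := opnorm_ge0 c.
have cX n : opnorm (c ^+ n) <= opnorm c ^+ n.
  elim: n => [|n IH]; first by rewrite !expr0 opnorm1.
  by rewrite !exprS; apply: le_trans (opnormM _ _) _; rewrite ler_wpM2l.
have d0 : 0 < 1 - opnorm c by rewrite subr_gt0.
have geo n : \sum_(k < n) opnorm (c ^+ k) <= (1 - opnorm c)^-1.
  apply: (@le_trans _ _ (\sum_(k < n) opnorm c ^+ k)); first exact: ler_sum.
  rewrite -[leRHS]mul1r ler_pdivlMr// mulrC -opprB mulNr -subrX1 opprB.
  by rewrite gerBl exprn_ge0.
have [b cb] := opcvg_series geo.
have Sn n : series (GRing.exp c) n = \sum_(k < n) c ^+ k by rewrite /series/= big_mkord.
have Sl n : (1 - c) * (\sum_(k < n) c ^+ k) = 1 - c ^+ n.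
  by rewrite -[1 - c in LHS]opprB mulNr -subrX1 opprB.
have Sr n : (\sum_(k < n) c ^+ k) * (1 - c) = 1 - c ^+ n.
  rewrite -Sl mulr_suml mulr_sumr; apply: eq_bigr => k _.
  by rewrite mulrBr mulrBl mulr1 mul1r -exprS -exprSr.
have Xn : opcvg (fun n => 1 - c ^+ n) 1.
  move=> e e0; have : (fun n => opnorm c ^+ n) @ \oo --> (0 : R).
    by apply: cvg_expr; rewrite ger0_norm.
  move/cvgrPdist_le => /(_ e e0) [N _ HN]; exists N => n /HN /=.
  rewrite sub0r normrN ger0_norm ?exprn_ge0// => h.
  have -> : 1 - c ^+ n - 1 = - c ^+ n by rewrite -[1 - c ^+ n]addrC addrK.
  by rewrite opnormN; apply: le_trans (cX n) h.
exists b; split.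
- apply: (closed_opcvg (cstar_closed (HS_cstar R s)) _ cb) => n.
  by rewrite Sn; apply: HS_sum => k; exact: HS_exp.
- apply: opcvg_unique (opcvg_mull (1 - c) cb) _.
  by under [X in opcvg X]funext => n do rewrite Sn Sl.
- apply: opcvg_unique (opcvg_mulr (1 - c) cb) _.
  by under [X in opcvg X]funext => n do rewrite Sn Sr.
Qed.

(** [A - c] factors as [(1 - c * B) * A] and as [A * (1 - B * c)]; each factorisation gives a
    one-sided inverse, and the two coincide. *)
Lemma resolvent_perturb A B c : HS s B -> A * B = 1 -> B * A = 1 -> HS s c ->
  opnorm (c * B) < 1 -> opnorm (B * c) < 1 ->
  exists b, [/\ HS s b, (A - c) * b = 1 & b * (A - c) = 1].
Proof.
move=> HB AB BA Hc cB Bc.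
have [b1 [H1 b1l b1r]] := neumann (HS_mul Hc HB) cB.
have [b2 [H2 b2l b2r]] := neumann (HS_mul HB Hc) Bc.
have E1 : A - c = (1 - c * B) * A by rewrite mulrBl mul1r -mulrA BA mulr1.
have E2 : A - c = A * (1 - B * c) by rewrite mulrBr mulr1 mulrA AB mul1r.
exists (B * b1); split; first exact: HS_mul.
- by rewrite E1 -mulrA (mulrA A) AB mul1r b1l.
- have -> : B * b1 = b2 * B.
    rewrite -[B * b1]mul1r -b2r -(mulrA b2); congr (_ * _).
    by rewrite mulrBl mul1r mulrA -(mulrA B c) -mulrA -mulrBr -{1}[b1]mul1r -mulrBl b1l mulr1.
  by rewrite E2 -mulrA (mulrA B) BA mul1r b2r.
Qed.

Variables (a : bop R) (sa : HS s a).
Let X := real_spectrum s a.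

(** [a - t] is a perturbation of the invertible scalar [- t], small relative to it when [|t|]
    exceeds [opnorm a]. *)
Lemma real_spectrum_le t : X t -> `|t| <= opnorm a.
Proof.
move=> Xt; rewrite leNgt; apply/negP => lt; apply: Xt.
have t0 : 0 < `|t| by exact: le_lt_trans (opnorm_ge0 a) lt.
have tn : t%:C != 0 :> R[i].
  by rewrite (_ : 0 = (0:R)%:C)// (inj_eq (@complexI R)) -normr_eq0 gt_eqF.
pose B : bop R := (- t%:C^-1) *: (1 : bop R).
have HB : HS s B by apply: HS_scale; exact: HS1.
have nB : normc (- t%:C^-1) = `|t|^-1.
  by rewrite normcN normcV /normc/= expr0n/= addr0 sqrtr_sqr.
have small d : opnorm d <= `|t|^-1 * opnorm a -> opnorm d < 1.
  by move=> h; apply: le_lt_trans h _; rewrite mulrC ltr_pdivrMr// mul1r.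
have [] := @resolvent_perturb (- (t%:C *: (1 : bop R))) B (- a) HB.
- by rewrite /B -bop_scaleAr mulr1 scalerN scalerA mulNr mulVf// scaleN1r opprK.
- by rewrite /B mulrN -bop_scaleAl mul1r scalerA mulNr mulVf// scaleN1r opprK.
- exact: HS_opp.
- by apply: small; rewrite mulNr opnormN /B -bop_scaleAr mulr1 opnormZ nB.
- by apply: small; rewrite mulrN opnormN /B -bop_scaleAl mul1r opnormZ nB.
move=> b [Hb b1 b2]; exists b; split => //.
- by move: b1; rewrite opprK [X in X * _]addrC.
- by move: b2; rewrite opprK [X in _ * X]addrC.
Qed.

Lemma real_spectrum_closed : closed X.
Proof.
rewrite -[X]setCK; apply: open_closedC; rewrite openE => t /= /contrapT[b [Hb b1 b2]].
rewrite /interior -nbhs_ballE; exists (opnorm b + 1)^-1 => /=.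
  by rewrite invr_gt0 ltr_wpDl ?opnorm_ge0.
move=> w; rewrite /ball/= => tw; apply.
have small d : opnorm d <= `|t - w| * opnorm b -> opnorm d < 1.
  move=> h; apply: le_lt_trans h _.
  have /le_lt_trans : `|t - w| * opnorm b <= `|t - w| * (opnorm b + 1).
    by rewrite ler_wpM2l// lerDl.
  by apply; rewrite -ltr_pdivlMr ?ltr_wpDl ?opnorm_ge0// mul1r.
have nB : normc (w%:C - t%:C) = `|t - w|.
  by rewrite -rmorphB /normc/= expr0n/= addr0 sqrtr_sqr distrC.
have [] := @resolvent_perturb (a - t%:C *: (1 : bop R)) b ((w%:C - t%:C) *: (1 : bop R)) Hb b1 b2.
- by apply: HS_scale; exact: HS1.
- by apply: small; rewrite -bop_scaleAl mul1r opnormZ nB.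
- by apply: small; rewrite -bop_scaleAr mulr1 opnormZ nB.
have -> : a - t%:C *: (1 : bop R) - (w%:C - t%:C) *: (1 : bop R) = a - w%:C *: (1 : bop R) :> bop R.
  by rewrite scalerBl opprB addrA subrK.
by move=> b' [? ? ?]; exists b'.
Qed.

Lemma real_spectrum_compact : compact X.
Proof.
apply: (subclosed_compact real_spectrum_closed (@segment_compact R (- opnorm a) (opnorm a))).
by move=> t /real_spectrum_le; rewrite ler_norml /= in_itv.
Qed.

End Spectrum.

Lemma normc_real (R : realType) (r : R) : normc r%:C = `|r|.
Proof. by rewrite /normc/= expr0n/= addr0 sqrtr_sqr. Qed.

(** * Norm bound for the continuous functional calculus *)

Section Calculus.
Variables (R : realType) (s : nat) (a : bop R) (Phi : (R -> R[i]) -> bop R).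
Hypothesis hPhi : continuous_calculus s a Phi.
Implicit Types (f h : R -> R[i]) (u v : R -> R).
Let X := real_spectrum s a.

Definition scont f := {within X, continuous (f : R -> R[i]^o)}.

Lemma scont_cst (z : R[i]) : scont (fun=> z).
Proof. by move=> x; exact: cvg_cst. Qed.

Arguments scont_cst : clear implicits.

Lemma scontD f h : scont f -> scont h -> scont (fun t => f t + h t).
Proof. by move=> cf ch x; apply: cvgD; [exact: cf|exact: ch]. Qed.

Lemma scontM f h : scont f -> scont h -> scont (fun t => f t * h t).
Proof. by move=> cf ch x; apply: cvgM; [exact: cf|exact: ch]. Qed.

Lemma scont_real u : {within X, continuous u} -> scont (fun t => (u t)%:C).
Proof.
move=> cu x; apply/(@continuous_dist R (subspace X) (fun t => (u t)%:C)) => e e0.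
have /cvgrPdist_le/(_ e e0) := cu x; apply: filterS => y.
by rewrite -rmorphB normc_real.
Qed.

Lemma scont_conj f : scont f -> scont (fun t => conjc (f t)).
Proof.
move=> cf x; apply/(@continuous_dist R (subspace X) (fun t => conjc (f t))) => e e0.
have := (@continuous_dist R (subspace X) f x).1 (cf x) e e0; apply: filterS => y.
by rewrite -conjcB normc_conj.
Qed.

Lemma scont_normc f : scont f -> {within X, continuous (fun t => normc (f t))}.
Proof.
move=> cf x; apply/cvgrPdist_le => e e0.
have := (@continuous_dist R (subspace X) f x).1 (cf x) e e0; apply: filterS => y.
move=> h; apply: le_trans h.
have A := normc_triangle (f x) (f y) 0; have B := normc_triangle (f y) (f x) 0.
move: A B; rewrite !subr0 [normc (f y - _)]normc_distC => A B.
by rewrite ler_norml lerBlDr A andbT lerNl opprB lerBlDr.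
Qed.

Lemma Phi_ext f h : scont f -> (forall t, X t -> f t = h t) -> Phi f = Phi h.
Proof. exact: (calculus_ext hPhi). Qed.

Lemma Phi0 : Phi (fun=> 0) = 0.
Proof.
have := calculus_linear hPhi (-1) (scont_cst 0) (scont_cst 0).
rewrite scaleN1r addNr => <-; apply: Phi_ext (scont_cst _) _ => t _.
by rewrite mulr0 addr0.
Qed.

Lemma PhiZ (z : R[i]) f : scont f -> Phi (fun t => z * f t) = z *: Phi f.
Proof.
move=> cf; have := calculus_linear hPhi z cf (scont_cst 0).
rewrite Phi0 addr0 => <-; apply: Phi_ext => [|t _]; last by rewrite addr0.
exact: (scontM (scont_cst z) cf).
Qed.

Lemma PhiD f h : scont f -> scont h -> Phi (fun t => f t + h t) = Phi f + Phi h.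
Proof.
move=> cf ch; have := calculus_linear hPhi 1 cf ch.
rewrite scale1r => <-; apply: Phi_ext => [|t _]; last by rewrite mul1r.
exact: scontD.
Qed.

Lemma Phi_cst (z : R[i]) : Phi (fun=> z) = z *: (1 : bop R).
Proof.
rewrite -(calculus_one hPhi) -PhiZ; last exact: scont_cst.
by apply: Phi_ext => [|t _]; [exact: scont_cst|rewrite mulr1].
Qed.

Lemma Phi_dotp f x : scont f ->
  dotp (Phi f x) (Phi f x) = dotp x (Phi (fun t => conjc (f t) * f t) x).
Proof.
move=> cf; rewrite (calculus_adjoint hPhi cf).
by rewrite -bop_mulE -(calculus_mul hPhi (scont_conj cf) cf).
Qed.

Lemma conjc_normc (z : R[i]) : conjc z * z = (normc z ^+ 2)%:C.
Proof.
case: z => p q; rewrite /normc sqr_sqrtr ?addr_ge0 ?sqr_ge0//.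
by apply/eqP; rewrite eq_complex/=; apply/andP; split; apply/eqP; ring.
Qed.

(* [|f|^2 + h^2 = M^2] with [h] real, so that [|Phi f x|^2 + |Phi h x|^2 = M^2 |x|^2]. *)
Lemma Phi_opnorm_le f (M : R) : 0 <= M -> scont f ->
  (forall t, X t -> normc (f t) <= M) -> opnorm (Phi f) <= M.
Proof.
move=> M0 cf fM; pose h t : R[i] := (Num.sqrt (M ^+ 2 - normc (f t) ^+ 2))%:C.
have ch : scont h.
  apply: scont_real => x.
  apply: (@continuous_comp _ _ _ (fun t : subspace X => M ^+ 2 - normc (f t) ^+ 2) Num.sqrt); first last.
    exact: sqrt_continuous.
  apply: cvgB; first exact: cvg_cst.
  by apply: cvgM; exact: scont_normc.
apply: opnorm_le_bound => // x.
have c1 := scontM (scont_conj cf) cf.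
have c2 := scontM (scont_conj ch) ch.
have E : Phi (fun t => conjc (f t) * f t) + Phi (fun t => conjc (h t) * h t) = (M ^+ 2)%:C *: (1 : bop R).
  rewrite -Phi_cst -(PhiD c1 c2); apply: (Phi_ext (scontD c1 c2)) => t Xt.
  rewrite !conjc_normc -rmorphD normc_real ger0_norm ?sqrtr_ge0// sqr_sqrtr ?subrKC//.
  by rewrite subr_ge0 lerXn2r ?nnegrE ?normc_ge0 ?fM.
have D : dotp (Phi f x) (Phi f x) + dotp (Phi h x) (Phi h x) = (M ^+ 2)%:C * dotp x x.
  rewrite (Phi_dotp x cf) (Phi_dotp x ch) -[dotp x (Phi (fun t => conjc (f t) * f t) x)]mul1r.
  have e1 : conjc (1 : R[i]) = 1 by apply/eqP; rewrite eq_complex/= oppr0 !eqxx.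
  rewrite -[X in X * _ + _]e1 -dotpDr scale1r -bop_addE E bop_scaleE bop_oneE.
  rewrite -[_ *: x]addr0 dotpDr [dotp x 0]dotp_conj dotp0l.
  have -> : conjc (0 : R[i]) = 0 by apply/eqP; rewrite eq_complex/= oppr0 !eqxx.
  by rewrite addr0; congr (_ * _); apply/eqP; rewrite eq_complex/= oppr0 !eqxx.
move: D; rewrite !dotpxx -rmorphD -rmorphM => /complexI D.
rewrite -(@ler_pXn2r _ 2) ?nnegrE ?mulr_ge0 ?l2norm_ge0// exprMn -D lerDl.
exact: sqr_ge0.
Qed.

End Calculus.

(** * Smooth functional calculus through Chebyshev sums *)

Section SmoothCalculus.
Variables (R : realType) (s : nat).
Hypothesis hs : (2 <= s)%N.
Variables (a : bop R) (Phi : (R -> R[i]) -> bop R).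
Hypothesis hPhi : continuous_calculus s a Phi.
Implicit Types (u v : R -> R).
Let X := real_spectrum s a.
(** Dividing by [L] brings the spectrum into [[-1, 1]]; the added 1 keeps [L] positive when
    [a = 0]. *)
Let L := opnorm a + 1.

Let L0 : 0 < L. Proof. by rewrite ltr_wpDl ?opnorm_ge0. Qed.

Lemma HS_calculus_id : HS s a.
Proof.
rewrite -(calculus_id hPhi); apply: (calculus_HS hPhi).
by apply: scont_real; apply: continuous_subspaceT => t; exact: cvg_id.
Qed.

Definition psi u : bop R := Phi (fun t => (u (t / (opnorm a + 1)))%:C).

Lemma psi_cont u : continuous u -> scont s a (fun t => (u (t / L))%:C).
Proof.
move=> cu; apply: (@scont_real R s a (fun t => u (t / L))); apply: continuous_subspaceT => t.
apply: (@continuous_comp R R R (fun t => t / L) u t); last exact: cu.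
by apply: cvgM; [exact: cvg_id|exact: cvg_cst].
Qed.

Lemma psiD u v : continuous u -> continuous v -> psi (fun y => u y + v y) = psi u + psi v.
Proof.
move=> cu cv; rewrite /psi -(PhiD hPhi (psi_cont cu) (psi_cont cv)).
by congr Phi; apply/funext => t; rewrite rmorphD.
Qed.

Lemma psiM u v : continuous u -> continuous v -> psi (fun y => u y * v y) = psi u * psi v.
Proof.
move=> cu cv; rewrite /psi -(calculus_mul hPhi (psi_cont cu) (psi_cont cv)).
by congr Phi; apply/funext => t; rewrite rmorphM.
Qed.

Lemma psiZ (c : R) u : continuous u -> psi (fun y => c * u y) = c%:C *: psi u.
Proof.
move=> cu; rewrite /psi -(PhiZ hPhi c%:C (psi_cont cu)).
by congr Phi; apply/funext => t; rewrite rmorphM.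
Qed.

Lemma psi_one : psi (fun=> 1) = 1.
Proof. by rewrite -(calculus_one hPhi). Qed.

Lemma psi_id : psi id = (L^-1)%:C *: a.
Proof.
rewrite -[in RHS](calculus_id hPhi) -(PhiZ hPhi); last first.
  by apply: scont_real; apply: continuous_subspaceT => t; exact: cvg_id.
by congr Phi; apply/funext => t; rewrite mulrC rmorphM.
Qed.

Lemma psi_opnorm_le u (M : R) : continuous u -> (forall y, -1 <= y <= 1 -> `|u y| <= M) ->
  opnorm (psi u) <= M.
Proof.
move=> cu uM; apply: (Phi_opnorm_le hPhi) => [||t Xt].
- by apply: le_trans (uM 0 _); rewrite ?normr_ge0// lerN10 ler01.
- exact: psi_cont.
rewrite normc_real; apply: uM; rewrite -ler_norml normrM normfV (gtr0_norm L0).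
rewrite ler_pdivrMr// mul1r; apply: le_trans (real_spectrum_le hs HS_calculus_id Xt) _.
by rewrite lerDl.
Qed.

Lemma chebT_continuous k : continuous (@chebT R k).
Proof.
suff: continuous (@chebT R k) /\ continuous (@chebT R k.+1) by case.
elim: k => [|k [IH1 IH2]]; first by split => y; [exact: cvg_cst|exact: cvg_id].
split=> // y; apply: cvgB; last exact: IH1.
by apply: cvgM; [apply: cvgM; [exact: cvg_cst|exact: cvg_id]|exact: IH2].
Qed.

Lemma chebT_le k (y : R) : -1 <= y <= 1 -> `|chebT k y| <= 1.
Proof. by move=> y1; rewrite -[y]acosK ?in_itv// chebT_cos ler_norml cos_geN1 cos_le1. Qed.

Lemma psi_cheb k : psi (chebT k) = chebTop (psi id) k.
Proof.
suff: psi (chebT k) = chebTop (psi id) k /\ psi (chebT k.+1) = chebTop (psi id) k.+1 by case.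
elim: k => [|k [IH1 IH2]]; first by split => //; exact: psi_one.
split=> //; rewrite [RHS]/= -/(chebTop _ k.+1) -IH1 -IH2.
have c1 := @chebT_continuous k.+1; have c0 := @chebT_continuous k.
have ci : continuous (@id R) by move=> y; exact: cvg_id.
have c3 : continuous (fun y : R => y * chebT k.+1 y) by move=> y; apply: cvgM; [exact: ci|exact: c1].
have -> : (psi id + psi id) * psi (chebT k.+1) - psi (chebT k) =
  psi (fun y => 2 * (y * chebT k.+1 y)) + psi (fun y => -1 * chebT k y).
  rewrite psiZ// psiZ// psiM// rmorphN rmorph1 scaleN1r mulrDl; congr (_ - _).
  by rewrite (rmorph_nat (@real_complex R)) scaler_nat mulr2n.
rewrite -psiD; first by congr psi; apply/funext => y; rewrite mulN1r mulrA.
  by move=> y; apply: cvgM; [exact: cvg_cst|exact: c3].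
by move=> y; apply: cvgM; [exact: cvg_cst|exact: c0].
Qed.

Lemma opnorm_chebTop k : opnorm (chebTop (psi id) k) <= 1.
Proof.
rewrite -psi_cheb; apply: psi_opnorm_le; first exact: chebT_continuous.
by move=> y; exact: chebT_le.
Qed.

(** [U_k = T_k + x U_(k-1)], where [T_k] has norm at most 1 because [chebT k] is bounded by 1 on
    [[-1, 1]]. *)
Lemma opnorm_chebS k : opnorm (chebS (psi id + psi id) k) <= k%:R.
Proof.
elim: k => [|k IH]; first by rewrite opnorm0.
have -> : chebS (psi id + psi id) k.+1 = chebTop (psi id) k + psi id * chebS (psi id + psi id) k.
  by rewrite chebTop_chebS subrK.
rewrite -natr1 [leRHS]addrC; apply: le_trans (opnormD _ _) _.
apply: lerD; first exact: opnorm_chebTop.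
apply: le_trans (opnormM _ _) _; rewrite -[leRHS]mul1r.
by apply: ler_pM; [exact: opnorm_ge0|exact: opnorm_ge0|exact: (opnorm_chebTop 1)|exact: IH].
Qed.

Lemma cheb_sum_continuous (c : nat -> R) K :
  continuous (fun y : R => \sum_(k < K) c k * chebT k y).
Proof.
elim: K => [|K IH] y; first by under eq_fun do rewrite big_ord0; exact: cvg_cst.
under eq_fun do rewrite big_ord_recr /=; apply: cvgD; first exact: IH.
by apply: cvgM; [exact: cvg_cst|exact: chebT_continuous].
Qed.

Lemma psi_sum (c : nat -> R) K : psi (fun y => \sum_(k < K) c k * chebT k y) =
  \sum_(k < K) (c k)%:C *: chebTop (psi id) k.
Proof.
elim: K => [|K IH].
  rewrite big_ord0 -(scale0r (psi (fun=> 1))) -[0 in RHS](rmorph0 (@real_complex R)).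
  rewrite -psiZ; last exact: cst_continuous.
  by congr psi; apply/funext => y; rewrite big_ord0 mul0r.
rewrite big_ord_recr /= -IH -psi_cheb -psiZ; last exact: chebT_continuous.
rewrite -psiD; first last.
  by move=> y; apply: cvgM; [exact: cvg_cst|exact: chebT_continuous].
  exact: cheb_sum_continuous.
by congr psi; apply/funext => y; rewrite big_ord_recr.
Qed.

Notation Nw := (Nw R s).

(** The decay of the coefficients beats the polynomial growth of the commutators, uniformly in the
    truncation and in the degree of the approximant; the bound then survives the limit of the
    Chebyshev sums. *)
Lemma weight_norm_comm_psi (w : bop R) (C Cw : nat -> R) :
  (forall r, 0 <= C r) -> (forall r M, comm_norm (Nw M) r a <= C r) ->
  (forall r, 0 <= Cw r) -> (forall r M, weight_norm (Nw M) r (comm w a) <= Cw r) ->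
  forall h, smooth h -> forall p, exists2 B, 0 <= B & forall M, weight_norm (Nw M) p (comm w (psi h)) <= B.
Proof.
move=> C0 aC Cw0 aCw h sh p; have [c [cRD capp]] := chebyshev_approximation sh.
have Li0 : 0 <= L^-1 by rewrite invr_ge0 ltW.
have nL : normc (L^-1)%:C = L^-1 by rewrite normc_real ger0_norm.
have [|| D [e [D0 HD]]] := @weight_norm_comm_chebTop_growth R (fun r => L^-1 * C r) (fun r => L^-1 * Cw r) p.
- by move=> i; rewrite mulr_ge0.
- by move=> i; rewrite mulr_ge0.
have TD M k : weight_norm (Nw M) p (comm w (chebTop (psi id) k)) <= D * (1 + k%:R) ^+ e.
  apply: HD; last exact: opnorm_chebS.
  - by move=> i; rewrite psi_id comm_normZ nL ler_wpM2l.
  - by move=> i; rewrite psi_id commZ weight_normZ nL ler_wpM2l.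
(* [e] powers against the growth of the commutators, two for summation. *)
have [B HB] := cRD (e + 2)%N.
have B0 : 0 <= B by apply: le_trans (HB 0%N 0%N); rewrite mulr_ge0 ?exprn_ge0.
pose P K := \sum_(k < K.+1) (c K k)%:C *: chebTop (psi id) k.
have PB M K : weight_norm (Nw M) p (comm w (P K)) <= B * D * 2.
  have -> : comm w (P K) = \sum_(k < K.+1) (c K k)%:C *: comm w (chebTop (psi id) k).
    by rewrite /P /comm mulr_sumr mulr_suml -sumrB; apply: eq_bigr => k _; exact: commZ.
  apply: le_trans (weight_norm_sum _ _ _ _) _.
  apply: (@le_trans _ _ (\sum_(k < K.+1) (B * D) * (1 + k%:R) ^- 2)).
    apply: ler_sum => k _; rewrite weight_normZ normc_real.
    have k0 : 0 < 1 + k%:R :> R by rewrite ltr_pwDl.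
    apply: le_trans (ler_wpM2l (normr_ge0 _) (TD M k)) _.
    rewrite ler_pdivlMr ?exprn_gt0//.
    have -> : `|c K k| * (D * (1 + k%:R) ^+ e) * (1 + k%:R) ^+ 2 =
        D * (`|c K k| * (1 + k%:R) ^+ (e + 2)) by rewrite exprD; ring.
    by rewrite [leRHS]mulrC ler_wpM2l.
  by rewrite -mulr_sumr ler_wpM2l ?mulr_ge0 ?sum_inv_sq.
exists (B * D * 2) => [|M]; first by rewrite !mulr_ge0.
have capp' n : exists K, opnorm (P K - psi h) <= n.+1%:R^-1.
  have [|K HK] := capp n.+1%:R^-1; first by rewrite invr_gt0.
  exists K; rewrite opnorm_distC /P -psi_sum.
  have ch := smooth_continuous sh; have cS := @cheb_sum_continuous (c K) K.+1.
  have cN : continuous (fun y => -1 * \sum_(k < K.+1) c K k * chebT k y).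
    by move=> y; apply: cvgM; [exact: cvg_cst|exact: cS].
  have -> : psi h - psi (fun y => \sum_(k < K.+1) c K k * chebT k y) =
      psi (fun y => h y + -1 * \sum_(k < K.+1) c K k * chebT k y).
    by rewrite psiD// psiZ// rmorphN rmorph1 scaleN1r.
  apply: psi_opnorm_le; first by move=> y; apply: cvgD; [exact: ch|exact: cN].
  by move=> y /HK; rewrite mulN1r.
(* A degree is chosen for each tolerance [1 / (n + 1)], since some approximant is known to be close,
   not all later ones. *)
pose Kn n := xget 0%N [set K | opnorm (P K - psi h) <= n.+1%:R^-1].
have HKn n : opnorm (P (Kn n) - psi h) <= n.+1%:R^-1.
  exact: (@xgetPex _ 0%N [set K | opnorm (P K - psi h) <= n.+1%:R^-1] (capp' n)).
have cvP : opcvg (fun n => P (Kn n)) (psi h).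
  move=> d d0; exists (Num.truncn d^-1) => n dn; apply: le_trans (HKn n) _.
  rewrite invf_ple ?posrE// ltW// (lt_le_trans (truncnS_gt _))// ler_nat ltnS//.
apply: (@seminorm_lim R (fun Y => weight_norm (Nw M) p (comm w Y))
  ((1 + 2 * opnorm (Nw M)) ^+ p * (2 * opnorm w)) _ _ _ _ _ cvP).
- by move=> Y Z; rewrite commD; exact: weight_normD.
- move=> Y; apply: le_trans (weight_norm_bound _ _ _) _; rewrite -mulrA.
  rewrite ler_wpM2l ?exprn_ge0 ?addr_ge0 ?mulr_ge0 ?opnorm_ge0//.
  apply: le_trans (opnormD _ _) _; rewrite opnormN.
  apply: le_trans (lerD (opnormM _ _) (opnormM _ _)) _.
  by rewrite [opnorm Y * _]mulrC -mulrA mulrDl !mul1r.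
by exists 0%N => n _; exact: PB.
Qed.

Lemma smooth_on_smn (U : set R) (g : R -> R[i]) : open U -> smooth_on U g ->
  (forall n t, U t -> nsmooth n (fun t => complex.Re (g t)) t) /\
  (forall n t, U t -> nsmooth n (fun t => complex.Im (g t)) t).
Proof.
move=> oU hg; split=> n t Ut; apply: nsmooth_pos => k _;
  by apply: filterS (open_nbhs_nbhs (conj oU Ut)) => y Uy; have [] := hg k y Uy.
Qed.

(** [Phi] sees only values on the spectrum, a compact set, so [u] may be replaced by a smooth
    function on the whole line. *)
Lemma Phi_real_part (U : set R) (u : R -> R) : open U -> X `<=` U ->
  (forall n t, U t -> nsmooth n u t) ->
  scont s a (fun t => (u t)%:C) /\ exists2 h, smooth h & Phi (fun t => (u t)%:C) = psi h.
Proof.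
move=> oU XU su; have [h sh hE] := smooth_extension (real_spectrum_compact hs HS_calculus_id) oU XU su.
have sc : scont s a (fun t => (u t)%:C).
  apply: scont_real; apply: continuous_in_subspaceT => t /set_mem Xt.
  by apply: nsmooth_continuous; exact: su (XU _ Xt).
split=> //; exists (fun y => h (L * y + 0)); first exact: smooth_comp_affine.
apply: (Phi_ext hPhi sc) => t Xt.
by rewrite addr0 mulrC divfK ?gt_eqF// hE.
Qed.

Lemma smooth_calculus_bounds (C : nat -> R) (U : set R) (g : R -> R[i]) :
  (forall r, 0 <= C r /\ forall M, [/\ comm_norm (Nw M) r a <= C r,
    weight_norm (Nw M) r (comm (V R s) a) <= C r & weight_norm (Nw M) r (comm (Vs R s) a) <= C r]) ->
  open U -> X `<=` U -> smooth_on U g ->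
  HS s (Phi g) /\ forall p, exists2 B, 0 <= B & forall M,
    weight_norm (Nw M) p (comm (V R s) (Phi g)) <= B /\ weight_norm (Nw M) p (comm (Vs R s) (Phi g)) <= B.
Proof.
move=> HC oU XU hg; have [sR sI] := smooth_on_smn oU hg.
have [cR [hR shR ER]] := Phi_real_part oU XU sR.
have [cI [hI shI EI]] := Phi_real_part oU XU sI.
have ii := scontM (@scont_cst R s a (0 +i* 1)) cI.
have gE t : g t = (complex.Re (g t))%:C + (0 +i* 1) * (complex.Im (g t))%:C.
  by case: (g t) => x y; apply/eqP; rewrite eq_complex/=; apply/andP; split; apply/eqP; ring.
have cg := scontD cR ii.
have gF : (fun t => (complex.Re (g t))%:C + (0 +i* 1) * (complex.Im (g t))%:C) = g.
  by apply/funext => t; rewrite -gE.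
rewrite gF in cg.
split; first exact: (calculus_HS hPhi).
have E : Phi g = psi hR + (0 +i* 1) *: psi hI.
  rewrite -ER -EI -(PhiZ hPhi _ cI) -(PhiD hPhi cR ii).
  by apply: (Phi_ext hPhi cg) => t _; exact: gE.
have n1 : normc (0 +i* 1 : R[i]) = 1 by rewrite /normc/= expr0n/= add0r expr1n sqrtr1.
have bnd w p : (forall r M, weight_norm (Nw M) r (comm w a) <= C r) -> exists2 B, 0 <= B &
    forall M, weight_norm (Nw M) p (comm w (Phi g)) <= B.
  move=> wC; have C0 r := (HC r).1.
  have qC r M : comm_norm (Nw M) r a <= C r by have [] := (HC r).2 M.
  have [B1 B10 H1] := weight_norm_comm_psi C0 qC C0 wC shR p.
  have [B2 B20 H2] := weight_norm_comm_psi C0 qC C0 wC shI p.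
  exists (B1 + B2) => [|M]; first exact: addr_ge0.
  rewrite E commD commZ; apply: le_trans (weight_normD _ _ _ _) _.
  by rewrite weight_normZ n1 mul1r; apply: lerD; [exact: H1|exact: H2].
move=> p; have [|B1 B10 H1] := bnd (V R s) p; first by move=> r M; have [] := (HC r).2 M.
have [|B2 B20 H2] := bnd (Vs R s) p; first by move=> r M; have [] := (HC r).2 M.
exists (B1 + B2) => [|M]; first exact: addr_ge0.
by split; [apply: le_trans (H1 M) _; rewrite lerDl|apply: le_trans (H2 M) _; rewrite lerDr].
Qed.

End SmoothCalculus.

(** * Elements determined by commutator bounds *)

Section EntryDecay.
Variables (R : realType) (s : nat).
Hypothesis hs : (2 <= s)%N.
Notation sz := (s%:Z).
Notation E := (basis_vec R).
Notation V := (V R s).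
Notation Vs := (Vs R s).
Notation Nw := (Nw R s).
Implicit Types (A X D : bop R) (W : int -> R[i]) (k l : int) (i j m p r M : nat) (n : int).

Lemma ent_dgl W A k l : bdd W -> ent (dg W * A) k l = W k * ent A k l.
Proof. by move=> bW; rewrite /ent bop_mulE dgE. Qed.

Lemma ent_dgr W A k l : bdd W -> ent (A * dg W) k l = W l * ent A k l.
Proof. by move=> bW; rewrite /ent bop_mulE dg_basis// bopZ l2Z. Qed.

(** The number operator on the left or right multiplies an entry by the truncated valuation of its
    row or column, so the recursion of [weight_norm] produces the power of the weight one factor at
    a time. *)
Lemma ent_wn M r D k l :
  normc (ent D k l) * (1 + (trunc_nu s M k)%:R + (trunc_nu s M l)%:R) ^+ r <= weight_norm (Nw M) r D.
Proof.
elim: r D => [|r IH] D /=; first by rewrite expr0 mulr1 ent_le.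
have bN := bdd_trunc R s M; have H1 := IH (Nw M * D); have H2 := IH (D * Nw M).
move: H1 H2; rewrite ent_dgl// ent_dgr// !normcM !normc_nat => H1 H2.
apply: le_trans (lerD (lerD (IH D) H1) H2).
by rewrite exprS le_eqVlt; apply/orP; left; apply/eqP; ring.
Qed.

(** A level above both valuations makes the truncation invisible, and [B] serves all levels. *)
Lemma ent_decay r D (B : R) k l : (forall M, weight_norm (Nw M) r D <= B) ->
  normc (ent D k l) * (1 + (nu s k)%:R + (nu s l)%:R) ^+ r <= B.
Proof.
move=> DB; apply: le_trans (DB (maxn (nu s k) (nu s l))).
have := ent_wn (maxn (nu s k) (nu s l)) r D k l.
by rewrite /trunc_nu (minn_idPl (leq_maxl _ _)) (minn_idPl (leq_maxr _ _)).
Qed.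

Variable G : bop R.

Lemma ent_commV k l : ent (comm V G) (sz * k) l = ent G k l - ent G (sz * k) (sz * l).
Proof.
have VE : V (E l) = E (sz * l) by have := VX_basis R hs 1 l; rewrite !expr1.
rewrite /comm entB; congr (_ - _); last by rewrite /ent bop_mulE VE.
by rewrite /ent bop_mulE (VP R s).1 dvdz_mulr// mulrC mulzK// gt_eqF// (sz_gt0 hs).
Qed.

Lemma ent_commV0 k l : ~~ (sz %| k)%Z -> ent (comm V G) k l = - ent G k (sz * l).
Proof.
move=> /negbTE dk; have VE : V (E l) = E (sz * l) by have := VX_basis R hs 1 l; rewrite !expr1.
by rewrite /comm entB /ent !bop_mulE VE (VP R s).1 dk sub0r.
Qed.

Lemma ent_commVs0 k l : ~~ (sz %| l)%Z -> ent (comm Vs G) k l = ent G (sz * k) l.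
Proof.
move=> dl; have := @VsX_basis0 R _ hs 1 l; rewrite !expr1 => /(_ dl) VE.
by rewrite /comm entB /ent !bop_mulE VE bop0 l2_0 subr0 (VsP R hs).1.
Qed.

(* The n-th diagonal consists of the entries in row s^(upn n + m) l and column
   s^(dnn n + m) l, with s not dividing l; here upn n - dnn n = n. *)
Definition upn n : nat := if n is Posz k then k else 0%N.
Definition dnn n : nat := if n is Negz k then k.+1 else 0%N.

Lemma updnE n : (upn n + dnn n)%N = `|n|%N.
Proof. by case: n => k; rewrite /upn /dnn ?addn0 ?add0n// NegzE absz_nat. Qed.

Definition diag_entry n m l : R[i] := ent G (sz ^+ (upn n + m) * l) (sz ^+ (dnn n + m) * l).

Hypothesis HG : forall p, exists2 B, 0 <= B & forall M,
  weight_norm (Nw M) p (comm V G) <= B /\ weight_norm (Nw M) p (comm Vs G) <= B.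

(** Neighbouring entries on a diagonal differ by an entry of [comm V G] whose row and column have
    valuations adding up to at least [m + |n|]. *)
Lemma diag_entry_step p : exists2 B : R, 0 <= B & forall n m l, ~~ (sz %| l)%Z ->
  normc (diag_entry n m.+1 l - diag_entry n m l) * (1 + m%:R + `|n|%:R) ^+ p <= B.
Proof.
have [B B0 HB] := HG p; exists B => // n m l dl.
have := ent_decay (sz * (sz ^+ (upn n + m) * l)) (sz ^+ (dnn n + m) * l) (fun M => (HB M).1).
rewrite ent_commV !mulrA -!exprS normc_distC !nu_cop// -!addnS => h.
apply: le_trans h; rewrite ler_wpM2l ?normc_ge0// lerXn2r ?nnegrE ?addr_ge0//.
by rewrite -updnE -!addrA lerD2l -!natrD ler_nat; lia.
Qed.

(** For [n != 0] the diagonal starts in a row or column not divisible by [s], so its first entry is,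
    up to sign, one of [comm V G] or [comm Vs G]; for [n = 0] the operator norm bounds it. [2 ^+ p]
    pays for the passage from [k] to [k + 1]. *)
Lemma diag_entry_init p : exists2 B : R, 0 <= B & forall n l, ~~ (sz %| l)%Z ->
  normc (diag_entry n 0 l) * (1 + `|n|%:R) ^+ p <= B.
Proof.
have [B B0 HB] := HG p; exists (2 ^+ p * B + opnorm G).
  by rewrite addr_ge0 ?opnorm_ge0// mulr_ge0 ?exprn_ge0.
move=> n l dl; rewrite /diag_entry !addn0.
have two (x : R) (k : nat) : x * (1 + k%:R) ^+ p <= B -> 0 <= x ->
    x * (1 + k.+1%:R) ^+ p <= 2 ^+ p * B + opnorm G.
  move=> xB x0; apply: (@le_trans _ _ (2 ^+ p * B)); last by rewrite lerDl opnorm_ge0.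
  rewrite [leRHS]mulrC; apply: (@le_trans _ _ (x * (1 + k%:R) ^+ p * 2 ^+ p)).
    rewrite -mulrA -exprMn ler_wpM2l// lerXn2r ?nnegrE ?mulr_ge0 ?addr_ge0//.
    by have := ler0n R k; rewrite -natr1; move: (k%:R : R) => y; lra.
  by rewrite ler_wpM2r ?exprn_ge0.
case: n => [[|k]|k]; rewrite /upn /dnn.
- rewrite addr0 expr1n mulr1; apply: le_trans (ent_le _ _ _) _.
  by rewrite lerDr mulr_ge0 ?exprn_ge0.
- apply: two; last exact: normc_ge0.
  have := ent_decay (sz ^+ k * l) l (fun M => (HB M).2).
  rewrite ent_commVs0// mulrA -exprS expr0 mul1r => h; apply: le_trans h.
  rewrite ler_wpM2l ?normc_ge0// lerXn2r ?nnegrE ?addr_ge0//.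
  by rewrite nu_cop// lerDl.
- apply: (two _ k); last exact: normc_ge0.
  have := ent_decay l (sz ^+ k * l) (fun M => (HB M).1).
  rewrite ent_commV0// normcN mulrA -exprS expr0 mul1r => h; apply: le_trans h.
  rewrite ler_wpM2l ?normc_ge0// lerXn2r ?nnegrE ?addr_ge0//.
  by rewrite nu_cop// nu_cop0// addr0.
Qed.

(** Two of the powers are spent on summing the increments. *)
Lemma telescope_decay (u : nat -> R[i]) (x B : R) p : 0 <= x -> 0 <= B ->
  (forall k : nat, normc (u k.+1 - u k) * (1 + k%:R + x) ^+ (p + 2) <= B) ->
  forall m m', (m <= m')%N -> normc (u m' - u m) * (1 + m%:R + x) ^+ p <= 2 * B.
Proof.
move=> x0 B0 uB m m' mm'; rewrite -telescope_sumr//.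
apply: le_trans (ler_wpM2r _ (normc_sum _ _ _)) _; first by rewrite exprn_ge0 ?addr_ge0.
rewrite mulr_suml big_nat; apply: (@le_trans _ _ (\sum_(m <= k < m') B * (1 + k%:R) ^- 2)).
  rewrite big_nat; apply: ler_sum => k /andP[mk _].
  rewrite ler_pdivlMr ?exprn_gt0 ?ltr_pwDl//; apply: le_trans (uB k); rewrite exprD [leRHS]mulrA.
  apply: ler_pM; rewrite ?mulr_ge0 ?exprn_ge0 ?addr_ge0 ?normc_ge0//.
    rewrite ler_wpM2l ?normc_ge0// lerXn2r ?nnegrE ?addr_ge0//.
    by rewrite lerD2r lerD2l ler_nat.
  by rewrite lerXn2r ?nnegrE ?addr_ge0// lerDl.
rewrite -mulr_sumr mulrC ler_wpM2r//; apply: le_trans (sum_inv_sq R m').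
rewrite -(big_mkord xpredT (fun k : nat => (1 + k%:R : R) ^- 2)) (@big_cat_nat _ _ _ m 0 m')//= lerDr.
by apply: sumr_ge0 => k _; rewrite invr_ge0 exprn_ge0 ?addr_ge0.
Qed.

End EntryDecay.

(** * Limits along the diagonals and integer approximation *)

Section Reconstruction.
Variables (R : realType) (s : nat).
Hypothesis hs : (2 <= s)%N.
Notation sz := (s%:Z).
Notation E := (basis_vec R).
Notation V := (V R s).
Notation Vs := (Vs R s).
Notation Nw := (Nw R s).
Implicit Types (A X D : bop R) (W : int -> R[i]) (k l : int) (i j m p r M : nat) (n : int).

Variable G : bop R.
Hypothesis HSG : HS s G.
Hypothesis HG : forall p, exists2 B, 0 <= B & forall M,
  weight_norm (Nw M) p (comm V G) <= B /\ weight_norm (Nw M) p (comm Vs G) <= B.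
Notation g := (diag_entry s G).

Let cop1 : ~~ (sz %| 1)%Z.
Proof. by rewrite dvdz1 absz_nat; case: s hs => [|[|]]. Qed.

Lemma diag_entry_tail p : exists2 B : R, 0 <= B & forall n m m' l, ~~ (sz %| l)%Z -> (m <= m')%N ->
  normc (g n m' l - g n m l) * (1 + m%:R + `|n|%:R) ^+ p <= B.
Proof.
have [B B0 HB] := diag_entry_step hs HG (p + 2); exists (2 * B); first by rewrite mulr_ge0.
by move=> n m m' l dl; apply: (telescope_decay (u := fun m => g n m l)) => // k; exact: HB.
Qed.

Lemma le_inv_eps (B e : R) : 0 < e -> exists N : nat, forall m, (N <= m)%N -> B <= e * (1 + m%:R).
Proof.
move=> e0; exists (Num.truncn (B / e)) => m Nm; rewrite mulrC -ler_pdivrMr// ltW//.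
by apply: lt_le_trans (truncnS_gt _) _; rewrite addrC natr1 ler_nat ltnS.
Qed.

Lemma diag_entry_is_cvg n l : ~~ (sz %| l)%Z -> exists z, ccvg (fun m => g n m l) z.
Proof.
move=> dl; apply: ccvg_complete => e e0; have [B B0 HB] := diag_entry_tail 1.
have [N HN] := le_inv_eps B e0; exists N => m m' Nm Nm'.
wlog mm' : m m' Nm Nm' / (m' <= m)%N => [W|].
  by have [|/ltnW] := leqP m' m; [exact: W|rewrite normc_distC; exact: W].
have m0 : 0 < 1 + m'%:R + `|n|%:R :> R by rewrite !ltr_pwDl.
rewrite -(ler_pM2r m0); have := HB n m' m l dl mm'; rewrite expr1 => /le_trans; apply.
by apply: le_trans (HN _ Nm') _; rewrite ler_wpM2l ?(ltW e0)// lerDl.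
Qed.

(** Read off along [l = 1]; by [const_symbol] every [l] not divisible by [s] gives the same limit,
    see [diag_entry_cvg]. *)
Definition diag_limit n : R[i] := xget 0 [set z | ccvg (fun m => g n m 1) z].

Lemma diag_entry_cvg n l : ~~ (sz %| l)%Z -> ccvg (fun m => g n m l) (diag_limit n).
Proof.
move=> dl; have [_ _ HGc] := HS_entries hs HSG.
have H1 : ccvg (fun m => g n m 1) (diag_limit n).
  by apply: (@xgetPex _ _ [set z | ccvg (fun m => g n m 1) z]); exact: diag_entry_is_cvg.
move=> e e0; have e2 : 0 < e / 2 by rewrite divr_gt0.
have [N HN] := H1 _ e2; have [r0 Hr0] := HGc (upn n) (dnn n) _ e2.
exists (maxn N r0) => m; rewrite geq_max => /andP[Nm rm].
apply: le_trans (normc_triangle _ (g n m 1) _) _; rewrite [e]splitr lerD ?HN//.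
exact: Hr0.
Qed.

Lemma diag_entry_decay p : exists2 B : R, 0 <= B & forall n m l, ~~ (sz %| l)%Z ->
  normc (g n m l - diag_limit n) * (1 + m%:R + `|n|%:R) ^+ p <= B.
Proof.
have [B B0 HB] := diag_entry_tail p; exists B => // n m l dl.
have m0 : 0 < (1 + m%:R + `|n|%:R) ^+ p :> R by rewrite exprn_gt0// !ltr_pwDl.
rewrite -ler_pdivlMr// normc_distC.
apply: (@ccvg_normc_le _ (fun m' => g n m' l - g n m l)).
  by apply: ccvgB; [exact: diag_entry_cvg|exact: ccvg_cst].
by exists m => m' mm'; rewrite ler_pdivlMr//; exact: HB.
Qed.

Lemma diag_limit_rdz : rapid_int diag_limit.
Proof.
move=> p; have [B B0 HB] := diag_entry_decay p; have [C C0 HC] := diag_entry_init hs HG p.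
exists (B + C); first exact: addr_ge0.
move=> n; have n0 : 0 <= (1 + `|n|%:R) ^+ p :> R by rewrite exprn_ge0// addr_ge0.
have : normc (diag_limit n) <= normc (g n 0 1 - diag_limit n) + normc (g n 0 1).
  have := normc_triangle (diag_limit n) (g n 0 1) 0; rewrite !subr0.
  by rewrite [normc (diag_limit n - _)]normc_distC.
move=> h; apply: le_trans (ler_wpM2r n0 h) _; rewrite mulrDl; apply: lerD; last exact: HC.
by have := HB n 0%N 1 cop1; rewrite addr0.
Qed.

(** The integer with the first [K] digits of [x]: matrix entries are known at integers only, and
    these approach [x]. *)
Definition trunc_digits (x : Zs s) (K : nat) : int := \sum_(j < K) (nat_of_ord (x j : 'Z_s))%:Z * sz ^+ j.

Lemma Zs_digit_val l : (nat_of_ord (l%:~R : 'Z_s))%:Z = (l %% sz)%Z.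
Proof.
have s0 : sz != 0 by rewrite gt_eqF// (sz_gt0 hs).
rewrite {1}(divz_eq l sz) intrD intrM (sZ_eq0 hs) mulr0 add0r.
have r0 := modz_ge0 l s0.
have rs : (`|(l %% sz)%Z| < s)%N by have := ltz_pmod l (sz_gt0 hs); lia.
rewrite -[in LHS](gez0_abs r0) -pmulrn Zp_nat /= Zp_cast// modn_small//.
by rewrite gez0_abs.
Qed.

Lemma trunc_digits_int l K : (sz ^+ K %| l - trunc_digits (Zs_of_int s l) K)%Z.
Proof.
suff e : l = trunc_digits (Zs_of_int s l) K + (l %/ sz ^+ K)%Z * sz ^+ K.
  by rewrite {1}e [X in X - _]addrC addrK dvdz_mull.
elim: K => [|K IH]; first by rewrite /trunc_digits big_ord0 add0r expr0 divz1 mulr1.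
rewrite /trunc_digits big_ord_recr /= -/(trunc_digits _ K) Zs_digit_val.
rewrite [in RHS]exprSr divzMA_ge0 ?exprn_ge0 ?ltW ?(sz_gt0 hs)//.
rewrite [X in _ + X + _](_ : _ = (l %/ sz ^+ K)%Z * sz ^+ K - ((l %/ sz ^+ K)%Z %/ sz)%Z * (sz ^+ K * sz)).
  by rewrite -addrA subrK -IH.
by rewrite {2}(divz_eq (l %/ sz ^+ K)%Z sz); ring.
Qed.

Lemma trunc_digits_cyl (x y : Zs s) K : cyl x K y -> trunc_digits y K = trunc_digits x K.
Proof. by move=> xy; apply: eq_bigr => j _; rewrite xy. Qed.

Lemma trunc_digits_dvd (x : Zs s) K K' : (K <= K')%N ->
  (sz ^+ K %| trunc_digits x K' - trunc_digits x K)%Z.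
Proof.
move=> /subnKC <-; rewrite /trunc_digits big_split_ord /= [X in (_ %| X)%Z]addrC addKr.
elim/big_ind: _ => [|a b da db|j _]; [exact: dvdz0|exact: rpredD|].
by rewrite exprD mulrCA dvdz_mulr ?dvdzz.
Qed.

(** At least one digit is kept, hence [K.+1]: the lowest digit decides divisibility by [s]. *)
Lemma trunc_digits_cop (x : Zs s) K : Zs_unit x -> ~~ (sz %| trunc_digits x K.+1)%Z.
Proof.
move=> x0; have := trunc_digits_dvd x (ltn0Sn K); rewrite expr1.
rewrite [trunc_digits x 1]/trunc_digits big_ord_recl big_ord0 addr0 expr0 mulr1 /=.
move=> d; rewrite -(subrK (nat_of_ord (x 0%N : 'Z_s))%:Z (trunc_digits x K.+1)) rpredDl//.
move: x0; rewrite /Zs_unit /=; apply: contraNN.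
move=> /dvdzP[q e]; apply/eqP/val_inj => /=.
have := ltn_ord (x 0%N : 'Z_s); rewrite [X in (_ < X)%N](Zp_cast hs) => xs.
have qs : q < 1 by rewrite -(ltr_pM2r (sz_gt0 hs)) mul1r -e ltz_nat.
have q0 : -1 < q by rewrite -(ltr_pM2r (sz_gt0 hs)) -e; have := sz_gt0 hs; lia.
by have q00 : q = 0; [lia|move: e; rewrite q00 mul0r => -[->]].
Qed.

End Reconstruction.

(** * Extension of the diagonals to Z_s^x *)

Section AdicExtension.
Variables (R : realType) (s : nat).
Hypothesis hs : (2 <= s)%N.
Notation sz := (s%:Z).
Notation V := (V R s).
Notation Vs := (Vs R s).
Notation Nw := (Nw R s).
Implicit Types (k l : int) (i j m p r M : nat) (n : int) (x y : Zs s).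

Variable G : bop R.
Hypothesis HSG : HS s G.
Hypothesis HG : forall p, exists2 B, 0 <= B & forall M,
  weight_norm (Nw M) p (comm V G) <= B /\ weight_norm (Nw M) p (comm Vs G) <= B.
Notation g := (diag_entry s G).
Notation diag_limit := (diag_limit s G).

(** A limit over integer approximations of [q.2], which [K.+1] keeps prime to the case of
    divisibility by [s]. The value 0 outside the units is a convention that lets closeness and decay
    hold for all [x]. *)
Definition diag_entry_ext n (q : nat * Zs s) : R[i] :=
  if q.2 0%N == 0 :> 'Z_s then 0 else
  xget 0 [set z | ccvg (fun K => g n q.1 (trunc_digits q.2 K.+1) - diag_limit n) z].

Lemma dvdz_expS K K' (z : int) : (K <= K')%N -> (sz ^+ K' %| z)%Z -> (sz ^+ K %| z)%Z.
Proof. by move=> KK; apply: dvdz_trans; exact: dvdz_exp2l. Qed.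

Lemma diag_entry_ext_cvg n m x : Zs_unit x ->
  ccvg (fun K => g n m (trunc_digits x K.+1) - diag_limit n) (diag_entry_ext n (m, x)).
Proof.
move=> x0; rewrite /diag_entry_ext /= (negbTE x0).
apply: (@xgetPex _ 0 [set z | ccvg (fun K => g n m (trunc_digits x K.+1) - diag_limit n) z]).
apply: ccvg_complete => e e0; have [_ HGu _] := HS_entries hs HSG.
have [K HK] := HGu (upn n + m)%N (dnn n + m)%N e e0.
exists K => k k' Kk Kk'; rewrite opprB addrA subrK; apply: HK; try exact: trunc_digits_cop.
have -> : trunc_digits x k.+1 - trunc_digits x k'.+1 =
  (trunc_digits x k.+1 - trunc_digits x K) - (trunc_digits x k'.+1 - trunc_digits x K) by ring.
by apply: rpredB; apply: trunc_digits_dvd => //; exact: leqW.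
Qed.

Lemma diag_entry_ext_close n m (e : R) : 0 < e -> exists K, forall x y, cyl x K y ->
  normc (diag_entry_ext n (m, x) - diag_entry_ext n (m, y)) <= e.
Proof.
move=> e0; have [_ HGu _] := HS_entries hs HSG.
have [K HK] := HGu (upn n + m)%N (dnn n + m)%N e e0.
(* At least one common digit, so that [x] and [y] are units together. *)
exists K.+1 => x y xy; have xy0 := xy 0%N (ltn0Sn K).
have [x0|x0] := eqVneq (x 0%N : 'Z_s) 0.
  by rewrite /diag_entry_ext /= xy0 x0 eqxx subrr normc0 ltW.
have y0 : Zs_unit y by rewrite /Zs_unit/= xy0.
apply: (ccvg_normc_le (ccvgB (diag_entry_ext_cvg n m x0) (diag_entry_ext_cvg n m y0))).
exists K => k Kk; rewrite opprB addrA subrK; apply: HK; try exact: trunc_digits_cop.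
have -> : trunc_digits x k.+1 - trunc_digits y k.+1 =
  (trunc_digits x k.+1 - trunc_digits x K.+1) - (trunc_digits y k.+1 - trunc_digits y K.+1).
  by rewrite (trunc_digits_cyl xy); ring.
by apply: rpredB; apply: (dvdz_expS (leqnSn K)); exact: trunc_digits_dvd.
Qed.

Lemma diag_entry_ext_int n m l : ~~ (sz %| l)%Z -> diag_entry_ext n (m, Zs_of_int s l) = g n m l - diag_limit n.
Proof.
move=> dl; have x0 := (Zs_of_int_unit hs l).2 dl.
apply: ccvg_unique (diag_entry_ext_cvg n m x0) _ => e e0; have [_ HGu _] := HS_entries hs HSG.
have [K HK] := HGu (upn n + m)%N (dnn n + m)%N e e0.
exists K => k Kk; rewrite opprB addrA subrK; apply: HK => //; first exact: trunc_digits_cop.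
by rewrite -opprB rpredN; apply: (dvdz_expS (leqW Kk)); exact: trunc_digits_int.
Qed.

Lemma diag_entry_ext_decay p : exists2 B : R, 0 <= B & forall n m x,
  normc (diag_entry_ext n (m, x)) * (1 + m%:R + `|n|%:R) ^+ p <= B.
Proof.
have [B B0 HB] := diag_entry_decay hs HSG HG p; exists B => // n m x.
have [x0|x0] := eqVneq (x 0%N : 'Z_s) 0.
  by rewrite /diag_entry_ext /= x0 eqxx normc0 mul0r.
have m0 : 0 < (1 + m%:R + `|n|%:R) ^+ p :> R by rewrite exprn_gt0// !ltr_pwDl.
rewrite -ler_pdivlMr//; apply: ccvg_normc_le (diag_entry_ext_cvg n m x0) _.
by exists 0%N => K _; rewrite ler_pdivlMr//; apply: HB; exact: trunc_digits_cop.
Qed.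

Lemma Zs_unit_closed : closed (@Zs_unit s).
Proof.
move=> x clx; have [y [y0 /(_ 0%N (ltn0Sn 0)) xy]] := clx _ (cyl_nbhs x 1).
by move: y0; rewrite /Zs_unit /= xy.
Qed.

Lemma diag_entry_ext_C0 n : C0_units (diag_entry_ext n).
Proof.
split.
  apply: continuous_subspaceT => -[m x]; apply/continuous_dist => e e0.
  have [K HK] := diag_entry_ext_close n m e0.
  exists ([set m], cyl x K); first by split => //=; exact: cyl_nbhs.
  by move=> [m' y] [/= -> xy]; exact: HK.
move=> e e0; have [B B0 HB] := diag_entry_ext_decay 1.
have e2 : 0 < e / 2 by rewrite divr_gt0.
have [N HN] := le_inv_eps B e2.
(* Decay in [m] leaves finitely many copies of the set of units, which is compact. *)
exists ([set m | (m < N)%N] `*` @Zs_unit s); split.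
- apply: compact_setX; last first.
    exact: (subclosed_compact Zs_unit_closed (@Zs_compact s)).
  exact: (finite_compact (finite_II N)).
- by move=> [m x] [].
move=> [m x] /= x0 NK; have Nm : (N <= m)%N by rewrite leqNgt; apply/negP => mN; exact: NK.
have m0 : 0 < 1 + m%:R + `|n|%:R :> R by rewrite !ltr_pwDl.
rewrite -(ltr_pM2r m0); have := HB n m x; rewrite expr1 => /le_lt_trans; apply.
apply: le_lt_trans (HN _ Nm) _; apply: (@lt_le_trans _ _ (e * (1 + m%:R))).
  by rewrite ltr_pM2r ?ltr_pwDl// ltr_pdivrMr// ltr_pMr// ltr1n.
by rewrite ler_wpM2l ?(ltW e0)// lerDl.
Qed.

Lemma diag_entry_ext_rapid : rapid_decay (fun m n => sup [set normc (diag_entry_ext n (m, x)) | x in @Zs_unit s]).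
Proof.
move=> p; have [B B0 HB] := diag_entry_ext_decay p; exists B => m n.
have m0 : 0 < (1 + m%:R + `|n|%:R) ^+ p :> R by rewrite exprn_gt0// !ltr_pwDl.
(* The unit 1 makes the set under the supremum nonempty. *)
have u1 : Zs_unit (Zs_of_int s 1).
  by apply/(Zs_of_int_unit hs); rewrite dvdz1 absz_nat; case: s hs => [|[|]].
have ub x : normc (diag_entry_ext n (m, x)) <= B / (1 + m%:R + `|n|%:R) ^+ p by rewrite ler_pdivlMr.
have le : sup [set normc (diag_entry_ext n (m, x)) | x in @Zs_unit s] <= B / (1 + m%:R + `|n|%:R) ^+ p.
  by apply: ge_sup => [|_ [x _ <-]//]; exists (normc (diag_entry_ext n (m, Zs_of_int s 1))), (Zs_of_int s 1).
rewrite ger0_norm -?ler_pdivlMr//; apply: le_trans (normc_ge0 (diag_entry_ext n (m, Zs_of_int s 1))) _.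
apply: ub_le_sup; last by exists (Zs_of_int s 1).
by exists (B / (1 + m%:R + `|n|%:R) ^+ p) => _ [x _ <-].
Qed.

End AdicExtension.

(** * Assembling the Toeplitz part and the ideal part *)

Section Synthesis.
Variables (R : realType) (s : nat).
Hypothesis hs : (2 <= s)%N.
Notation sz := (s%:Z).
Notation E := (basis_vec R).
Notation V := (V R s).
Notation Vs := (Vs R s).
Notation Nw := (Nw R s).
Implicit Types (A B : bop R) (W : int -> R[i]) (k l : int) (i j m p r M : nat) (n : int).

(** The vectors [xi] involve nonzero indices only, and by [at_zero] they recover the value at
    [E_0]. *)
Lemma at_zero_eq A B : at_zero s A -> at_zero s B ->
  (forall l, l != 0 -> A (E l) = B (E l)) -> A = B.
Proof.
move=> zA zB AB.
have xiE K : A (xi R s K) = B (xi R s K).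
  by rewrite /xi !bop_sum; apply: eq_bigr => r _; rewrite AB// (szX_neq0 hs).
have D : ent A 0 0 = ent B 0 0.
  apply/eqP; rewrite -subr_eq0; apply/eqP/eq0_normc/eqP; rewrite eq_le normc_ge0 andbT.
  apply/ler_addgt0Pr => e e0; rewrite add0r; have e2 : 0 < e / 2 by rewrite divr_gt0.
  have [K1 H1] := zA.2 _ e2; have [K2 H2] := zB.2 _ e2.
  have [K0 H0] := xi_large hs (1 : R) ltr01.
  pose K := maxn (maxn K1 K2) K0.
  have x0 : 0 < l2norm (xi R s K).
    by have := H0 K (leq_maxr _ _); rewrite mul1r; exact: lt_le_trans ltr01.
  rewrite -(ler_pM2r x0) -l2normZ scalerBl.
  have -> : ent A 0 0 *: xi R s K - ent B 0 0 *: xi R s K =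
     (B (xi R s K) - ent B 0 0 *: xi R s K) - (A (xi R s K) - ent A 0 0 *: xi R s K).
    by rewrite xiE opprB [RHS]addrC addrA subrK.
  apply: le_trans (l2normD _ _) _; rewrite l2normN [e]splitr mulrDl.
  apply: lerD; [apply: H2|apply: H1]; rewrite /K; apply: leq_trans (leq_maxl _ _).
    exact: leq_maxr.
  exact: leq_maxl.
apply: bop_ext => l; have [->|l0] := eqVneq l 0; last exact: AB.
by rewrite (at_zero_basis zA) (at_zero_basis zB) D.
Qed.

Definition shifted_diag n W : bop R :=
  match n with Posz j => V ^+ j * dg W | Negz j => dg W * Vs ^+ j.+1 end.

Lemma ent_shifted_diag n W k l : bdd W -> ent (shifted_diag n W) k l =
  match n with
  | Posz j => W l * (k == sz ^+ j * l)%:R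
  | Negz j => W k * (sz ^+ j.+1 * k == l)%:R
  end.
Proof.
move=> bW; case: n => j.
  by rewrite /ent bop_mulE dg_basis// bopZ l2Z (VX_basis R hs) basis_vecE.
by rewrite /ent bop_mulE dgE// VsXE// basis_vecE.
Qed.

Lemma at_zero_shifted_diag n W : bdd W -> lim_zero s W -> at_zero s (shifted_diag n W).
Proof.
move=> bW lW; have zW := at_zero_dg hs bW lW; have [zV zVs] := at_zeroV R hs.
case: n => j; first exact: (at_zeroM (at_zeroX hs j zV) zW).
exact: (at_zeroM zW (at_zeroX hs j.+1 zVs)).
Qed.

Lemma ent_sum (I : Type) (r : seq I) (F : I -> bop R) k l :
  ent (\sum_(i <- r) F i) k l = \sum_(i <- r) ent (F i) k l.
Proof. by rewrite /ent bop_sumE l2_sum. Qed.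

Lemma bilateral_pick (f : int -> R[i]) n0 : (forall n, n != n0 -> f n = 0) ->
  exists N0, forall N, (N0 <= N)%N -> \sum_(j < N) (f (Posz j) + f (Negz j)) = f n0.
Proof.
move=> f0; case: n0 f0 => j0 f0; exists j0.+1 => N jN; rewrite (bigD1 (Ordinal jN)) //=.
  rewrite [X in _ + X]big1 ?addr0 => [|j jj]; first by rewrite (f0 (Negz j0))// addr0.
  by rewrite !f0 ?addr0.
rewrite [X in _ + X]big1 ?addr0 => [|j jj]; first by rewrite (f0 (Posz j0))// add0r.
by rewrite !f0 ?addr0.
Qed.

Lemma szX_cop_eq i j l : ~~ (sz %| l)%Z -> (sz ^+ i * l == sz ^+ j * l) = (i == j).
Proof.
move=> dl; apply/eqP/eqP => [e|->//].
by have := congr1 (nu s) e; rewrite !nu_cop.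
Qed.

Lemma orb_cop k l : l != 0 -> orb s k l ->
  exists i j l', [/\ ~~ (sz %| l')%Z, k = sz ^+ i * l' & l = sz ^+ j * l'].
Proof.
move=> l0 [i [j e]]; have k0 : k != 0.
  apply: contraNneq l0 => k0; move: e; rewrite k0 mulr0 => /esym/eqP.
  by rewrite mulf_eq0 (negbTE (szX_neq0 hs _)).
have [a [k' [kE dk]]] := cop_decomp hs k0; have [b [l' [lE dl]]] := cop_decomp hs l0.
exists a, b, l'; split=> //; rewrite kE; congr (_ * _).
by have := congr1 (unit_part s) e; rewrite kE lE !mulrA -!exprD !unit_part_cop.
Qed.

Variable G : bop R.
Hypothesis HSG : HS s G.
Hypothesis HG : forall p, exists2 B, 0 <= B & forall M,
  weight_norm (Nw M) p (comm V G) <= B /\ weight_norm (Nw M) p (comm Vs G) <= B.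
Notation g := (diag_entry s G).
Notation diag_limit := (diag_limit s G).
Notation F := (diag_entry_ext (s := s) G).

(** Toeplitz and ideal contributions of one diagonal together. At [l = 0] only the limit remains,
    which makes the symbol continuous there. *)
Definition diag_symbol n l : R[i] := diag_limit n + WF (F n) l.

Lemma diag_symbol_cop n m l : ~~ (sz %| l)%Z -> diag_symbol n (sz ^+ m * l) = g n m l.
Proof.
move=> dl; rewrite /diag_symbol /WF mulf_eq0 (negbTE (szX_neq0 hs _)) /=.
case: eqP dl => [->|_ dl]; first by rewrite dvdz0.
by rewrite nu_cop// unit_part_cop// (diag_entry_ext_int hs HSG)// subrKC.
Qed.

Lemma WF_decay p : exists2 B : R, 0 <= B & forall n l,
  normc (WF (F n) l) * (1 + (nu s l)%:R + `|n|%:R) ^+ p <= B.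
Proof.
have [B B0 HB] := diag_entry_ext_decay hs HSG HG p; exists B => // n l.
by rewrite /WF; case: eqP => _; [rewrite normc0 mul0r|exact: HB].
Qed.

Lemma WFg_bdd n : bdd (WF (F n)).
Proof. by apply: (WF_bdd hs); exact: diag_entry_ext_C0. Qed.

Lemma diag_symbol_bdd n : bdd (diag_symbol n).
Proof.
have [B HB] := WFg_bdd n; exists (normc (diag_limit n) + B) => l.
by apply: le_trans (le_normcD _ _) _; rewrite lerD2l.
Qed.

Lemma diag_symbol_lim_zero n : lim_zero s (diag_symbol n).
Proof.
move=> e e0; have [B B0 HB] := WF_decay 1; have [N HN] := le_inv_eps B e0.
exists N => l dl; rewrite /diag_symbol opprD addrACA subrr add0r [WF _ 0]/WF eqxx subr0.
have [->|l0] := eqVneq l 0; first by rewrite /WF eqxx normc0 ltW.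
have Nnu : (N <= nu s l)%N.
  have [m [l' [lE dl']]] := cop_decomp hs l0; move: dl.
  by rewrite lE nu_cop// szX_dvd_cop.
have m0 : 0 < 1 + (nu s l)%:R + `|n|%:R :> R by rewrite !ltr_pwDl.
rewrite -(ler_pM2r m0); have := HB n l; rewrite expr1 => /le_trans; apply.
by apply: le_trans (HN _ Nnu) _; rewrite ler_wpM2l ?(ltW e0)// lerDl.
Qed.

Lemma dg_addcst (z : R[i]) W : bdd W -> dg (fun l => z + W l) = z *: (1 : bop R) + dg W.
Proof.
move=> bW; apply: bop_ext => l; rewrite bop_addE bop_scaleE bop_oneE !dg_basis ?scalerDl//.
by case: bW => B HB; exists (normc z + B) => k; apply: le_trans (le_normcD _ _) _; rewrite lerD2l.
Qed.

Lemma shifted_diag_symbolE n (phi : R -> R[i]) : fourier_coef phi n = diag_limit n ->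
  toeplitz_term s phi n + Iinf_term F n = shifted_diag n (diag_symbol n).
Proof.
move=> phin; have bW := WFg_bdd n; rewrite (toeplitz_termE hs) (Iinf_termE hs bW) phin.
rewrite /shifted_diag /diag_symbol dg_addcst//; case: n {phin bW} => j.
  by rewrite mulrDr -bop_scaleAr mulr1.
by rewrite mulrDl -bop_scaleAl mul1r.
Qed.

(** A pair in one orbit with [l != 0] lies on exactly one diagonal, where the symbol returns the
    entry of [G]; an entry of the bilateral sum thus has at most one nonzero term. *)
Lemma ent_shifted_diag_symbol k l : l != 0 -> exists n0 : int,
  (forall n, n != n0 -> ent (shifted_diag n (diag_symbol n)) k l = 0) /\
  ent (shifted_diag n0 (diag_symbol n0)) k l = ent G k l.
Proof.
move=> l0; have [kl|kl] := pselect (orb s k l); last first.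
  have T0 n' : ent (shifted_diag n' (diag_symbol n')) k l = 0.
    rewrite ent_shifted_diag; last exact: diag_symbol_bdd.
    case: n' => j; case: eqP => [e|_]; rewrite ?mulr0//; case: kl.
      by exists 0%N, j; rewrite e expr0 mul1r.
    by exists j.+1, 0%N; rewrite e expr0 mul1r.
  (* No diagonal meets this pair, so any index serves as witness. *)
  exists 0; split=> [n' _|]; rewrite T0//; symmetry.
  by have [HGo _ _] := HS_entries hs HSG; exact: HGo.
have [a [b [l' [dl -> ->]]]] := orb_cop l0 kl.
have [ba|ab] := leqP b a.
  exists (Posz (a - b)); split=> [[j|j] jn|]; rewrite ent_shifted_diag; try exact: diag_symbol_bdd.
  - rewrite mulrA -exprD szX_cop_eq//; case: eqP => [e|_]; last by rewrite mulr0.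
    by case/negP: jn; apply/eqP; congr Posz; lia.
  - rewrite mulrA -exprD szX_cop_eq//; case: eqP => [e|_]; last by rewrite mulr0.
    by lia.
  - by rewrite mulrA -exprD subnK// eqxx mulr1 diag_symbol_cop// /diag_entry /= subnK.
exists (Negz (b - a.+1)); split=> [[j|j] jn|]; rewrite ent_shifted_diag; try exact: diag_symbol_bdd.
- rewrite mulrA -exprD szX_cop_eq//; case: eqP => [e|_]; last by rewrite mulr0.
  by lia.
- rewrite mulrA -exprD szX_cop_eq//; case: eqP => [e|_]; last by rewrite mulr0.
  by case/negP: jn; apply/eqP; congr Negz; lia.
- rewrite mulrA -exprD szX_cop_eq// (_ : (b - a.+1).+1 + a = b)%N; last by lia.
  by rewrite eqxx mulr1 diag_symbol_cop// /diag_entry /= (_ : (b - a.+1).+1 + a = b)%N; last by lia.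
Qed.

(** Both series converge in norm by the decay of their coefficients, and their sum has the entries
    of [G] in all columns [l != 0]. Column 0 follows because [at_zero] is stable under norm
    limits. *)
Lemma HSinf_of_bounds : HSinf s G.
Proof.
have [phi sphi phiE] := fourier_synthesis (diag_limit_rdz hs HSG HG).
have rp : rapid_int (fourier_coef phi).
  by move=> p; have [C C0 HC] := diag_limit_rdz hs HSG HG p; exists C => // n; rewrite phiE.
have cT := toeplitz_cvg hs rp.
have [B B0 HB] := WF_decay 2.
have WB n j : (1 + j%:R <= 1 + `|n|%:R :> R) -> forall l, normc (WF (F n) l) <= B * (1 + j%:R) ^- 2.
  move=> jn l; rewrite ler_pdivlMr ?exprn_gt0 ?ltr_pwDl//; apply: le_trans (HB n l).
  rewrite ler_wpM2l ?normc_ge0// lerXn2r ?nnegrE ?addr_ge0//.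
  by apply: le_trans jn _; rewrite lerD2r lerDl.
have [||c cc] := @bil_cvg R (Iinf_term F) B B0.
- move=> j; rewrite (Iinf_termE hs (WFg_bdd _)); apply: le_trans (opnormM _ _) _.
  rewrite -[leRHS]mul1r; apply: ler_pM; [exact: opnorm_ge0|exact: opnorm_ge0|exact: opnorm_VX|].
  by apply: dg_opnorm; exact: WB.
- move=> j; rewrite (Iinf_termE hs (WFg_bdd _)); apply: le_trans (opnormM _ _) _.
  rewrite -[leRHS]mulr1; apply: ler_pM; [exact: opnorm_ge0|exact: opnorm_ge0| |exact: opnorm_VsX].
  by apply: dg_opnorm; apply: WB; rewrite lerD2l ler_nat.
exists phi, c; split=> //.
  exists F; split; [by move=> n; exact: diag_entry_ext_C0|exact: diag_entry_ext_rapid|exact/opcvgP].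
pose S N := \sum_(j < N) (shifted_diag (Posz j) (diag_symbol (Posz j)) + shifted_diag (Negz j) (diag_symbol (Negz j))).
have SE N : S N = bilateral_series (toeplitz_term s phi) N + bilateral_series (Iinf_term F) N.
  rewrite !bilateral_seriesE -big_split /=; apply: eq_bigr => j _.
  by rewrite -!(shifted_diag_symbolE (phiE _)) addrACA.
have cS : opcvg S (toeplitz s phi + c).
  move=> e e0; have e2 : 0 < e / 2 by rewrite divr_gt0.
  have [N1 H1] := cT _ e2; have [N2 H2] := cc _ e2; exists (maxn N1 N2) => N.
  rewrite geq_max => /andP[N1N N2N]; rewrite SE opprD addrACA [e]splitr.
  by apply: le_trans (opnormD _ _) _; apply: lerD; [exact: H1|exact: H2].
apply: at_zero_eq; first exact: HS_at_zero.
  apply: at_zero_approx => e e0; have [N HN] := cS e e0.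
  exists (S N); last by rewrite opnorm_distC; exact: HN.
  rewrite /S; elim/big_ind: _ => [|X Y|j _]; [exact: at_zero0|exact: at_zeroD|].
  by apply: at_zeroD; apply: at_zero_shifted_diag; try exact: diag_symbol_bdd; exact: diag_symbol_lim_zero.
move=> l l0; apply: l2_ext => k; rewrite -[LHS]/(ent G k l) -[RHS]/(ent (toeplitz s phi + c) k l).
have [n0 [Hn0 En0]] := ent_shifted_diag_symbol k l0; rewrite -En0.
apply: (@ccvg_unique _ (fun N => ent (S N) k l)); last exact: ent_cvg.
have [N0 HN0] := bilateral_pick Hn0.
apply: ccvg_eq (ccvg_cst _); exists N0 => N NN; rewrite /S ent_sum -(HN0 N NN).
by apply: eq_bigr => j _; rewrite entD.
Qed.

End Synthesis.

Theorem theorem3p13 (R : realType) (s : nat) (hs : (2 <= s)%N)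
  (a : bop R) (ha : HSinf s a) (sa : self_adjoint a)
  (U : set R) (oU : open U) (aU : real_spectrum s a `<=` U)
  (g : R -> R[i]) (hg : smooth_on U g)
  (Phi : (R -> R[i]) -> bop R) (hPhi : continuous_calculus s a Phi) :
  HSinf s (Phi g).
Proof.
have [C HC] := HSinf_bounds hs ha.
have [HSg Hg] := smooth_calculus_bounds hs hPhi HC oU aU hg.
exact: HSinf_of_bounds.
Qed.
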